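(* Assume the consistency of ZF. Then there is a model of $\mathrm{ZFU}_{\mathrm{R}}$ in which Plenitude holds, Duplication holds, and Collection fails.
   Context: The language of urelement set theory has $\in$ and a unary predicate $\mathcal{A}$ for urelements. $\mathrm{ZFU}_{\mathrm{R}}$ = ZU (urelements have no members, Extensionality for sets, Foundation, Pairing, Union, Powerset, Infinity, Separation scheme) + Replacement scheme. Plenitude: for every (well-ordered, pure) cardinal $\kappa$ there is a set of urelements equinumerous with $\kappa$. Duplication: every set $A$ of urelements has a set of urelements disjoint from $A$ and equinumerous with $A$. Collection: for every formula $\varphi$, $\forall w,u(\forall x\in w\,\exists y\,\varphi(x,y,u)\to\exists v\,\forall x\in w\,\exists y\in v\,\varphi(x,y,u))$. *)

(* Defs.v *)
From Stdlib Require Import List.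

Set Implicit Arguments.
Unset Strict Implicit.
Unset Printing Implicit Defensive.

(** * First-order logic with equality

    The language has one binary relation symbol (membership) and one unary
    predicate symbol for each element of [P].  Variables are de Bruijn indices:
    under a quantifier, index 0 is the bound variable and [S n] is the variable
    that is called [n] outside. *)

Inductive form (P : Type) : Type :=
| Bot
| Mem (x y : nat)
| Eq (x y : nat)
| Pred (p : P) (x : nat)
| And (f g : form P)
| Or (f g : form P)
| Imp (f g : form P)
| All (f : form P)
| Ex (f : form P).

Arguments Bot {P}.
Arguments Mem {P} x y.
Arguments Eq {P} x y.

Declare Scope fo_scope.
Delimit Scope fo_scope with fo.
Bind Scope fo_scope with form.

Notation "x ∈ y" := (Mem x y) (at level 70, no associativity) : fo_scope.
Notation "x == y" := (Eq x y) (at level 70, no associativity) : fo_scope.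
Notation "f /\ g" := (And f g) : fo_scope.
Notation "f \/ g" := (Or f g) : fo_scope.
Notation "f --> g" := (Imp f g) (at level 99, right associativity) : fo_scope.
Notation "f <-> g" := (And (Imp f g) (Imp g f)) : fo_scope.
Notation "~ f" := (Imp f Bot) : fo_scope.

Definition AllIn {P} (x : nat) (f : form P) : form P := All (0 ∈ S x --> f).
Definition ExIn {P} (x : nat) (f : form P) : form P := Ex (0 ∈ S x /\ f).

Definition scons {X : Type} (a : X) (s : nat -> X) (n : nat) : X :=
  match n with 0 => a | S m => s m end.

Notation "a .: s" := (scons a s) (at level 60, right associativity).

Fixpoint rename {P} (r : nat -> nat) (f : form P) : form P :=
  match f with
  | Bot => Bot
  | Mem x y => Mem (r x) (r y)
  | Eq x y => Eq (r x) (r y)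
  | Pred p x => Pred p (r x)
  | And f g => And (rename r f) (rename r g)
  | Or f g => Or (rename r f) (rename r g)
  | Imp f g => Imp (rename r f) (rename r g)
  | All f => All (rename (0 .: fun n => S (r n)) f)
  | Ex f => Ex (rename (0 .: fun n => S (r n)) f)
  end.

Definition shift {P} : form P -> form P := rename S.

(** The language has no function symbols, so the only terms are variables. *)
Definition inst {P} (t : nat) : form P -> form P := rename (t .: fun n => n).

(** All free variables of [f] are smaller than [fv_bound f]. *)
Fixpoint fv_bound {P} (f : form P) : nat :=
  match f with
  | Bot => 0
  | Mem x y | Eq x y => Nat.max (S x) (S y)
  | Pred _ x => S x
  | And f g | Or f g | Imp f g => Nat.max (fv_bound f) (fv_bound g)
  | All f | Ex f => Nat.pred (fv_bound f)
  end.

Definition closure {P} (f : form P) : form P :=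
  Nat.iter (fv_bound f) (@All P) f.

(** ** Classical natural deduction *)

Inductive derives {P} : list (form P) -> form P -> Prop :=
| d_ax G f : In f G -> derives G f
| d_raa G f : derives ((~ f)%fo :: G) Bot -> derives G f
| d_andI G f g : derives G f -> derives G g -> derives G (f /\ g)
| d_andE1 G f g : derives G (f /\ g) -> derives G f
| d_andE2 G f g : derives G (f /\ g) -> derives G g
| d_orI1 G f g : derives G f -> derives G (f \/ g)
| d_orI2 G f g : derives G g -> derives G (f \/ g)
| d_orE G f g h : derives G (f \/ g) ->
    derives (f :: G) h -> derives (g :: G) h -> derives G h
| d_impI G f g : derives (f :: G) g -> derives G (f --> g)
| d_impE G f g : derives G (f --> g) -> derives G f -> derives G g
| d_allI G f : derives (map shift G) f -> derives G (All f)
| d_allE G f t : derives G (All f) -> derives G (inst t f)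
| d_exI G f t : derives G (inst t f) -> derives G (Ex f)
| d_exE G f g : derives G (Ex f) ->
    derives (f :: map shift G) (shift g) -> derives G g
| d_eqI G t : derives G (t == t)
| d_eqE G f s t : derives G (s == t) ->
    derives G (inst s f) -> derives G (inst t f).

Definition theory (P : Type) : Type := form P -> Prop.

Definition proves {P} (T : theory P) (f : form P) : Prop :=
  exists G, (forall g, In g G -> T g) /\ derives G f.

Definition consistent {P} (T : theory P) : Prop := ~ proves T Bot.

(** ** Structures and satisfaction *)

Record structure (P : Type) : Type := Structure {
  dom :> Type;
  dom_inhabited : inhabited dom;
  mem : dom -> dom -> Prop;
  pred : P -> dom -> Prop }.

Fixpoint sat {P} (M : structure P) (e : nat -> M) (f : form P) : Prop :=
  match f with
  | Bot => False
  | Mem x y => mem (e x) (e y)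
  | Eq x y => e x = e y
  | Pred p x => pred p (e x)
  | And f g => sat e f /\ sat e g
  | Or f g => sat e f \/ sat e g
  | Imp f g => sat e f -> sat e g
  | All f => forall a : M, sat (a .: e) f
  | Ex f => exists a : M, sat (a .: e) f
  end.

Definition holds_in {P} (M : structure P) (f : form P) : Prop :=
  forall e : nat -> M, sat e f.

Definition models {P} (M : structure P) (T : theory P) : Prop :=
  forall f, T f -> holds_in M f.

(** * Axioms common to ZF and to set theory with urelements

    Separation, Pairing and Union do not say that the object they provide is a
    set rather than an urelement.  This matters only if it has no members, and
    then the empty set given by Infinity serves as well. *)

Section CommonAxioms.
Context {P : Type}.
Implicit Type f : form P.

Local Open Scope fo_scope.

Definition subset (x y : nat) : form P := AllIn x (0 ∈ S y).

Definition nonempty (x : nat) : form P := Ex (0 ∈ S x).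

Definition foundation : form P :=
  All (nonempty 0 --> ExIn 0 (AllIn 0 (~ 0 ∈ 2))).

Definition pairing : form P :=
  All (All (Ex (All (0 ∈ 1 <-> 0 == 3 \/ 0 == 2)))).

Definition union : form P :=
  All (Ex (All (0 ∈ 1 <-> ExIn 2 (1 ∈ 0)))).

(** In the schemes the free variables of [f] from some index on are the
    parameters [u].  In [f(z, u)], [z] is 0 and [u] is 1, 2, ...; in
    [f(x, y, u)], [y] is 0, [x] is 1 and [u] is 2, 3, ....  The renamings
    prevent [f] from mentioning the other variables of the axiom. *)

Definition separation f : form P := closure
  (* w *) (All (* y *) (Ex (* z *) (All
    (0 ∈ 1 <-> 0 ∈ 2 /\ rename (0 .: Nat.add 3) f)))).

Definition replacement f : form P := closure
  (* w *) (All (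
    (* x *) (AllIn 0
      (* y *) (Ex (rename (0 .: 1 .: Nat.add 3) f /\
        (* y' *) All (rename (0 .: 2 .: Nat.add 4) f --> 0 == 1))))
    -->
    (* v *) (Ex (* x *) (AllIn 1 (* y *) (ExIn 1
      (rename (0 .: 1 .: Nat.add 4) f)))))).

Definition collection f : form P := closure
  (* w *) (All (
    (* x *) (AllIn 0 (* y *) (Ex (rename (0 .: 1 .: Nat.add 3) f)))
    -->
    (* v *) (Ex (* x *) (AllIn 1 (* y *) (ExIn 1
      (rename (0 .: 1 .: Nat.add 4) f)))))).

(** [y] has the members of [x ∪ {x}]. *)
Definition successor (y x : nat) : form P :=
  All (0 ∈ S y <-> 0 ∈ S x \/ 0 == S x).

Definition Collection : theory P := fun g => exists f, g = collection f.

End CommonAxioms.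

(** * ZF, in the language of membership alone *)

Section ZF.
Local Open Scope fo_scope.

Definition zf_extensionality : form Empty_set :=
  All (All (All (0 ∈ 2 <-> 0 ∈ 1) --> 1 == 0)).

Definition zf_powerset : form Empty_set :=
  All (Ex (All (0 ∈ 1 <-> subset 0 2))).

Definition zf_infinity : form Empty_set :=
  Ex (ExIn 0 (~ nonempty 0) /\ AllIn 0 (ExIn 1 (successor 0 1))).

Inductive ZF : theory Empty_set :=
| ZF_extensionality : ZF zf_extensionality
| ZF_foundation : ZF foundation
| ZF_pairing : ZF pairing
| ZF_union : ZF union
| ZF_powerset : ZF zf_powerset
| ZF_infinity : ZF zf_infinity
| ZF_separation f : ZF (separation f)
| ZF_replacement f : ZF (replacement f).

End ZF.

(** * Set theory with urelements *)

Variant ur_symbol : Type := UrSym.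

Section ZFU.
Local Open Scope fo_scope.

Definition Ur (x : nat) : form ur_symbol := Pred UrSym x.

Definition IsSet (x : nat) : form ur_symbol := ~ Ur x.

Definition urelements_empty : form ur_symbol :=
  All (Ur 0 --> ~ nonempty 0).

Definition extensionality : form ur_symbol :=
  All (All (IsSet 1 /\ IsSet 0 /\ All (0 ∈ 2 <-> 0 ∈ 1) --> 1 == 0)).

Definition powerset : form ur_symbol :=
  All (Ex (All (0 ∈ 1 <-> IsSet 0 /\ subset 0 2))).

Definition infinity : form ur_symbol :=
  Ex (ExIn 0 (IsSet 0 /\ ~ nonempty 0) /\ AllIn 0 (ExIn 1 (successor 0 1))).

Inductive ZU : theory ur_symbol :=
| ZU_urelements_empty : ZU urelements_empty
| ZU_extensionality : ZU extensionality
| ZU_foundation : ZU foundation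
| ZU_pairing : ZU pairing
| ZU_union : ZU union
| ZU_powerset : ZU powerset
| ZU_infinity : ZU infinity
| ZU_separation f : ZU (separation f).

Inductive ZFUR : theory ur_symbol :=
| ZFUR_ZU f : ZU f -> ZFUR f
| ZFUR_replacement f : ZFUR (replacement f).

(** [z = {x, y}] *)
Definition is_upair (z x y : nat) : form ur_symbol :=
  All (0 ∈ S z <-> 0 == S x \/ 0 == S y).

(** [p = {{x}, {x, y}}] *)
Definition is_opair (p x y : nat) : form ur_symbol :=
  All (0 ∈ S p <-> is_upair 0 (S x) (S x) \/ is_upair 0 (S x) (S y)).

(** [(x, y) ∈ g] *)
Definition opair_in (x y g : nat) : form ur_symbol :=
  ExIn g (is_opair 0 (S x) (S y)).

Definition is_bijection (g a b : nat) : form ur_symbol :=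
  IsSet g /\
  (* every member of [g] is a pair [(x, y)] with [x ∈ a] and [y ∈ b] *)
  AllIn g (ExIn (S a) (ExIn (S (S b)) (is_opair 2 1 0))) /\
  (* every [x ∈ a] has exactly one image [y] *)
  AllIn a (Ex (opair_in 1 0 (S (S g)) /\
               All (opair_in 2 0 (S (S (S g))) --> 0 == 1))) /\
  (* every [y ∈ b] has exactly one preimage [x] *)
  AllIn b (Ex (opair_in 0 1 (S (S g)) /\
               All (opair_in 0 2 (S (S (S g))) --> 0 == 1))).

Definition equinumerous (a b : nat) : form ur_symbol :=
  Ex (is_bijection 0 (S a) (S b)).

Definition transitive (a : nat) : form ur_symbol :=
  AllIn a (subset 0 (S a)).

Definition wellordered_by_mem (a : nat) : form ur_symbol :=
  AllIn a (~ 0 ∈ 0) /\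
  AllIn a (AllIn (S a) (AllIn (S (S a)) (2 ∈ 1 --> 1 ∈ 0 --> 2 ∈ 0))) /\
  AllIn a (AllIn (S a) (1 ∈ 0 \/ 1 == 0 \/ 0 ∈ 1)) /\
  All (subset 0 (S a) /\ nonempty 0 -->
       ExIn 0 (AllIn 1 (1 == 0 \/ 1 ∈ 0))).

(** A transitive set is pure, i.e. has no urelement in its transitive closure,
    iff all its members are sets. *)
Definition ordinal (a : nat) : form ur_symbol :=
  IsSet a /\ transitive a /\ AllIn a (IsSet 0) /\ wellordered_by_mem a.

Definition cardinal (a : nat) : form ur_symbol :=
  ordinal a /\ AllIn a (~ equinumerous 0 (S a)).

Definition set_of_urelements (a : nat) : form ur_symbol :=
  IsSet a /\ AllIn a (Ur 0).

Definition disjoint (a b : nat) : form ur_symbol :=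
  AllIn a (~ 0 ∈ S b).

Definition Plenitude : form ur_symbol :=
  All (cardinal 0 --> Ex (set_of_urelements 0 /\ equinumerous 0 1)).

Definition Duplication : form ur_symbol :=
  All (set_of_urelements 0 -->
       Ex (set_of_urelements 0 /\ disjoint 0 1 /\ equinumerous 0 1)).

End ZFU.

(* Main.v *)
From Stdlib Require Import List Arith Lia Cantor Classical ClassicalEpsilon.
From Stdlib Require Import FunctionalExtensionality PropExtensionality ProofIrrelevance.
Require Import Defs.

(** By completeness there is a model [M] of ZF, possibly ill-founded and without choice.  Inside
    [M] we form a permutation model.  Its urelements are triples [(i, b, a)] with [i], [b] natural
    numbers of [M] and [a] a pure set: piece [i] consists of the [(i, b, a)], and [a] numbers the
    copies of the piece.  A set has support [m] if no piece [i >= m] occurs in its transitive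
    closure and it is fixed by every transposition of two values [b, b' >= m] within a piece
    [i]; the universe consists of what has a support hereditarily.

    Replacement holds although no set involves all pieces: a value definable from parameters with
    support [m] is fixed by all exchanges of pieces beyond [m], so it involves none of them.
    Plenitude and Duplication hold because the coordinate [a] is not moved.  For Collection, call
    a set thin if it injects into a transitive set without urelements.  Pieces are not thin, and
    distinct pieces share no non-thin part up to bijection, so for each [n] there is a family of
    [n] pairwise unrelated non-thin sets of urelements.  A set with support [m] contains such
    families for [n <= m] only, by the pigeonhole principle, since a non-thin set of urelements
    contains almost all of some copy of a piece. *)

(** The ground model need be neither well-founded nor a model of choice. Its numbers may be
    nonstandard, so bounded means bounded by a number of [M], and induction inside [M] is available
    only for properties definable with parameters; hence the calculus of [Def]. Hereditary notions
    (pure, symmetric, image under a permutation) are all instances of one relation [Bnf], given by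
    set-sized witnesses. Thinness stands in for a notion of size, because the coordinate [a], which
    Plenitude forces to be unrestricted, makes sets of urelements as large as any pure set.
    Permutations are partial maps on the pairs [(i, b)], and a set is acted upon only if every
    urelement below it lies in the domain. So one formalism says both which pieces a set involves
    and what fixes it. The first property passes to members, the second does not. This is what the
    refutation of Collection must cope with: members of a set with support [m] may have larger
    supports, but they involve only pieces below [m]. *)

Set Implicit Arguments.
Unset Strict Implicit.
Unset Printing Implicit Defensive.

(** * Renaming and satisfaction *)

Section Renaming.
Context {P : Type}.
Implicit Types f g : form P.

Lemma rename_ext_below f : forall r s, (forall n, n < fv_bound f -> r n = s n) ->
  rename r f = rename s f.
Proof.
  induction f; simpl; intros r s H; f_equal; auto;
    try (apply H; lia); try (apply IHf1; intros; apply H; lia);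
    try (apply IHf2; intros; apply H; lia);
    apply IHf; intros [|n] Hn; simpl; auto; f_equal; apply H; lia.
Qed.

Lemma rename_ext f r s : (forall n, r n = s n) -> rename r f = rename s f.
Proof. intros; apply rename_ext_below; auto. Qed.

Lemma rename_comp f : forall r s, rename r (rename s f) = rename (fun n => r (s n)) f.
Proof.
  induction f; simpl; intros r s; f_equal; auto;
    rewrite IHf; apply rename_ext; intros [|n]; reflexivity.
Qed.

Lemma rename_id f : forall r, (forall n, r n = n) -> rename r f = f.
Proof.
  induction f; simpl; intros r H; rewrite ?H; f_equal; auto;
    apply IHf; intros [|n]; simpl; auto.
Qed.

Lemma rename_closed f r : fv_bound f = 0 -> rename r f = f.
Proof.
  intros H. rewrite <- (rename_id f (r := fun n => n)) at 2 by auto.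
  apply rename_ext_below; intros; lia.
Qed.

Lemma rename_inst f r t :
  rename r (inst t f) = inst (r t) (rename (0 .: fun n => S (r n)) f).
Proof.
  unfold inst; rewrite !rename_comp; apply rename_ext; intros [|n]; reflexivity.
Qed.

Lemma rename_shift f r : rename (0 .: fun n => S (r n)) (shift f) = shift (rename r f).
Proof. unfold shift; rewrite !rename_comp; apply rename_ext; reflexivity. Qed.

Lemma fv_rename f : forall r k, (forall n, n < fv_bound f -> r n < k) ->
  fv_bound (rename r f) <= k.
Proof.
  induction f; simpl; intros r k H.
  - lia.
  - pose proof (H x ltac:(lia)); pose proof (H y ltac:(lia)); lia.
  - pose proof (H x ltac:(lia)); pose proof (H y ltac:(lia)); lia.
  - pose proof (H x ltac:(lia)); lia.
  - apply Nat.max_lub; [apply IHf1|apply IHf2]; intros; apply H; lia.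
  - apply Nat.max_lub; [apply IHf1|apply IHf2]; intros; apply H; lia.
  - apply Nat.max_lub; [apply IHf1|apply IHf2]; intros; apply H; lia.
  - enough (fv_bound (rename (0 .: fun n => S (r n)) f) <= S k) by lia.
    apply IHf; intros [|n] Hn; simpl; [lia|]. specialize (H n); lia.
  - enough (fv_bound (rename (0 .: fun n => S (r n)) f) <= S k) by lia.
    apply IHf; intros [|n] Hn; simpl; [lia|]. specialize (H n); lia.
Qed.

Lemma fv_iter_All n f : fv_bound (Nat.iter n (@All P) f) = fv_bound f - n.
Proof. induction n; simpl; rewrite ?IHn; lia. Qed.

Lemma fv_closure f : fv_bound (closure f) = 0.
Proof. unfold closure; rewrite fv_iter_All; lia. Qed.

Lemma sat_ext_below (M : structure P) f : forall e e' : nat -> M,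
  (forall n, n < fv_bound f -> e n = e' n) -> sat e f <-> sat e' f.
Proof.
  induction f; simpl; intros e e' H.
  - tauto.
  - rewrite !H by lia; tauto.
  - rewrite !H by lia; tauto.
  - rewrite !H by lia; tauto.
  - rewrite (IHf1 e e'), (IHf2 e e'); [tauto| |]; intros; apply H; lia.
  - rewrite (IHf1 e e'), (IHf2 e e'); [tauto| |]; intros; apply H; lia.
  - rewrite (IHf1 e e'), (IHf2 e e'); [tauto| |]; intros; apply H; lia.
  - enough (E : forall a, sat (a .: e) f <-> sat (a .: e') f)
      by (split; intros H' a; apply E; auto).
    intros a; apply IHf; intros [|n] Hn; simpl; auto; apply H; lia.
  - enough (E : forall a, sat (a .: e) f <-> sat (a .: e') f)
      by (split; intros [a H']; exists a; apply E; auto).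
    intros a; apply IHf; intros [|n] Hn; simpl; auto; apply H; lia.
Qed.

Lemma sat_ext (M : structure P) f (e e' : nat -> M) :
  (forall n, e n = e' n) -> sat e f <-> sat e' f.
Proof. intros; apply sat_ext_below; auto. Qed.

Lemma sat_rename (M : structure P) f : forall (e : nat -> M) r,
  sat e (rename r f) <-> sat (fun n => e (r n)) f.
Proof.
  induction f; simpl; intros e r; rewrite ?IHf1, ?IHf2; try tauto.
  - enough (E : forall a, sat (a .: e) (rename (0 .: fun n => S (r n)) f) <->
      sat (a .: fun n => e (r n)) f) by (split; intros H' a; apply E; auto).
    intros a; rewrite IHf; apply sat_ext; intros [|n]; reflexivity.
  - enough (E : forall a, sat (a .: e) (rename (0 .: fun n => S (r n)) f) <->
      sat (a .: fun n => e (r n)) f) by (split; intros [a H']; exists a; apply E; auto).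
    intros a; rewrite IHf; apply sat_ext; intros [|n]; reflexivity.
Qed.

Lemma holds_closure (M : structure P) f :
  holds_in M (closure f) <-> forall e : nat -> M, sat e f.
Proof.
  unfold closure, holds_in. generalize (fv_bound f) as n.
  induction n as [|n IH]; simpl; [tauto|]. split.
  - intros H. apply IH. intros e.
    apply (@sat_ext _ _ (e 0 .: fun n => e (S n))); [intros [|m]; reflexivity|].
    apply H.
  - intros H e a. apply IH. exact H.
Qed.

End Renaming.

(** * Derivations *)

Section Derivations.
Context {P : Type}.
Implicit Types (f g : form P) (G : list (form P)).

Lemma derives_rename G f : derives G f ->
  forall r, derives (map (rename r) G) (rename r f).
Proof.
  assert (shifts : forall G r, map (rename (0 .: fun n => S (r n))) (map shift G) =
    map shift (map (rename r) G)).
  { intros G' r; rewrite !map_map; apply map_ext; intros; apply rename_shift. }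
  induction 1; intros r; simpl in *.
  - apply d_ax, in_map; auto.
  - apply d_raa; apply IHderives.
  - apply d_andI; auto.
  - eapply d_andE1; apply IHderives.
  - eapply d_andE2; apply IHderives.
  - apply d_orI1; auto.
  - apply d_orI2; auto.
  - eapply d_orE; [apply IHderives1|apply IHderives2|apply IHderives3].
  - apply d_impI; apply IHderives.
  - eapply d_impE; [apply IHderives1|apply IHderives2].
  - apply d_allI. rewrite <- shifts. apply IHderives.
  - rewrite rename_inst; apply d_allE; apply IHderives.
  - apply d_exI with (t := r t). rewrite <- rename_inst; apply IHderives.
  - eapply d_exE; [apply IHderives1|].
    rewrite <- rename_shift, <- shifts; apply IHderives2.
  - apply d_eqI.
  - rewrite rename_inst; eapply d_eqE; [apply IHderives1|].
    rewrite <- rename_inst; apply IHderives2.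
Qed.

Lemma weaken G f : derives G f -> forall G', incl G G' -> derives G' f.
Proof.
  induction 1; intros G' HG.
  - apply d_ax; auto.
  - apply d_raa; apply IHderives; intros h [->|?]; simpl; auto.
  - apply d_andI; auto.
  - eapply d_andE1; eauto.
  - eapply d_andE2; eauto.
  - apply d_orI1; auto.
  - apply d_orI2; auto.
  - eapply d_orE; [eauto|apply IHderives2|apply IHderives3];
      intros k [->|?]; simpl; auto.
  - apply d_impI; apply IHderives; intros h [->|?]; simpl; auto.
  - eapply d_impE; eauto.
  - apply d_allI; apply IHderives; apply incl_map; auto.
  - apply d_allE; auto.
  - eapply d_exI; eauto.
  - eapply d_exE; [eauto|]. apply IHderives2.
    intros h [->|?]; simpl; auto; right; apply (incl_map shift HG); auto.
  - apply d_eqI.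
  - eapply d_eqE; eauto.
Qed.

Lemma derives_exfalso G f : derives G Bot -> derives G f.
Proof. intros H; apply d_raa; eapply weaken; [exact H|]; intros h; simpl; auto. Qed.

Definition extend (T : theory P) f : theory P := fun g => T g \/ g = f.

Lemma proves_ax (T : theory P) f : T f -> proves T f.
Proof.
  intros H; exists (f :: nil); split; [|apply d_ax; simpl; auto].
  intros g [<-|[]]; auto.
Qed.

Lemma proves_mono (T T' : theory P) f :
  (forall g, T g -> T' g) -> proves T f -> proves T' f.
Proof. intros H (G & HG & D); exists G; auto. Qed.

Lemma proves_deduction (T : theory P) f g : proves (extend T f) g -> proves T (f --> g)%fo.
Proof.
  intros (G & HG & D).
  exists (filter (fun h => if excluded_middle_informative (h = f) then false else true) G).
  split.
  - intros h Hh; apply filter_In in Hh as [Hh E].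
    destruct (excluded_middle_informative (h = f)); [discriminate|].
    destruct (HG h Hh); tauto.
  - apply d_impI; eapply weaken; [exact D|]. intros h Hh; simpl.
    destruct (classic (h = f)); [auto|right].
    apply filter_In; split; auto.
    destruct (excluded_middle_informative (h = f)); tauto.
Qed.

Lemma proves_mp (T : theory P) f g : proves T (f --> g)%fo -> proves T f -> proves T g.
Proof.
  intros (G & HG & D) (G' & HG' & D'); exists (G ++ G'); split.
  - intros h Hh; apply in_app_or in Hh as [?|?]; auto.
  - eapply d_impE; eapply weaken;
      [exact D|apply incl_appl, incl_refl|exact D'|apply incl_appr, incl_refl].
Qed.

Lemma proves_cut (T : theory P) G f :
  derives G f -> (forall g, In g G -> proves T g) -> proves T f.
Proof.
  revert f; induction G as [|g G IH]; intros f D H.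
  - exists nil; split; [intros ? []|exact D].
  - apply proves_mp with (f := g); [|apply H; simpl; auto].
    apply IH; [apply d_impI; exact D|]. intros h Hh; apply H; simpl; auto.
Qed.

Lemma proves_not (T : theory P) f : ~ consistent (extend T f) -> proves T (~ f)%fo.
Proof.
  intros H. apply NNPP in H. exact (proves_deduction H).
Qed.

(* Renaming [k] to 0 and every other [n] to [S n] turns the instance back into [f] and shifts the context. *)
Lemma exE_fresh G f k : derives (inst k f :: G) Bot -> fv_bound f <= S k ->
  (forall g, In g G -> fv_bound g <= k) -> derives (Ex f :: G) Bot.
Proof.
  intros D Hf HG.
  set (r := fun n => if Nat.eqb n k then 0 else S n).
  assert (rS : forall n, n < k -> r n = S n).
  { intros n Hn; unfold r; destruct (Nat.eqb_spec n k); [lia|auto]. }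
  pose proof (derives_rename D r) as D'; clear D; rename D' into D; simpl in D.
  apply d_exE with (f := f); [apply d_ax; simpl; auto|].
  eapply weaken; [exact D|]. intros h [<-|Hh].
  - left. unfold inst. rewrite rename_comp.
    rewrite <- (rename_id f (r := fun n => n)) at 1 by auto.
    apply rename_ext_below. intros [|n] Hn; simpl.
    + unfold r; rewrite Nat.eqb_refl; reflexivity.
    + rewrite rS; lia.
  - right; right. apply in_map_iff in Hh as (g & <- & Hg). apply in_map_iff.
    exists g; split; auto. apply rename_ext_below. intros n Hn.
    symmetry; apply rS. specialize (HG g Hg); lia.
Qed.

End Derivations.

(** * Completeness for countable closed theories *)

Section Completeness.
Context {P : Type} (code : P -> nat) (code_inj : forall p q, code p = code q -> p = q).
Context (T : theory P) (T_closed : forall f, T f -> fv_bound f = 0).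
Context (T_cons : consistent T).
Implicit Types f g : form P.

Fixpoint enc (f : form P) : nat :=
  match f with
  | Bot => to_nat (0, 0)
  | Mem x y => to_nat (1, to_nat (x, y))
  | Eq x y => to_nat (2, to_nat (x, y))
  | Pred p x => to_nat (3, to_nat (code p, x))
  | And f g => to_nat (4, to_nat (enc f, enc g))
  | Or f g => to_nat (5, to_nat (enc f, enc g))
  | Imp f g => to_nat (6, to_nat (enc f, enc g))
  | All f => to_nat (7, enc f)
  | Ex f => to_nat (8, enc f)
  end.

Lemma to_nat_eq a b c d : to_nat (a, b) = to_nat (c, d) -> a = c /\ b = d.
Proof. intros H; apply to_nat_inj in H; injection H; auto. Qed.

Lemma enc_inj f : forall g, enc f = enc g -> f = g.
Proof.
  induction f; intros []; cbn [enc]; intros H; apply to_nat_eq in H as [E H];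
    try discriminate E; try (apply to_nat_eq in H as [H1 H2]); f_equal; auto.
Qed.

Lemma to_nat_ge a b : a + b <= to_nat (a, b).
Proof. pose proof (to_nat_non_decreasing a b); lia. Qed.

Lemma fv_enc f : fv_bound f <= enc f.
Proof.
  induction f; cbn [enc fv_bound];
    repeat match goal with
    | |- context [to_nat (?a, ?b)] =>
        pose proof (to_nat_ge a b); generalize dependent (to_nat (a, b)); intros
    | _ : context [to_nat (?a, ?b)] |- _ =>
        pose proof (to_nat_ge a b); generalize dependent (to_nat (a, b)); intros
    end; lia.
Qed.

(* Variables serve as Henkin constants.  The witness [enc f] is fresh for [f] and for the axioms of all formulas with a smaller code. *)
Definition henkin_axiom f : form P := (Ex f --> inst (enc f) f)%fo.

Definition henkin_upto n : theory P := fun g =>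
  T g \/ exists f, enc f < n /\ g = henkin_axiom f.

Lemma fv_henkin n g : henkin_upto n g -> fv_bound g <= n.
Proof.
  intros [H|(f & Hf & ->)]; [rewrite (T_closed H); lia|].
  simpl. pose proof (fv_enc f). apply Nat.max_lub; [lia|].
  apply fv_rename. intros [|k] Hk; simpl; lia.
Qed.

(** If the axiom for the formula with code [n] were inconsistent with the earlier ones, these would
    prove [Ex f] and refute the instance at variable [n]. That variable is fresh, so by [exE_fresh]
    the earlier theory would be inconsistent already. *)
Lemma henkin_upto_cons n : consistent (henkin_upto n).
Proof.
  induction n as [|n IH].
  - intros H; apply T_cons; revert H; apply proves_mono.
    intros g [H|(f & Hf & _)]; [exact H|lia].
  - intros H.
    destruct (classic (exists f, enc f = n)) as [[f Hf]|Hn].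
    2: { apply IH; revert H; apply proves_mono. intros g [H|(f & Hf & ->)]; [left; auto|].
         right; exists f; split; auto. assert (enc f <> n) by (intros E; apply Hn; eauto); lia. }
    assert (Hneg : proves (henkin_upto n) (~ henkin_axiom f)%fo).
    { apply proves_deduction; revert H; apply proves_mono.
      intros g [H|(f' & Hf' & ->)]; [left; left; auto|].
      destruct (Nat.eq_dec (enc f') n) as [E|E].
      - right. f_equal. apply enc_inj; congruence.
      - left; right; exists f'; split; [lia|auto]. }
    destruct Hneg as (G & HG & D). apply IH. exists G; split; [exact HG|].
    assert (D1 : derives G (Ex f)).
    { apply d_raa. eapply d_impE; [eapply weaken; [exact D|intros h; simpl; auto]|].
      apply d_impI, derives_exfalso.
      eapply d_impE; apply d_ax; simpl; [right; left; reflexivity|auto]. }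
    eapply d_impE; [|exact D1]. apply d_impI. apply exE_fresh with (k := n).
    + eapply d_impE; [eapply weaken; [exact D|intros h; simpl; auto]|].
      apply d_impI. unfold henkin_axiom. apply d_ax; simpl; rewrite Hf; auto.
    + pose proof (fv_enc f); lia.
    + intros g Hg; apply fv_henkin; auto.
Qed.

(** The step from [n] to [S n] concerns at most one formula, the one with code [n]. Stage 0 has all
    Henkin axioms at once. *)
Fixpoint lindenbaum (n : nat) : theory P :=
  match n with
  | 0 => fun g => exists k, henkin_upto k g
  | S n => fun g => lindenbaum n g \/ (enc g = n /\ consistent (extend (lindenbaum n) g))
  end.

Definition maximal : theory P := fun g => exists n, lindenbaum n g.

(** A derivation uses finitely many hypotheses, so the union of a chain of consistent theories is
    consistent. This serves for both [henkin_upto] and [lindenbaum]. *)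
Lemma chain_list (A : Type) (C : nat -> A -> Prop) (l : list A) :
  (forall m n a, m <= n -> C m a -> C n a) ->
  (forall a, In a l -> exists n, C n a) -> exists n, forall a, In a l -> C n a.
Proof.
  intros Cm; induction l as [|a l IH]; intros H; [exists 0; intros ? []|].
  destruct IH as [n Hn]; [intros; apply H; simpl; auto|].
  destruct (H a) as [m Hm]; [simpl; auto|].
  exists (max m n). intros b [<-|Hb]; [eapply Cm; [|exact Hm]; lia|].
  eapply Cm; [|apply Hn; auto]; lia.
Qed.

Lemma lindenbaum_mono m n g : m <= n -> lindenbaum m g -> lindenbaum n g.
Proof. induction 1; simpl; auto. Qed.

Lemma lindenbaum_cons n : consistent (lindenbaum n).
Proof.
  induction n as [|n IH].
  - intros (G & HG & D).
    destruct (@chain_list _ henkin_upto G) as [k Hk]; auto.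
    + intros i j g Hij [H|(f & Hf & ->)]; [left; auto|].
      right; exists f; split; auto; lia.
    + apply (@henkin_upto_cons k). exists G; auto.
  - destruct (classic (exists g, enc g = n /\ consistent (extend (lindenbaum n) g)))
      as [(g & Hg & Hc)|Hn].
    + intros H; apply Hc; revert H; apply proves_mono.
      intros h [Hh|[Hh _]]; [left; auto|right; apply enc_inj; congruence].
    + intros H; apply IH; revert H; apply proves_mono.
      intros h [Hh|[Hh Hc]]; auto. exfalso; apply Hn; eauto.
Qed.

Lemma maximal_cons : consistent maximal.
Proof.
  intros (G & HG & D).
  destruct (@chain_list _ lindenbaum G lindenbaum_mono HG) as [k Hk].
  apply (@lindenbaum_cons k). exists G; auto.
Qed.

Lemma maximal_proves f : proves maximal f <-> maximal f.
Proof.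
  split; [|apply proves_ax]. intros H. exists (S (enc f)). simpl. right; split; auto.
  intros H'. apply maximal_cons. apply proves_mp with (f := f); auto.
  apply proves_deduction. revert H'; apply proves_mono.
  intros g [Hg|Hg]; [left; exists (enc f); auto|right; auto].
Qed.

Lemma maximal_derives G f : derives G f -> (forall g, In g G -> maximal g) -> maximal f.
Proof.
  intros D H; apply maximal_proves. apply proves_cut with (G := G); auto.
  intros; apply proves_ax; auto.
Qed.

Lemma maximal_not f : maximal (~ f)%fo <-> ~ maximal f.
Proof.
  split.
  - intros H H'. apply maximal_cons, maximal_proves.
    apply maximal_derives with (G := f :: (~ f)%fo :: nil);
      [eapply d_impE; apply d_ax; simpl; eauto 10|].
    intros g [<-|[<-|[]]]; auto.
  - intros H. apply maximal_proves, proves_not. intros Hc. apply H. exists (S (enc f)).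
    right; split; auto. intros H'; apply Hc; revert H'; apply proves_mono.
    intros g [Hg|Hg]; [left; exists (enc f); auto|right; auto].
Qed.

Lemma maximal_and f g : maximal (f /\ g)%fo <-> maximal f /\ maximal g.
Proof.
  split.
  - intros H; split; apply maximal_derives with (G := (f /\ g)%fo :: nil);
      try (intros h [<-|[]]; auto);
      [eapply d_andE1|eapply d_andE2]; apply d_ax; simpl; eauto 10.
  - intros [Hf Hg]. apply maximal_derives with (G := f :: g :: nil);
      [apply d_andI; apply d_ax; simpl; auto|intros h [<-|[<-|[]]]; auto].
Qed.

Lemma maximal_imp f g : maximal (f --> g)%fo <-> (maximal f -> maximal g).
Proof.
  split.
  - intros H Hf. apply maximal_derives with (G := f :: (f --> g)%fo :: nil);
      [eapply d_impE; apply d_ax; simpl; eauto 10|intros h [<-|[<-|[]]]; auto].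
  - intros H. destruct (classic (maximal f)) as [Hf|Hf].
    + apply maximal_derives with (G := g :: nil).
      * apply d_impI; apply d_ax; simpl; auto.
      * intros h [<-|[]]. exact (H Hf).
    + apply maximal_not in Hf. apply maximal_derives with (G := (~ f)%fo :: nil);
        [|intros h [<-|[]]; auto].
      apply d_impI, derives_exfalso. eapply d_impE; apply d_ax; simpl; eauto 10.
Qed.

Lemma maximal_or f g : maximal (f \/ g)%fo <-> maximal f \/ maximal g.
Proof.
  split.
  - intros H. apply NNPP; intros H'.
    assert (Hf : maximal (~ f)%fo) by (apply maximal_not; tauto).
    assert (Hg : maximal (~ g)%fo) by (apply maximal_not; tauto).
    apply maximal_cons, maximal_proves.
    apply maximal_derives with (G := (f \/ g)%fo :: (~ f)%fo :: (~ g)%fo :: nil).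
    + eapply d_orE; [apply d_ax; simpl; auto| |].
      * apply d_impE with (f := f); apply d_ax; simpl; auto.
      * apply d_impE with (f := g); apply d_ax; simpl; auto 10.
    + intros h [<-|[<-|[<-|[]]]]; auto.
  - intros [H|H].
    + apply maximal_derives with (G := f :: nil); [|intros h [<-|[]]; auto].
      apply d_orI1, d_ax; simpl; auto.
    + apply maximal_derives with (G := g :: nil); [|intros h [<-|[]]; auto].
      apply d_orI2, d_ax; simpl; auto.
Qed.

Lemma maximal_ex f : maximal (Ex f) <-> exists t, maximal (inst t f).
Proof.
  split.
  - intros H. exists (enc f). revert H. apply maximal_imp.
    exists 0, (S (enc f)). right. exists f; auto.
  - intros [t H]. apply maximal_derives with (G := inst t f :: nil);
      [eapply d_exI; apply d_ax; simpl; eauto 10|intros h [<-|[]]; auto].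
Qed.

Lemma maximal_all f : maximal (All f) <-> forall t, maximal (inst t f).
Proof.
  split.
  - intros H t. apply maximal_derives with (G := All f :: nil);
      [eapply d_allE; apply d_ax; simpl; eauto 10|intros h [<-|[]]; auto].
  - intros H. apply NNPP; intros H'. apply maximal_not in H'.
    assert (He : maximal (Ex (~ f)%fo)).
    { apply maximal_derives with (G := (~ All f)%fo :: nil);
        [|intros h [<-|[]]; auto].
      apply d_raa. eapply d_impE; [apply d_ax; simpl; eauto 10|].
      apply d_allI. apply d_raa.
      eapply d_impE; [apply d_ax; simpl; right; left; reflexivity|].
      simpl. apply d_exI with (t := 0). unfold inst; simpl.
      rewrite rename_comp, rename_id by (intros [|n]; reflexivity).
      apply d_ax; simpl; auto. }
    apply maximal_ex in He as [t He]. unfold inst in He; simpl in He.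
    apply maximal_not in He. apply He, H.
Qed.

Definition eqv (x y : nat) : Prop := maximal (x == y)%fo.

Lemma eqv_refl x : eqv x x.
Proof. apply maximal_derives with (G := nil); [apply d_eqI|intros ? []]. Qed.

Lemma eqv_subst f x y : eqv x y -> maximal (inst x f) -> maximal (inst y f).
Proof.
  intros E H. apply maximal_derives with (G := (x == y)%fo :: inst x f :: nil);
    [eapply d_eqE; apply d_ax; simpl; eauto 10|intros h [<-|[<-|[]]]; auto].
Qed.

Lemma eqv_sym x y : eqv x y -> eqv y x.
Proof.
  intros E. exact (@eqv_subst (0 == S x)%fo x y E (eqv_refl x)).
Qed.

Lemma eqv_trans x y z : eqv x y -> eqv y z -> eqv x z.
Proof.
  intros E E'. exact (@eqv_subst (S x == 0)%fo y z E' E).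
Qed.

(** Equality is interpreted as identity, so the domain needs one representative per class.
    Equivalent variables have extensionally equal predicates [eqv x], hence the same [epsilon]. *)
Definition rep (x : nat) : nat := epsilon (inhabits 0) (eqv x).

Lemma rep_eqv x : eqv x (rep x).
Proof. unfold rep; apply epsilon_spec; exists x; apply eqv_refl. Qed.

Lemma rep_eq x y : rep x = rep y <-> eqv x y.
Proof.
  split; intros H.
  - eapply eqv_trans; [apply rep_eqv|]. rewrite H. apply eqv_sym, rep_eqv.
  - unfold rep. f_equal. extensionality z. apply propositional_extensionality.
    split; intros Hz; eauto using eqv_trans, eqv_sym.
Qed.

Lemma rep_rep x : rep (rep x) = rep x.
Proof. apply rep_eq, eqv_sym, rep_eqv. Qed.

Definition term_structure : structure P :=
  {| dom := {x : nat | rep x = x};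
     dom_inhabited := inhabits (exist _ (rep 0) (rep_rep 0));
     mem := fun a b => maximal (Mem (proj1_sig a) (proj1_sig b));
     pred := fun p a => maximal (Pred p (proj1_sig a)) |}.

Definition cls (x : nat) : term_structure := exist _ (rep x) (rep_rep x).

Lemma cls_surj (a : term_structure) : exists x, a = cls x.
Proof.
  destruct a as [x Hx]. exists x. apply eq_sig_hprop; simpl; auto.
  intros; apply proof_irrelevance.
Qed.

(** Every element of the term structure is the class of a variable, so assignments amount to
    renamings [r]; under a quantifier [r] becomes [k .: r]. *)
Lemma truth f : forall r : nat -> nat,
  sat (M := term_structure) (fun n => cls (r n)) f <-> maximal (rename r f).
Proof.
  assert (env : forall f k (r : nat -> nat),
    sat (M := term_structure) (cls k .: fun n => cls (r n)) f <->
    sat (M := term_structure) (fun n => cls ((k .: r) n)) f).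
  { intros g k r; apply sat_ext; intros [|n]; reflexivity. }
  assert (instr : forall f k (r : nat -> nat),
    rename (k .: r) f = inst k (rename (0 .: fun n => S (r n)) f)).
  { intros g k r; unfold inst; rewrite rename_comp; apply rename_ext; intros [|n]; auto. }
  induction f; intros r; simpl.
  - split; [tauto|]. intros H; apply maximal_cons, proves_ax, H.
  - split; intros H.
    + apply (@eqv_subst (S (r x) ∈ 0)%fo (rep (r y)) (r y) (eqv_sym (rep_eqv _))).
      apply (@eqv_subst (0 ∈ S (rep (r y)))%fo (rep (r x)) (r x) (eqv_sym (rep_eqv _))).
      exact H.
    + apply (@eqv_subst (S (rep (r x)) ∈ 0)%fo (r y) (rep (r y)) (rep_eqv _)).
      apply (@eqv_subst (0 ∈ S (r y))%fo (r x) (rep (r x)) (rep_eqv _)).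
      exact H.
  - split; intros H.
    + apply rep_eq. injection H; auto.
    + apply eq_sig_hprop; [intros; apply proof_irrelevance|]. apply rep_eq, H.
  - split; intros H.
    + exact (@eqv_subst (Pred p 0) (rep (r x)) (r x) (eqv_sym (rep_eqv _)) H).
    + exact (@eqv_subst (Pred p 0) (r x) (rep (r x)) (rep_eqv _) H).
  - rewrite IHf1, IHf2, maximal_and; tauto.
  - rewrite IHf1, IHf2, maximal_or; tauto.
  - rewrite IHf1, IHf2, maximal_imp; tauto.
  - rewrite maximal_all. split.
    + intros H t. rewrite <- instr. apply IHf, env, H.
    + intros H a. destruct (cls_surj a) as [k ->]. apply env, IHf. rewrite instr. apply H.
  - rewrite maximal_ex. split.
    + intros [a H]. destruct (cls_surj a) as [k ->]. exists k.
      rewrite <- instr. apply IHf, env, H.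
    + intros [t H]. exists (cls t). apply env, IHf. rewrite instr. exact H.
Qed.

Theorem completeness : exists M : structure P, models M T.
Proof.
  exists term_structure. intros f Hf e.
  destruct (choice (fun n x => e n = cls x)) as [r Hr]; [intros n; apply cls_surj|].
  apply (@sat_ext _ _ _ _ (fun n => cls (r n))); [exact Hr|].
  apply truth. rewrite rename_closed by auto.
  exists 0, 0. left. exact Hf.
Qed.

End Completeness.

Lemma ZF_closed f : ZF f -> fv_bound f = 0.
Proof. destruct 1; try reflexivity; apply fv_closure. Qed.

Lemma ZF_model : consistent ZF -> exists M : structure Empty_set, models M ZF.
Proof.
  apply completeness with (code := fun p : Empty_set => match p with end).
  - intros [].
  - exact ZF_closed.
Qed.
(** * Definability with parameters *)

Class ZFModel (M : structure Empty_set) : Prop := zf_holds : models M ZF.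

Section Definability.
Context {M : structure Empty_set}.
Implicit Types (Q : (nat -> M) -> Prop) (a b : (nat -> M) -> M).

Definition value (e : nat -> M) (t : nat + M) : M :=
  match t with inl k => e k | inr c => c end.

(* A variable of the defining formula denotes either a variable of the predicate or a parameter in [M]. *)
Definition Def Q : Prop :=
  exists (f : form Empty_set) (t : nat -> nat + M),
    forall e, sat (fun n => value e (t n)) f <-> Q e.

(** The language has no function symbols, so operations enter through their graphs, with the value
    at place 0. *)
Definition DefTerm a : Prop := Def (fun e => e 0 = a (fun n => e (S n))).

Lemma def_ext Q Q' : (forall e, Q e <-> Q' e) -> Def Q -> Def Q'.
Proof. intros H (f & t & E); exists f, t; intros e; rewrite E; auto. Qed.

Lemma def_subst Q (s : nat -> nat + M) : Def Q -> Def (fun e => Q (fun n => value e (s n))).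
Proof.
  intros (f & t & E).
  exists f, (fun n => match t n with inl k => s k | inr c => inr c end).
  intros e. rewrite <- E. apply sat_ext. intros n. destruct (t n); reflexivity.
Qed.

Lemma def_binary (op : form Empty_set -> form Empty_set -> form Empty_set)
    (Op : Prop -> Prop -> Prop) Q Q' :
  (forall (e : nat -> M) f g, sat e (op f g) <-> Op (sat e f) (sat e g)) ->
  Def Q -> Def Q' -> Def (fun e => Op (Q e) (Q' e)).
Proof.
  intros HOp (f & t & E) (f' & t' & E').
  (* The two definitions may read the same variable differently; [f] is moved to the even variables
     and [f'] to the odd ones. *)
  exists (op (rename (fun n => 2 * n) f) (rename (fun n => S (2 * n)) f')),
    (fun n => if Nat.even n then t (Nat.div2 n) else t' (Nat.div2 n)).
  intros e. rewrite HOp.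
  assert (HE : sat (fun n => value e (t n)) f = Q e /\
          sat (fun n => value e (t' n)) f' = Q' e)
    by (split; apply propositional_extensionality; auto).
  destruct HE as [<- <-].
  replace (sat (fun n => value e (t n)) f) with (sat (fun n => value e
    (if Nat.even n then t (Nat.div2 n) else t' (Nat.div2 n))) (rename (fun n => 2 * n) f)).
  2: { apply propositional_extensionality. rewrite sat_rename. apply sat_ext. intros n.
       rewrite Nat.even_mul, Nat.div2_double. reflexivity. }
  replace (sat (fun n => value e (t' n)) f') with (sat (fun n => value e
    (if Nat.even n then t (Nat.div2 n) else t' (Nat.div2 n))) (rename (fun n => S (2 * n)) f')).
  2: { apply propositional_extensionality. rewrite sat_rename. apply sat_ext. intros n.
       rewrite Nat.even_succ, <- Nat.negb_even, Nat.even_mul, Nat.div2_succ_double.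
       reflexivity. }
  reflexivity.
Qed.

Lemma def_and Q Q' : Def Q -> Def Q' -> Def (fun e => Q e /\ Q' e).
Proof. apply (@def_binary (@And _)); simpl; tauto. Qed.

Lemma def_or Q Q' : Def Q -> Def Q' -> Def (fun e => Q e \/ Q' e).
Proof. apply (@def_binary (@Or _)); simpl; tauto. Qed.

Lemma def_imp Q Q' : Def Q -> Def Q' -> Def (fun e => Q e -> Q' e).
Proof. apply (@def_binary (@Imp _) (fun A B => A -> B)); simpl; tauto. Qed.

Lemma def_false : Def (fun _ => False).
Proof. exists Bot, (fun _ => inl 0); simpl; tauto. Qed.

Lemma def_true : Def (fun _ => True).
Proof. exists (Imp Bot Bot), (fun _ => inl 0); simpl; tauto. Qed.

Lemma def_not Q : Def Q -> Def (fun e => ~ Q e).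
Proof. intros; apply def_imp; auto using def_false. Qed.

Lemma def_iff Q Q' : Def Q -> Def Q' -> Def (fun e => Q e <-> Q' e).
Proof. intros; apply def_and; apply def_imp; auto. Qed.

(** Several variables of the defining formula may denote the variable about to be bound; [under]
    merges them into 0. [lower] is the assignment left outside the quantifier, with a dummy value at
    the merged variables. *)
Definition under (t : nat -> nat + M) (n : nat) : nat :=
  match t n with inl 0 => 0 | _ => S n end.

Definition lower (t : nat -> nat + M) (n : nat) : nat + M :=
  match t n with inl (S k) => inl k | inl 0 => inl 0 | inr c => inr c end.

Lemma under_lower t x (e : nat -> M) n :
  (x .: fun n => value e (lower t n)) (under t n) = value (x .: e) (t n).
Proof. unfold under, lower; destruct (t n) as [[|k]|c] eqn:E; simpl; rewrite ?E; auto. Qed.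

Lemma def_all (Q : M -> (nat -> M) -> Prop) :
  Def (fun e => Q (e 0) (fun n => e (S n))) -> Def (fun e => forall x, Q x e).
Proof.
  intros (f & t & E). exists (All (rename (under t) f)), (lower t). intros e; simpl.
  enough (H : forall x, sat (x .: fun n => value e (lower t n)) (rename (under t) f) <-> Q x e)
    by (split; intros H' x; apply H; auto).
  intros x. rewrite sat_rename, (@sat_ext _ M f _ (fun n => value (x .: e) (t n)));
    [apply (E (x .: e))|intros; apply under_lower].
Qed.

Lemma def_ex (Q : M -> (nat -> M) -> Prop) :
  Def (fun e => Q (e 0) (fun n => e (S n))) -> Def (fun e => exists x, Q x e).
Proof.
  intros (f & t & E). exists (Ex (rename (under t) f)), (lower t). intros e; simpl.
  enough (H : forall x, sat (x .: fun n => value e (lower t n)) (rename (under t) f) <-> Q x e)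
    by (split; intros [x H']; exists x; apply H; auto).
  intros x. rewrite sat_rename, (@sat_ext _ M f _ (fun n => value (x .: e) (t n)));
    [apply (E (x .: e))|intros; apply under_lower].
Qed.

Lemma def_var n : DefTerm (fun e => e n).
Proof. exists (Eq 0 1), (fun k => inl (match k with 0 => 0 | _ => S n end)); simpl; tauto. Qed.

Lemma def_const (c : M) : DefTerm (fun _ => c).
Proof. exists (Eq 0 1), (fun k => match k with 0 => inl 0 | _ => inr c end); simpl; tauto. Qed.

Lemma def_sub1 (R : M -> Prop) a :
  Def (fun e => R (e 0)) -> DefTerm a -> Def (fun e => R (a e)).
Proof.
  intros HR Ha. apply def_ext with (fun e => exists x, x = a e /\ R x).
  { intros e; split; [intros (x & -> & H); auto|eauto]. }
  apply def_ex, def_and; [exact Ha|]. exact (def_subst (fun n => inl 0) HR).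
Qed.

Lemma def_sub2 (R : M -> M -> Prop) a b :
  Def (fun e => R (e 0) (e 1)) -> DefTerm a -> DefTerm b -> Def (fun e => R (a e) (b e)).
Proof.
  intros HR Ha Hb. apply def_ext with (fun e => exists x, x = a e /\ exists y, y = b e /\ R x y).
  { intros e; split; [intros (x & -> & y & -> & H); auto|eauto 6]. }
  apply def_ex, def_and; [exact Ha|]. apply def_ex, def_and.
  - exact (def_subst (fun n => match n with 0 => inl 0 | S n => inl (S (S n)) end) Hb).
  - exact (def_subst (fun n => inl (1 - n)) HR).
Qed.

Lemma def_sub3 (R : M -> M -> M -> Prop) a b c :
  Def (fun e => R (e 0) (e 1) (e 2)) -> DefTerm a -> DefTerm b -> DefTerm c ->
  Def (fun e => R (a e) (b e) (c e)).
Proof.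
  intros HR Ha Hb Hc.
  apply def_ext with (fun e => exists x, x = c e /\ R (a e) (b e) x).
  { intros e; split; [intros (x & -> & H); auto|eauto 6]. }
  apply def_ex, def_and; [exact Hc|].
  apply def_ext with (fun e => exists y, y = b (fun n => e (S n)) /\ R (a (fun n => e (S n))) y (e 0)).
  { intros e; split; [intros (x & -> & H); auto|eauto 6]. }
  apply def_ex, def_and.
  { exact (def_subst (fun n => match n with 0 => inl 0 | S n => inl (S (S n)) end) Hb). }
  apply def_ext with (fun e => exists y, y = a (fun n => e (S (S n))) /\ R y (e 0) (e 1)).
  { intros e; split; [intros (x & -> & H); auto|eauto 6]. }
  apply def_ex, def_and.
  { exact (def_subst (fun n => match n with 0 => inl 0 | S n => inl (S (S (S n))) end) Ha). }
  exact (def_subst (fun n => inl n) HR).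
Qed.

Lemma def_sub4 (R : M -> M -> M -> M -> Prop) a b c d :
  Def (fun e => R (e 0) (e 1) (e 2) (e 3)) ->
  DefTerm a -> DefTerm b -> DefTerm c -> DefTerm d ->
  Def (fun e => R (a e) (b e) (c e) (d e)).
Proof.
  intros HR Ha Hb Hc Hd.
  apply def_ext with (fun e => exists x, x = d e /\ R (a e) (b e) (c e) x).
  { intros e; split; [intros (x & -> & H); auto|eauto 6]. }
  apply def_ex, def_and; [exact Hd|].
  apply def_ext with (fun e => exists y, y = c (fun n => e (S n)) /\
    R (a (fun n => e (S n))) (b (fun n => e (S n))) y (e 0)).
  { intros e; split; [intros (x & -> & H); auto|eauto 6]. }
  apply def_ex, def_and.
  { exact (def_subst (fun n => match n with 0 => inl 0 | S n => inl (S (S n)) end) Hc). }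
  apply def_ext with (fun e => exists y, y = b (fun n => e (S (S n))) /\
    R (a (fun n => e (S (S n)))) y (e 0) (e 1)).
  { intros e; split; [intros (x & -> & H); auto|eauto 6]. }
  apply def_ex, def_and.
  { exact (def_subst (fun n => match n with 0 => inl 0 | S n => inl (S (S (S n))) end) Hb). }
  apply def_ext with (fun e => exists y, y = a (fun n => e (S (S (S n)))) /\
    R y (e 0) (e 1) (e 2)).
  { intros e; split; [intros (x & -> & H); auto|eauto 6]. }
  apply def_ex, def_and.
  { exact (def_subst (fun n => match n with 0 => inl 0 | S n => inl (S (S (S (S n)))) end) Ha). }
  exact (def_subst (fun n => inl n) HR).
Qed.

Lemma def_mem a b : DefTerm a -> DefTerm b -> Def (fun e => mem (a e) (b e)).
Proof.
  apply def_sub2. exists (Mem 0 1), (fun n => inl n); simpl; tauto.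
Qed.

Lemma def_eq a b : DefTerm a -> DefTerm b -> Def (fun e => a e = b e).
Proof.
  apply def_sub2. exists (Eq 0 1), (fun n => inl n); simpl; tauto.
Qed.

End Definability.

(** A hook, redefined below whenever further operations have been shown definable. *)
Ltac def_user := fail.

Ltac def_step :=
  lazymatch goal with
  | |- Def (fun e => _ /\ _) => apply def_and
  | |- Def (fun e => _ \/ _) => apply def_or
  | |- Def (fun e => _ <-> _) => apply def_iff
  | |- Def (fun e => ~ _) => apply def_not
  | |- Def (fun e => False) => apply def_false
  | |- Def (fun e => True) => apply def_true
  | |- Def (fun e => exists x, _) => apply def_ex
  | |- Def (fun e => mem _ _) => apply def_mem
  | |- Def (fun e => _ = _) => apply def_eq
  | |- Def (fun e => forall _ : dom _, _) => apply def_all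
  | |- Def (fun e => _ -> _) => apply def_imp
  | |- DefTerm (fun e => e _) => apply def_var
  | |- _ => first
      [ def_user
      | simple apply def_const
      | match goal with
        | H : Def (fun e => ?R (e 0)) |- Def (fun e => ?R _) => apply (def_sub1 H)
        | H : Def (fun e => ?R (e 0) (e 1)) |- Def (fun e => ?R _ _) => apply (def_sub2 H)
        | H : Def (fun e => ?R (e 0) (e 1) (e 2) (e 3)) |- Def (fun e => ?R _ _ _ _) =>
            apply (def_sub4 H)
        end ]
  end; cbv beta.

Ltac def := cbv beta; repeat def_step.
(** * Set theory inside a model of ZF *)

Section Basics.
Context {M : structure Empty_set} {HM : ZFModel M}.
Implicit Types (x y z u v w : M).

Lemma separation_in w (Q : M -> Prop) : Def (fun e => Q (e 0)) ->
  exists y, forall z, mem z y <-> mem z w /\ Q z.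
Proof.
  intros (f & t & E).
  pose proof (zf_holds (ZF_separation (rename (under t) f))) as H.
  apply holds_closure with (e := fun n => value (fun _ => w) (lower t n)) in H.
  destruct (H w) as [y Hy]. exists y; intros z. specialize (Hy z). simpl in Hy.
  rewrite !sat_rename in Hy.
  rewrite (@sat_ext _ M f _ (fun n => value (z .: fun _ => w) (t n))), E in Hy; [exact Hy|].
  intros n. rewrite <- under_lower. destruct (under t n); reflexivity.
Qed.

Lemma replacement_in w (R : M -> M -> Prop) : Def (fun e => R (e 0) (e 1)) ->
  (forall x, mem x w -> exists y, R x y /\ forall y', R x y' -> y' = y) ->
  exists v, forall x, mem x w -> exists y, mem y v /\ R x y.
Proof.
  intros (f & t & E) HR.
  (* The scheme has [y] at 0 and [x] at 1, opposite to [R]. All remaining variables become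
     parameters, with default [w]. *)
  set (r := fun n => match t n with inl 0 => 1 | inl 1 => 0 | _ => S (S n) end).
  set (p := fun n => match t n with inl _ => w | inr c => c end).
  assert (Hr : forall x y, sat (fun n => (y .: x .: p) (r n)) f <-> R x y).
  { intros x y. rewrite (@sat_ext _ M f _ (fun n => value (x .: y .: fun _ => w) (t n))).
    - apply (E (x .: y .: fun _ => w)).
    - intros n. unfold r, p, value. destruct (t n) as [[|[|k]]|c] eqn:Et; simpl; rewrite ?Et; auto. }
  pose proof (zf_holds (ZF_replacement (rename r f))) as H.
  apply holds_closure with (e := p) in H.
  assert (HA : forall x y (e : nat -> M),
    (forall n, e n = (y .: x .: p) n) -> sat e (rename r f) <-> R x y).
  { intros x y e He. rewrite sat_rename, <- Hr. apply sat_ext; intros; apply He. }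
  destruct (H w) as [v Hv].
  - intros x Hx. destruct (HR x Hx) as (y & Hy & Hu). exists y. split.
    + rewrite sat_rename. apply (HA x y); [intros [|[|n]]; reflexivity|auto].
    + intros y' Hy'. rewrite sat_rename in Hy'.
      apply (HA x y') in Hy'; [apply Hu, Hy'|intros [|[|n]]; reflexivity].
  - exists v. intros x Hx. destruct (Hv x Hx) as (y & Hy & Hy'). exists y; split; [exact Hy|].
    rewrite sat_rename in Hy'. apply (HA x y) in Hy'; [auto|intros [|[|n]]; reflexivity].
Qed.

Lemma set_ext x y : (forall z, mem z x <-> mem z y) -> x = y.
Proof. exact (zf_holds ZF_extensionality (fun _ => x) x y). Qed.

Lemma foundation_in x : (exists y, mem y x) ->
  exists y, mem y x /\ forall z, mem z y -> ~ mem z x.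
Proof. exact (zf_holds ZF_foundation (fun _ => x) x). Qed.

(** Replacement wants a total function and gives a set that may be too large. So the domain of [R]
    is separated beforehand and the exact image afterwards. *)
Lemma image_in w (R : M -> M -> Prop) : Def (fun e => R (e 0) (e 1)) ->
  (forall x y y', mem x w -> R x y -> R x y' -> y = y') ->
  exists v, forall y, mem y v <-> exists x, mem x w /\ R x y.
Proof.
  intros HR Hf.
  destruct (@separation_in w (fun x => exists y, R x y)) as [w' Hw']; [def|].
  destruct (@replacement_in w' R HR) as [v Hv].
  - intros x Hx; apply Hw' in Hx as (Hx & y & Hy). exists y; eauto.
  - destruct (@separation_in v (fun y => exists x, mem x w /\ R x y)) as [v' Hv']; [def|].
    exists v'. intros y; rewrite Hv'. split; [tauto|].
    intros (x & Hx & Hy); split; [|eauto].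
    destruct (Hv x) as (y' & Hy' & Hxy); [apply Hw'; eauto|].
    rewrite (Hf x y y'); auto.
Qed.

(** The choice is made outside [M]. It does no harm to definability, since Extensionality makes the
    objects chosen below unique and so gives [upair] and [union_of] definable graphs. *)
Definition the (Q : M -> Prop) : M := epsilon (dom_inhabited M) Q.

Lemma the_spec (Q : M -> Prop) : (exists x, Q x) -> Q (the Q).
Proof. apply epsilon_spec. Qed.

Definition emp : M := the (fun x => forall z, ~ mem z x).
Definition upair x y : M := the (fun p => forall z, mem z p <-> z = x \/ z = y).
Definition union_of x : M := the (fun p => forall z, mem z p <-> exists y, mem y x /\ mem z y).
Definition power x : M := the (fun p => forall z, mem z p <-> forall y, mem y z -> mem y x).

Lemma in_emp z : ~ mem z emp.
Proof.
  revert z; apply (the_spec (Q := fun x => forall z, ~ mem z x)).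
  destruct (dom_inhabited M) as [w].
  destruct (@separation_in w (fun _ => False)) as [y Hy]; [def|].
  exists y; intros z Hz; apply Hy in Hz; tauto.
Qed.

Lemma in_upair x y z : mem z (upair x y) <-> z = x \/ z = y.
Proof.
  revert z; apply (the_spec (Q := fun p => forall z, mem z p <-> z = x \/ z = y)).
  exact (zf_holds ZF_pairing (fun _ => x) x y).
Qed.

Lemma in_union x z : mem z (union_of x) <-> exists y, mem y x /\ mem z y.
Proof.
  revert z; apply (the_spec (Q := fun p => forall z, mem z p <-> exists y, mem y x /\ mem z y)).
  exact (zf_holds ZF_union (fun _ => x) x).
Qed.

Lemma in_power x z : mem z (power x) <-> forall y, mem y z -> mem y x.
Proof.
  revert z; apply (the_spec (Q := fun p => forall z, mem z p <-> forall y, mem y z -> mem y x)).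
  exact (zf_holds ZF_powerset (fun _ => x) x).
Qed.

Lemma emp_eq x : x = emp <-> forall z, ~ mem z x.
Proof.
  split; [intros -> z; apply in_emp|]. intros H; apply set_ext; intros z.
  split; [intros Hz; destruct (H z Hz)|intros Hz; destruct (in_emp Hz)].
Qed.

Lemma upair_eq p x y : p = upair x y <-> forall z, mem z p <-> z = x \/ z = y.
Proof.
  split; [intros -> z; apply in_upair|]. intros H; apply set_ext; intros z.
  rewrite H, in_upair; tauto.
Qed.

Lemma union_eq p x : p = union_of x <-> forall z, mem z p <-> exists y, mem y x /\ mem z y.
Proof.
  split; [intros -> z; apply in_union|]. intros H; apply set_ext; intros z.
  rewrite H, in_union; tauto.
Qed.

Definition pair x y : M := upair (upair x x) (upair x y).
Definition binunion x y : M := union_of (upair x y).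

Lemma in_binunion x y z : mem z (binunion x y) <-> mem z x \/ mem z y.
Proof.
  unfold binunion; rewrite in_union. split.
  - intros (u & Hu & Hz). apply in_upair in Hu as [->| ->]; auto.
  - intros [H|H]; [exists x|exists y]; rewrite in_upair; auto.
Qed.

Lemma sing_inj x y z : upair x x = upair y z -> x = y /\ x = z.
Proof.
  intros H.
  assert (Hy : mem y (upair x x)) by (rewrite H, in_upair; auto).
  assert (Hz : mem z (upair x x)) by (rewrite H, in_upair; auto).
  apply in_upair in Hy, Hz. intuition congruence.
Qed.

Lemma upair_cancel x y z : upair x y = upair x z -> y = z.
Proof.
  intros H.
  assert (Hy : mem y (upair x z)) by (rewrite <- H, in_upair; auto).
  assert (Hz : mem z (upair x y)) by (rewrite H, in_upair; auto).
  apply in_upair in Hy, Hz. intuition congruence.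
Qed.

Lemma pair_inj x y x' y' : pair x y = pair x' y' -> x = x' /\ y = y'.
Proof.
  unfold pair; intros H.
  assert (E : x = x').
  { assert (Hx : mem (upair x x) (upair (upair x' x') (upair x' y')))
      by (rewrite <- H, in_upair; auto).
    apply in_upair in Hx as [Hx|Hx]; apply sing_inj in Hx; tauto. }
  subst x'; split; auto. apply upair_cancel in H. apply upair_cancel in H. exact H.
Qed.

Lemma def_upair a b : DefTerm a -> DefTerm b -> DefTerm (fun e => upair (a e) (b e)).
Proof.
  intros Ha Hb; unfold DefTerm.
  apply def_sub3 with (R := fun p x y => p = upair x y);
    [|def|exact (def_subst (fun n => match n with 0 => inl 0 | S n => inl (S (S n)) end) Ha)
     |exact (def_subst (fun n => match n with 0 => inl 0 | S n => inl (S (S n)) end) Hb)].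
  eapply def_ext; [intros e; symmetry; apply upair_eq|]. def.
Qed.

Lemma def_union a : DefTerm a -> DefTerm (fun e => union_of (a e)).
Proof.
  intros Ha; unfold DefTerm.
  apply def_sub2 with (R := fun p x => p = union_of x);
    [|def|exact (def_subst (fun n => match n with 0 => inl 0 | S n => inl (S (S n)) end) Ha)].
  eapply def_ext; [intros e; symmetry; apply union_eq|]. def.
Qed.

Lemma def_pair a b : DefTerm a -> DefTerm b -> DefTerm (fun e => pair (a e) (b e)).
Proof. intros; apply def_upair; apply def_upair; auto. Qed.

Lemma def_binunion a b : DefTerm a -> DefTerm b -> DefTerm (fun e => binunion (a e) (b e)).
Proof. intros; apply def_union, def_upair; auto. Qed.

End Basics.
Ltac def_user ::= lazymatch goal with
  | |- DefTerm (fun e => pair _ _) => apply def_pair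
  | |- DefTerm (fun e => binunion _ _) => apply def_binunion
  | |- DefTerm (fun e => upair _ _) => apply def_upair
  | |- DefTerm (fun e => union_of _) => apply def_union
  end.

(** * Hereditary back-and-forth relations *)

Section BackAndForth.
Context {M : structure Empty_set} {HM : ZFModel M}.
Implicit Types (x y z u v w d f g : M) (D p : M -> M -> Prop) (C : M -> Prop).

(* Sets of the model to be built are coded by singletons, urelements by two-element sets. *)
Definition cset d : M := upair d d.
Definition elt u x : Prop := exists d, x = cset d /\ mem u d.

Lemma cset_inj d d' : cset d = cset d' -> d = d'.
Proof. intros H; apply sing_inj in H; tauto. Qed.

Lemma elt_cset u d : elt u (cset d) <-> mem u d.
Proof. split; [intros (d' & E & H); apply cset_inj in E as ->; auto|exists d; auto]. Qed.

(* Set-sized witnesses for the relation [Bnf], which takes the place of a definition by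
   ∈-recursion: [x] decodes to the set [d] by [D], [p] is the relation between urelements. *)
Definition bnf D p C f : Prop := forall x y, mem (pair x y) f ->
  p x y \/ exists d e, D x d /\ y = cset e /\ C x /\
    (forall u, mem u d -> exists v, mem v e /\ mem (pair u v) f) /\
    (forall v, mem v e -> exists u, mem u d /\ mem (pair u v) f).

Definition Bnf D p C x y : Prop := exists f, bnf D p C f /\ mem (pair x y) f.

(** [p_dom] and [p_ran] keep the two clauses of [bnf] apart on either side. [D_wf] is foundation for
    decoded membership, the source of all inductions along [Bnf]. *)
Record coding D p C : Prop := {
  D_def : Def (fun e => D (e 0) (e 1));
  p_def : Def (fun e => p (e 0) (e 1));
  C_def : Def (fun e => C (e 0));
  D_fun : forall x d d', D x d -> D x d' -> d = d';
  D_inj : forall x x' d, D x d -> D x' d -> x = x';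
  D_wf : forall w, (exists x, mem x w) ->
    exists x, mem x w /\ forall d u, D x d -> mem u d -> ~ mem u w;
  p_fun : forall x y y', p x y -> p x y' -> y = y';
  p_inj : forall x x' y, p x y -> p x' y -> x = x';
  p_dom : forall x y d, p x y -> ~ D x d;
  p_ran : forall x y e, p x y -> y <> cset e }.

Lemma in_pair_l x y f : mem (pair x y) f -> mem x (union_of (union_of f)).
Proof.
  intros H. apply in_union; exists (upair x x); rewrite in_upair; split; auto.
  apply in_union; exists (pair x y); split; auto. apply in_upair; auto.
Qed.

Context D p C (K : coding D p C).
Notation bn := (bnf D p C).
Notation BN := (Bnf D p C).

Lemma Bnf_def : Def (fun e => BN (e 0) (e 1)).
Proof.
  destruct K as [HD Hp HC _ _ _ _ _ _ _]. unfold Bnf, bnf, cset. def.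
Qed.

(** Foundation needs a set, and the domain of a single witness [f] is one. *)
Lemma bnf_min f (Q : M -> Prop) : Def (fun e => Q (e 0)) ->
  (exists x y, mem (pair x y) f /\ Q x) ->
  exists x, (exists y, mem (pair x y) f) /\ Q x /\
    forall d u v, D x d -> mem u d -> mem (pair u v) f -> ~ Q u.
Proof.
  intros HQ (x0 & y0 & H0 & HQ0).
  destruct (@separation_in M HM (union_of (union_of f)) (fun x => (exists y, mem (pair x y) f) /\ Q x))
    as [w Hw]; [def|].
  destruct (D_wf K (w := w)) as (x & Hx & Hmin).
  - exists x0. apply Hw. split; [eapply in_pair_l; eauto|eauto].
  - apply Hw in Hx as (_ & Hx & HQx). exists x; split; [auto|split; [auto|]].
    intros d u v Hd Hu Huv HQu. apply (Hmin d u Hd Hu). apply Hw.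
    split; [eapply in_pair_l; eauto|eauto].
Qed.

(** At a minimal point of disagreement the two witnesses agree on all members, so the two images
    have the same members. *)
Lemma bnf_fun f g x y y' : bn f -> bn g -> mem (pair x y) f -> mem (pair x y') g -> y = y'.
Proof.
  intros Hf Hg Hx Hx'. apply NNPP; intros Hne.
  destruct (@bnf_min f (fun x => exists y y', mem (pair x y) f /\ mem (pair x y') g /\ y <> y'))
    as (z & _ & (v & v' & H & H' & Hv) & Hmin); [def|exists x, y; cbv beta; eauto 7|].
  apply Hv. clear Hne Hx Hx' Hv.
  destruct (Hf _ _ H) as [Hp|(d & e & Hd & -> & _ & F & B)];
    destruct (Hg _ _ H') as [Hp'|(d' & e' & Hd' & -> & _ & F' & B')].
  - eapply p_fun; eauto.
  - destruct (p_dom K Hp Hd').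
  - destruct (p_dom K Hp' Hd).
  - assert (d' = d) as -> by (eapply D_fun; eauto). f_equal.
    assert (Huniq : forall u v v', mem u d -> mem (pair u v) f -> mem (pair u v') g -> v = v').
    { intros u v v' Hu Hf1 Hg1. apply NNPP; intros Hne.
      apply (Hmin d u v Hd Hu Hf1). eauto 6. }
    apply set_ext; intros v; split; intros Hv.
    + destruct (B v Hv) as (u & Hu & Huv). destruct (F' u Hu) as (v' & Hv' & Huv').
      rewrite (Huniq u v v'); auto.
    + destruct (B' v Hv) as (u & Hu & Huv). destruct (F u Hu) as (v' & Hv' & Huv').
      rewrite <- (Huniq u v' v); auto.
Qed.

Lemma bnf_inj f g x x' y : bn f -> bn g -> mem (pair x y) f -> mem (pair x' y) g -> x = x'.
Proof.
  intros Hf Hg Hx Hx'. apply NNPP; intros Hne.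
  destruct (@bnf_min f (fun x => exists y x', mem (pair x y) f /\ mem (pair x' y) g /\ x <> x'))
    as (z & _ & (v & z' & H & H' & Hz) & Hmin); [def|exists x, y; cbv beta; eauto 7|].
  apply Hz. clear Hne Hx Hx' Hz.
  destruct (Hf _ _ H) as [Hp|(d & e & Hd & -> & _ & F & B)];
    destruct (Hg _ _ H') as [Hp'|(d' & e' & Hd' & E & _ & F' & B')].
  - eapply p_inj; eauto.
  - destruct (p_ran K Hp E).
  - destruct (p_ran K Hp' eq_refl).
  - apply cset_inj in E as <-.
    assert (Huniq : forall u u' v, mem u d -> mem (pair u v) f -> mem (pair u' v) g -> u = u').
    { intros u u' v Hu Hf1 Hg1. apply NNPP; intros Hne.
      apply (Hmin d u v Hd Hu Hf1). eauto 6. }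
    assert (d' = d) as ->; [|eapply D_inj; eauto].
    apply set_ext; intros u; split; intros Hu.
    + destruct (F' u Hu) as (v & Hv & Huv). destruct (B v Hv) as (u' & Hu' & Huv').
      rewrite <- (Huniq u' u v); auto.
    + destruct (F u Hu) as (v & Hv & Huv). destruct (B' v Hv) as (u' & Hu' & Huv').
      rewrite (Huniq u u' v); auto.
Qed.

Lemma Bnf_fun x y y' : BN x y -> BN x y' -> y = y'.
Proof. intros (f & Hf & H) (g & Hg & H'). eapply bnf_fun; [exact Hf|exact Hg| |]; eauto. Qed.

Lemma Bnf_inj x x' y : BN x y -> BN x' y -> x = x'.
Proof. intros (f & Hf & H) (g & Hg & H'). eapply bnf_inj; [exact Hf|exact Hg| |]; eauto. Qed.

Definition least_bnf x y f : Prop :=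
  bn f /\ mem (pair x y) f /\
  forall g, bn g -> mem (pair x y) g -> forall z, mem z f -> mem z g.

(* Any two back-and-forth systems agree where both are defined, so their intersection is one. *)
Lemma least_bnf_exists x y : BN x y -> exists f, least_bnf x y f.
Proof.
  intros (f & Hf & H). pose proof (D_def K); pose proof (p_def K); pose proof (C_def K).
  destruct (@separation_in M HM f (fun z => forall g, bn g -> mem (pair x y) g -> mem z g))
    as [h Hh]; [unfold bnf, cset; def|].
  exists h; split; [|split].
  - intros u v Huv; apply Hh in Huv as [Huv Hall].
    destruct (Hf _ _ Huv) as [Hp|(d & e & Hd & -> & Hc & F & B)]; [auto|right].
    exists d, e. repeat split; auto.
    + intros u' Hu'. destruct (F u' Hu') as (v' & Hv' & Huv').
      exists v'; split; auto. apply Hh; split; auto. intros g Hg Hxy.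
      destruct (Hg _ _ (Hall g Hg Hxy)) as [Hp|(d' & e' & Hd' & _ & _ & F' & _)];
        [destruct (p_dom K Hp Hd)|].
      rewrite (D_fun K Hd Hd') in Hu'. destruct (F' u' Hu') as (v'' & _ & Hv'').
      rewrite (bnf_fun Hf Hg Huv' Hv''); auto.
    + intros v' Hv'. destruct (B v' Hv') as (u' & Hu' & Huv').
      exists u'; split; auto. apply Hh; split; auto. intros g Hg Hxy.
      destruct (Hg _ _ (Hall g Hg Hxy)) as [Hp|(d' & e' & _ & Ee & _ & _ & B')];
        [destruct (p_ran K Hp eq_refl)|].
      apply cset_inj in Ee as <-. destruct (B' v' Hv') as (u'' & _ & Hu'').
      rewrite (bnf_inj Hf Hg Huv' Hu''); auto.
  - apply Hh; auto.
  - intros g Hg Hxy z Hz; apply Hh in Hz as [_ Hz]; auto.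
Qed.

(** From right to left, the witnesses for the members have to be glued together. Picking one for
    each member would require choice in [M]; the least witness is unique, so Replacement collects
    these. *)
Lemma Bnf_step x y : BN x y <->
  p x y \/ exists d e, D x d /\ y = cset e /\ C x /\
    (forall u, mem u d -> exists v, mem v e /\ BN u v) /\
    (forall v, mem v e -> exists u, mem u d /\ BN u v).
Proof.
  pose proof (D_def K); pose proof (p_def K); pose proof (C_def K).
  split.
  - intros (f & Hf & Hxy). destruct (Hf _ _ Hxy) as [Hp|(d & e & Hd & -> & Hc & F & B)]; auto.
    right; exists d, e; repeat split; auto.
    + intros u Hu; destruct (F u Hu) as (v & ? & ?); exists v; split; auto; exists f; auto.
    + intros v Hv; destruct (B v Hv) as (u & ? & ?); exists u; split; auto; exists f; auto.
  - intros [Hp|(d & e & Hd & -> & Hc & F & B)].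
    + exists (upair (pair x y) (pair x y)); split; [|apply in_upair; auto].
      intros u v Huv. left. apply in_upair in Huv.
      assert (E : pair u v = pair x y) by tauto. apply pair_inj in E as [-> ->]; auto.
    + destruct (@image_in M HM d (fun u f => exists v, mem v e /\ least_bnf u v f))
        as [w Hw].
      { unfold least_bnf, bnf, cset; def. }
      { intros u f g _ (v & _ & Hf) (v' & _ & Hg).
        destruct Hf as (Hf1 & Hf2 & Hf3), Hg as (Hg1 & Hg2 & Hg3).
        assert (v = v') as <- by (apply (@Bnf_fun u); [exists f|exists g]; auto).
        apply set_ext; intros z; split; [apply Hf3|apply Hg3]; auto. }
      set (s := pair x (cset e)).
      exists (binunion (union_of w) (upair s s)). split.
      2: { rewrite in_binunion, in_upair; auto. }
      assert (Hin : forall u v, mem u d -> mem v e -> BN u v ->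
        mem (pair u v) (binunion (union_of w) (upair s s))).
      { intros u v Hu Hv HB. apply in_binunion; left. apply in_union.
        destruct (least_bnf_exists HB) as [g Hg]. exists g; split; [|exact (proj1 (proj2 Hg))].
        apply Hw. eauto. }
      intros x' y' Hxy; apply in_binunion in Hxy as [Hxy|Hxy].
      * apply in_union in Hxy as (g & Hg & Hxy). pose proof Hg as Hg'.
        apply Hw in Hg as (u & Hu & v & Hv & Hl).
        destruct (proj1 Hl _ _ Hxy) as [?|(d' & e' & Hd' & -> & Hc' & F' & B')]; auto.
        right; exists d', e'; repeat split; auto.
        -- intros u' Hu'; destruct (F' u' Hu') as (v' & ? & ?). exists v'; split; auto.
           apply in_binunion; left; apply in_union; eauto.
        -- intros v' Hv'; destruct (B' v' Hv') as (u' & ? & ?). exists u'; split; auto.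
           apply in_binunion; left; apply in_union; eauto.
      * apply in_upair in Hxy. assert (E : pair x' y' = s) by tauto.
        apply pair_inj in E as [-> ->]. right. exists d, e; repeat split; auto.
        -- intros u Hu; destruct (F u Hu) as (v & Hv & HB); eauto.
        -- intros v Hv; destruct (B v Hv) as (u & Hu & HB); eauto.
Qed.

Lemma Bnf_ind (Q : M -> Prop) : Def (fun e => Q (e 0)) ->
  (forall x, (exists y, BN x y) -> (forall d u, D x d -> mem u d -> Q u) -> Q x) ->
  forall x y, BN x y -> Q x.
Proof.
  intros HQ IH x y (f & Hf & Hxy). apply NNPP; intros Hne.
  destruct (@bnf_min f (fun x => ~ Q x)) as (z & (v & Hz) & HnQ & Hmin); [def|eauto|].
  apply HnQ. apply IH; [exists v, f; auto|].
  intros d u Hd Hu. apply NNPP; intros HQu.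
  destruct (Hf _ _ Hz) as [Hp|(d' & e' & Hd' & _ & _ & F & _)]; [destruct (p_dom K Hp Hd)|].
  rewrite (D_fun K Hd Hd') in Hu. destruct (F u Hu) as (v' & _ & Hv').
  rewrite <- (D_fun K Hd Hd') in Hu. apply (Hmin d u v' Hd Hu Hv'); auto.
Qed.

End BackAndForth.

(** * Two ways of reading an object as a set *)

Section Decoding.
Context {M : structure Empty_set} {HM : ZFModel M}.
Implicit Types (x y z u v w d f g : M).

Definition decode x d : Prop := x = cset d.
Definition plain x d : Prop := x = d.

Lemma plain_wf w : (exists x, mem x w) ->
  exists x, mem x w /\ forall d u, plain x d -> mem u d -> ~ mem u w.
Proof.
  intros H; destruct (foundation_in H) as (x & Hx & Hmin). exists x; split; auto.
  intros d u <-; apply Hmin.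
Qed.

(* An ∈-minimal member of [w] together with the sets coded in [w] is either itself minimal, or
   its code is. *)
Lemma decode_wf w : (exists x, mem x w) ->
  exists x, mem x w /\ forall d u, decode x d -> mem u d -> ~ mem u w.
Proof.
  intros [x0 H0].
  destruct (@separation_in M HM (union_of w) (fun d => mem (cset d) w)) as [w' Hw'];
    [unfold cset; def|].
  destruct (@foundation_in M HM (binunion w w')) as (x & Hx & Hmin).
  { exists x0; apply in_binunion; auto. }
  assert (Hc : forall d, mem (cset d) w -> mem d w').
  { intros d Hd. apply Hw'; split; auto. apply in_union; exists (cset d); split; auto.
    apply in_upair; auto. }
  apply in_binunion in Hx as [Hx|Hx].
  - exists x; split; auto. intros d u -> Hu Huw.
    apply (Hmin d); [apply in_upair; auto|]. apply in_binunion; auto.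
  - apply Hw' in Hx as [_ Hx]. exists (cset x); split; auto.
    intros d u E Hu Huw. apply cset_inj in E as <-.
    apply (Hmin u Hu), in_binunion; auto.
Qed.

Lemma coding_decode (p : M -> M -> Prop) (C : M -> Prop) :
  Def (fun e => p (e 0) (e 1)) -> Def (fun e => C (e 0)) ->
  (forall x y y', p x y -> p x y' -> y = y') ->
  (forall x x' y, p x y -> p x' y -> x = x') ->
  (forall x y d, p x y -> x <> cset d) -> (forall x y e, p x y -> y <> cset e) ->
  coding decode p C.
Proof.
  intros Hp HC ? ? ? ?; constructor; eauto using decode_wf.
  - unfold decode, cset; def.
  - unfold decode; intros; apply cset_inj; congruence.
  - unfold decode; congruence.
Qed.

(** In this instance [Bnf] is the translation of a set of [M] into its hereditary code. *)
Lemma coding_plain : coding plain (fun _ _ => False) (fun _ => True).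
Proof.
  constructor; try tauto; try (unfold plain; congruence); try (unfold plain; def; fail);
    try (def; fail). apply plain_wf.
Qed.

End Decoding.
(** * Coded natural numbers *)

Section Naturals.
Context {M : structure Empty_set} {HM : ZFModel M}.
Implicit Types (x y z u v w d f g r i j k m n : M) (a b : (nat -> M) -> M).

Lemma union_cset d : union_of (cset d) = d.
Proof.
  apply set_ext; intros z; rewrite in_union; split.
  - intros (y & Hy & Hz); apply in_upair in Hy as [->| ->]; auto.
  - intros Hz; exists d; split; auto; apply in_upair; auto.
Qed.

(** The numbers are to be the von Neumann numerals of the new model, hence codes at every level; in
    [succ], [union_of] takes off the outer singleton. *)
Definition zero : M := cset emp.
Definition succ x : M := cset (binunion (union_of x) (upair x x)).

Lemma def_cset a : DefTerm a -> DefTerm (fun e => cset (a e)).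
Proof. intros; apply def_upair; auto. Qed.

Lemma def_succ a : DefTerm a -> DefTerm (fun e => succ (a e)).
Proof. intros; apply def_cset, def_binunion; [apply def_union|apply def_upair]; auto. Qed.

Lemma def_elt a b : DefTerm a -> DefTerm b -> Def (fun e => elt (a e) (b e)).
Proof. apply def_sub2. unfold elt, cset. def. Qed.

Lemma omega_exists : exists w, mem emp w /\ (forall x, mem x w -> mem (binunion x (upair x x)) w) /\
  forall Q : M -> Prop, Def (fun e => Q (e 0)) -> Q emp ->
    (forall x, mem x w -> Q x -> Q (binunion x (upair x x))) -> forall x, mem x w -> Q x.
Proof.
  destruct (zf_holds ZF_infinity (fun _ => emp)) as (w & (x0 & H0 & H0') & Hw).
  set (ind := fun i => mem emp i /\ forall x, mem x i -> mem (binunion x (upair x x)) i).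
  assert (Hind : ind w).
  { split.
    - assert (x0 = emp) as <-; [|exact H0].
      apply emp_eq. intros z Hz. apply H0'. exists z; exact Hz.
    - intros x Hx. destruct (Hw x Hx) as (y & Hy & Hs).
      replace (binunion x (upair x x)) with y; [exact Hy|]. apply set_ext. intros z.
      rewrite in_binunion, in_upair. destruct (Hs z) as [Hs1 Hs2]; simpl in Hs1, Hs2. tauto. }
  destruct (@separation_in M HM w (fun x => forall i, ind i -> mem x i)) as [o Ho];
    [unfold ind; def|].
  exists o. split; [|split].
  - apply Ho. split; [apply Hind|intros i Hi; apply Hi].
  - intros x Hx. apply Ho in Hx as [Hx Hx']. apply Ho.
    split; [apply Hind; auto|intros i Hi; apply Hi; auto].
  - intros Q HQ Q0 QS x Hx. destruct (@separation_in M HM o Q HQ) as [q Hq].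
    apply Hq. apply Ho in Hx as [_ Hx]. apply Hx. split.
    + apply Hq. split; auto. apply Ho. split; [apply Hind|intros i Hi; apply Hi].
    + intros y Hy. apply Hq in Hy as [Hy HQy]. apply Hq. split; auto.
      apply Ho in Hy as [Hy Hy']. apply Ho.
      split; [apply Hind; auto|intros i Hi; apply Hi; auto].
Qed.

Definition is_nat_set w : Prop :=
  mem zero w /\ (forall n, mem n w -> mem (succ n) w) /\
  forall Q : M -> Prop, Def (fun e => Q (e 0)) -> Q zero ->
    (forall n, mem n w -> Q n -> Q (succ n)) -> forall n, mem n w -> Q n.

Definition Nats : M := the is_nat_set.

(* The code of a von Neumann numeral is found by recursion on its elements, for which [Bnf]
   with all sets decoding to themselves serves. *)
Lemma Nats_spec : is_nat_set Nats.
Proof.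
  unfold Nats; apply the_spec.
  pose proof (@coding_plain M HM) as K.
  set (hat := Bnf plain (fun _ _ => False) (fun _ : M => True)).
  assert (Hdef : Def (fun e => hat (e 0) (e 1))) by exact (Bnf_def K).
  destruct omega_exists as (w & Hw0 & HwS & Hind).
  assert (hat0 : hat emp zero).
  { apply (Bnf_step K). right; exists emp, emp; repeat split; auto;
      intros u Hu; destruct (in_emp Hu). }
  assert (hatS : forall x y, hat x y -> hat (binunion x (upair x x)) (succ y)).
  { intros x y Hxy. pose proof Hxy as Hxy'.
    apply (Bnf_step K) in Hxy' as [[]|(d & e & <- & -> & _ & F & B)].
    apply (Bnf_step K). right.
    exists (binunion x (upair x x)), (binunion e (upair (cset e) (cset e))).
    unfold succ; rewrite union_cset. repeat split; auto.
    - intros u Hu. apply in_binunion in Hu as [Hu|Hu].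
      + destruct (F u Hu) as (v & Hv & Huv). exists v; rewrite in_binunion; auto.
      + apply in_upair in Hu. assert (u = x) as -> by tauto.
        exists (cset e); rewrite in_binunion, in_upair; auto.
    - intros v Hv. apply in_binunion in Hv as [Hv|Hv].
      + destruct (B v Hv) as (u & Hu & Huv). exists u; rewrite in_binunion; auto.
      + apply in_upair in Hv. assert (v = cset e) as -> by tauto.
        exists x; rewrite in_binunion, in_upair; auto. }
  destruct (@image_in M HM w hat Hdef) as [l Hl].
  { intros x y y' _; apply (Bnf_fun K). }
  exists l. split; [|split].
  - apply Hl; eauto.
  - intros n Hn; apply Hl in Hn as (x & Hx & Hxn). apply Hl; eauto.
  - intros Q HQ Q0 QS n Hn. apply Hl in Hn as (x & Hx & Hxn).
    assert (H : forall x, mem x w -> exists y, hat x y /\ Q y).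
    { apply Hind; [def|eauto|].
      intros x' Hx' (y & Hxy & Hy). exists (succ y); split; auto.
      apply QS; auto. apply Hl; eauto. }
    destruct (H x Hx) as (y & Hy & HQy).
    rewrite (Bnf_fun K Hxn Hy); auto.
Qed.

Lemma nat_zero : mem zero Nats.
Proof. exact (proj1 Nats_spec). Qed.

Lemma nat_succ n : mem n Nats -> mem (succ n) Nats.
Proof. exact (proj1 (proj2 Nats_spec) n). Qed.

Lemma nat_ind (Q : M -> Prop) : Def (fun e => Q (e 0)) -> Q zero ->
  (forall n, mem n Nats -> Q n -> Q (succ n)) -> forall n, mem n Nats -> Q n.
Proof. exact (proj2 (proj2 Nats_spec) Q). Qed.

Lemma elt_zero u : ~ elt u zero.
Proof. intros H; apply elt_cset in H; destruct (in_emp H). Qed.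

Lemma nat_code n : mem n Nats -> exists d, n = cset d.
Proof.
  revert n; apply (nat_ind (Q := fun n => exists d, n = cset d));
    [unfold cset; def|exists emp; auto|].
  intros n _ _; eexists; reflexivity.
Qed.

Lemma elt_succ n u : mem n Nats -> elt u (succ n) <-> elt u n \/ u = n.
Proof.
  intros Hn. destruct (nat_code Hn) as [d ->].
  unfold succ. rewrite union_cset, !elt_cset, in_binunion, in_upair. tauto.
Qed.

End Naturals.

Ltac def_user ::= lazymatch goal with
  | |- DefTerm (fun e => pair _ _) => apply def_pair
  | |- DefTerm (fun e => succ _) => apply def_succ
  | |- DefTerm (fun e => cset _) => apply def_cset
  | |- DefTerm (fun e => binunion _ _) => apply def_binunion
  | |- DefTerm (fun e => upair _ _) => apply def_upair
  | |- DefTerm (fun e => union_of _) => apply def_union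
  | |- Def (fun e => elt _ _) => apply def_elt
  end.

Ltac nat_induction :=
  match goal with |- forall n, mem n Nats -> @?Q n => apply (@nat_ind _ _ Q); cbv beta end.

(** * Order of the coded numbers and the pigeonhole principle *)

Section Order.
Context {M : structure Empty_set} {HM : ZFModel M}.
Implicit Types (x y z u v w d f g r i j k m n : M).

Lemma nat_down n : mem n Nats -> forall u, elt u n -> mem u Nats.
Proof.
  revert n; nat_induction; [def| |].
  - intros u Hu; destruct (elt_zero Hu).
  - intros n Hn IH u Hu. apply elt_succ in Hu as [Hu| ->]; auto.
Qed.

Lemma nat_trans n : mem n Nats -> forall u v, elt u n -> elt v u -> elt v n.
Proof.
  revert n; nat_induction; [def| |].
  - intros u v Hu; destruct (elt_zero Hu).
  - intros n Hn IH u v Hu Hv. apply elt_succ in Hu as [Hu| ->]; auto;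
      apply elt_succ; eauto.
Qed.

Lemma nat_irrefl n : mem n Nats -> ~ elt n n.
Proof.
  revert n; nat_induction; [def|apply elt_zero|].
  intros n Hn IH H. apply IH.
  assert (Hs : elt n (succ n)) by (apply elt_succ; auto).
  apply elt_succ in H as [H|H]; auto; [|rewrite <- H at 2; auto].
  apply (nat_trans Hn H Hs).
Qed.

Lemma nat_linear m n : mem m Nats -> mem n Nats -> elt m n \/ m = n \/ elt n m.
Proof.
  assert (H0 : forall n, mem n Nats -> n = zero \/ elt zero n).
  { nat_induction; [def|auto|]. intros k Hk [->|H]; right; apply elt_succ; auto. }
  intros Hm; revert m Hm n.
  nat_induction; [def| |].
  - intros n Hn; destruct (H0 n Hn); auto.
  - intros m Hm IH. nat_induction; [def| |].
    + destruct (H0 (succ m) (nat_succ Hm)); auto.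
    + intros n Hn IHn. destruct (IHn) as [H|[H|H]].
      * left; apply elt_succ; auto.
      * left; apply elt_succ; auto.
      * apply elt_succ in H as [H|H]; auto; [|subst; auto].
        destruct (IH _ (nat_succ Hn)) as [H'|[H'|H']].
        -- apply elt_succ in H' as [H'|H']; auto; exfalso.
           ++ apply (nat_irrefl Hn). eapply nat_trans; eauto.
           ++ subst. apply (nat_irrefl Hn); auto.
        -- right; right; apply elt_succ; auto.
        -- right; right; apply elt_succ; auto.
Qed.

Definition nat_le m n : Prop := forall j, elt j m -> elt j n.

Lemma nat_bound m n : mem m Nats -> mem n Nats ->
  exists k, mem k Nats /\ elt m k /\ elt n k /\ nat_le m k /\ nat_le n k.
Proof.
  intros Hm Hn.
  assert (Hk : exists k, mem k Nats /\ elt m k /\ elt n k).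
  { destruct (nat_linear Hm Hn) as [H|[->|H]].
    - exists (succ n); rewrite !elt_succ by auto; auto using nat_succ.
    - exists (succ n); rewrite !elt_succ by auto; auto using nat_succ.
    - exists (succ m); rewrite !elt_succ by auto; auto using nat_succ. }
  destruct Hk as (k & Hk & H1 & H2). exists k.
  refine (conj Hk (conj H1 (conj H2 (conj _ _)))); intros j Hj;
    [exact (nat_trans Hk H1 Hj)|exact (nat_trans Hk H2 Hj)].
Qed.

(** The induction in [pigeonhole] quantifies over relations and must stay definable in [M], so
    relations between numbers have to be sets of [M]. *)
Lemma relation_set (R : M -> M -> Prop) : Def (fun e => R (e 0) (e 1)) ->
  exists r, forall i k, mem (pair i k) r <-> mem i Nats /\ mem k Nats /\ R i k.
Proof.
  intros HR.
  destruct (@separation_in M HM (power (power Nats)) (fun z => exists i k,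
    z = pair i k /\ mem i Nats /\ mem k Nats /\ R i k)) as [r Hr]; [def|].
  exists r. intros i k. rewrite Hr. split.
  - intros (_ & i' & k' & E & H). apply pair_inj in E as [-> ->]; auto.
  - intros (Hi & Hk & H); split; [|eauto 6].
    apply in_power. intros y Hy. apply in_power. intros z Hz.
    apply in_upair in Hy as [->| ->]; apply in_upair in Hz as [->| ->]; auto.
Qed.

(* For the step, if [i] is sent to the top value [m], reroute it through the value of the last
   argument [succ m]. *)
Lemma pigeonhole m : mem m Nats -> forall r,
  (forall i, elt i (succ m) -> exists k, elt k m /\ mem (pair i k) r) ->
  exists i j k, elt i (succ m) /\ elt j (succ m) /\ i <> j /\
    mem (pair i k) r /\ mem (pair j k) r.
Proof.
  revert m; nat_induction; [def| |].
  - intros r H. destruct (H zero) as (k & Hk & _); [apply elt_succ; auto using nat_zero|].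
    destruct (elt_zero Hk).
  - intros m Hm IH r H. apply NNPP; intros Hno.
    assert (Hinj : forall i j k, elt i (succ (succ m)) -> elt j (succ (succ m)) ->
      mem (pair i k) r -> mem (pair j k) r -> i = j).
    { intros i j k Hi Hj H1 H2. apply NNPP; intros Hij. apply Hno. exists i, j, k; auto. }
    assert (Hsm := nat_succ Hm).
    assert (Hup : forall i, elt i (succ m) -> elt i (succ (succ m)))
      by (intros i Hi; apply elt_succ; auto).
    assert (Htop : elt (succ m) (succ (succ m))) by (apply elt_succ; auto).
    assert (Hne : forall i, elt i (succ m) -> i <> succ m)
      by (intros i Hi ->; apply (nat_irrefl Hsm Hi)).
    destruct (@relation_set (fun i k => mem (pair i k) r \/
      (mem (pair i m) r /\ mem (pair (succ m) k) r))) as [r' Hr]; [def|].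
    destruct (IH r') as (i & j & k & Hi & Hj & Hij & H1 & H2).
    + intros i Hi. destruct (H i (Hup i Hi)) as (k & Hk & Hik).
      apply elt_succ in Hk as [Hk| ->]; auto.
      * exists k; split; auto. apply Hr.
        split; [exact (nat_down Hsm Hi)|split; [exact (nat_down Hm Hk)|auto]].
      * destruct (H (succ m) Htop) as (k & Hk & Hmk).
        apply elt_succ in Hk as [Hk| ->]; auto.
        -- exists k; split; auto. apply Hr.
        split; [exact (nat_down Hsm Hi)|split; [exact (nat_down Hm Hk)|auto]].
        -- destruct (Hne i Hi). eapply Hinj; eauto.
    + apply Hr in H1 as (_ & _ & H1), H2 as (_ & _ & H2).
      destruct H1 as [H1|[H1 H3]], H2 as [H2|[H2 H4]].
      * eauto.
      * apply (Hne i Hi). eauto.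
      * apply (Hne j Hj). eauto.
      * eauto.
Qed.

End Order.
(** * Urelements and partial permutations of them *)

Section Atoms.
Context {M : structure Empty_set} {HM : ZFModel M}.
Implicit Types (x y z u v w d f g i j k m n : M).

(** The inner singleton differs from [emp], so an atom has two members and is never a [cset]. *)
Definition atom i b a : M := upair emp (upair (pair (pair i b) a) (pair (pair i b) a)).

Lemma atom_inj i b a i' b' a' : atom i b a = atom i' b' a' -> i = i' /\ b = b' /\ a = a'.
Proof.
  intros H. apply upair_cancel in H. apply sing_inj in H as [H _].
  apply pair_inj in H as [H ->]. apply pair_inj in H as [-> ->]. auto.
Qed.

Lemma atom_not_cset i b a d : atom i b a <> cset d.
Proof.
  intros H. symmetry in H. apply sing_inj in H as [-> H].
  apply (in_emp (z := pair (pair i b) a)). rewrite H. apply in_upair; auto.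
Qed.

Lemma def_atom (a b c : (nat -> M) -> M) : DefTerm a -> DefTerm b -> DefTerm c ->
  DefTerm (fun e => atom (a e) (b e) (c e)).
Proof.
  intros. apply def_upair; [apply def_const|].
  apply def_upair; apply def_pair; try apply def_pair; auto.
Qed.

Section Diagonal.
Context (p : M -> M -> Prop) (C : M -> Prop) (K : coding decode p C).
Context (p_eq : forall x y, p x y -> x = y).

(** By induction, Extensionality identifies the two sides. The diagonal of such a [Bnf] then acts as
    a predicate defined by recursion on members; [Pure] and [HS] arise in this way. *)
Lemma Bnf_eq x y : Bnf decode p C x y -> x = y.
Proof.
  pose proof (Bnf_def K) as HB.
  intros H; generalize H; revert y H.
  (* The induction is for a predicate of [x] alone, so the image is quantified again inside it; the
     outer [y] only places [x] in the domain. The same device returns for [Act]. *)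
  enough (E : forall x y, Bnf decode p C x y -> forall z, Bnf decode p C x z -> x = z) by eauto.
  apply (Bnf_ind K (Q := fun x => forall z, Bnf decode p C x z -> x = z)); [def|].
  clear x. intros x _ IH z Hz. apply (Bnf_step K) in Hz as [Hp|(d & e & -> & -> & _ & F & B)].
  { auto. }
  f_equal. apply set_ext; intros u; split; intros Hu.
  - destruct (F u Hu) as (v & Hv & Huv). rewrite (IH d u eq_refl Hu v Huv); auto.
  - destruct (B u Hu) as (v & Hv & Huv). rewrite <- (IH d v eq_refl Hv u Huv); auto.
Qed.

Lemma Bnf_diag x : Bnf decode p C x x <->
  p x x \/ exists d, x = cset d /\ C x /\ forall u, mem u d -> Bnf decode p C u u.
Proof.
  rewrite (Bnf_step K). split; (intros [Hp|H]; [auto|right]).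
  - destruct H as (d & e & -> & E & Hc & F & B). apply cset_inj in E as <-.
    exists d; repeat split; auto. intros u Hu. destruct (F u Hu) as (v & Hv & Huv).
    rewrite (Bnf_eq Huv) at 2. exact Huv.
  - destruct H as (d & -> & Hc & H). exists d, d; repeat split; eauto.
Qed.

Lemma Bnf_diag_ind (Q : M -> Prop) : Def (fun e => Q (e 0)) ->
  (forall x, p x x -> Q x) ->
  (forall d, C (cset d) -> (forall u, mem u d -> Bnf decode p C u u) ->
    (forall u, mem u d -> Q u) -> Q (cset d)) ->
  forall x, Bnf decode p C x x -> Q x.
Proof.
  intros HQ H1 H2 x H. apply (Bnf_ind K HQ) with x; auto. clear x H.
  intros x [y Hy] IH. pose proof (Bnf_eq Hy) as <-.
  apply Bnf_diag in Hy as [Hp|(d & -> & Hc & Hu)]; auto.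
  apply H2; auto. intros u; apply (IH d u eq_refl).
Qed.

End Diagonal.

Definition Pure x : Prop := Bnf decode (fun _ _ => False) (fun _ => True) x x.

Lemma coding_pure : coding decode (fun _ _ : M => False) (fun _ : M => True).
Proof. apply coding_decode; try tauto; def. Qed.

Lemma Pure_def : Def (fun e => Pure (e 0)).
Proof.
  unfold Pure. exact (def_sub2 (Bnf_def coding_pure) (def_var 0) (def_var 0)).
Qed.

Lemma Pure_step x : Pure x <-> exists d, x = cset d /\ forall u, mem u d -> Pure u.
Proof.
  unfold Pure. rewrite (Bnf_diag coding_pure) by tauto. split.
  - intros [[]|(d & -> & _ & H)]; eauto.
  - intros (d & -> & H); right; eauto.
Qed.

Lemma Pure_cset d : Pure (cset d) <-> forall u, mem u d -> Pure u.
Proof.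
  rewrite Pure_step; split; [intros (e & E & H); apply cset_inj in E as ->; auto|eauto].
Qed.

Lemma Pure_ind (Q : M -> Prop) : Def (fun e => Q (e 0)) ->
  (forall d, (forall u, mem u d -> Pure u) -> (forall u, mem u d -> Q u) -> Q (cset d)) ->
  forall x, Pure x -> Q x.
Proof. intros HQ H. apply (Bnf_diag_ind coding_pure); tauto || eauto. Qed.

(* The diagonal of a back-and-forth system is a transitive set of pure sets. *)
Lemma Pure_closure x : Pure x -> exists w, mem x w /\
  forall u, mem u w -> Pure u /\ exists d, u = cset d /\ forall v, mem v d -> mem v w.
Proof.
  intros (f & Hf & Hx).
  destruct (@separation_in M HM (union_of (union_of f)) (fun u => mem (pair u u) f)) as [w Hw];
    [def|].
  assert (HP : forall u, mem (pair u u) f -> Pure u) by (intros u Hu; exists f; auto).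
  exists w. split; [apply Hw; eauto using in_pair_l|].
  intros u Hu; apply Hw in Hu as [_ Hu]. split; auto.
  destruct (Hf _ _ Hu) as [[]|(d & e & -> & E & _ & F & _)].
  exists d; split; auto. intros v Hv. destruct (F v Hv) as (v' & _ & Hvv).
  assert (v = v') as <-.
  { apply (Bnf_eq coding_pure); [tauto|]. exists f; auto. }
  apply Hw; eauto using in_pair_l.
Qed.

End Atoms.

Ltac def_user ::= lazymatch goal with
  | |- DefTerm (fun e => pair _ _) => apply def_pair
  | |- DefTerm (fun e => succ _) => apply def_succ
  | |- DefTerm (fun e => cset _) => apply def_cset
  | |- DefTerm (fun e => atom _ _ _) => apply def_atom
  | |- DefTerm (fun e => binunion _ _) => apply def_binunion
  | |- DefTerm (fun e => upair _ _) => apply def_upair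
  | |- DefTerm (fun e => union_of _) => apply def_union
  | |- Def (fun e => elt _ _) => apply def_elt
  | |- Def (fun e => Pure _) => apply (def_sub1 Pure_def)
  end.

(** * The action of partial index maps on sets *)

Section Action.
Context {M : structure Empty_set} {HM : ZFModel M}.
Implicit Types (x y z u v w d f g i j k m n : M) (t s : M -> M -> M -> M -> Prop).

Definition atom_map t x y : Prop :=
  exists i b i' b' a, x = atom i b a /\ y = atom i' b' a /\ t i b i' b'.

(* The partial map on sets and urelements that the partial map [t] on indices induces. *)
Definition Act t x y : Prop := Bnf decode (atom_map t) (fun _ => True) x y.

Record partial_inj t : Prop := {
  t_def : Def (fun e => t (e 0) (e 1) (e 2) (e 3));
  t_fun : forall i b i' b' j c, t i b i' b' -> t i b j c -> i' = j /\ b' = c;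
  t_inj : forall i b i' b' j c, t i b i' b' -> t j c i' b' -> i = j /\ b = c }.

Lemma coding_act t : partial_inj t -> coding decode (atom_map t) (fun _ : M => True).
Proof.
  intros Ht. pose proof (t_def Ht). apply coding_decode; unfold atom_map; [def|def| | | |].
  - intros x y y' (i & b & i' & b' & a & -> & -> & H1) (j & c & j' & c' & a' & E & -> & H2).
    apply atom_inj in E as (<- & <- & <-). destruct (t_fun Ht H1 H2) as [-> ->]; auto.
  - intros x x' y (i & b & i' & b' & a & -> & -> & H1) (j & c & j' & c' & a' & -> & E & H2).
    apply atom_inj in E as (<- & <- & <-). destruct (t_inj Ht H1 H2) as [-> ->]; auto.
  - intros x y d (i & b & i' & b' & a & -> & _ & _); apply atom_not_cset.
  - intros x y d (i & b & i' & b' & a & _ & -> & _); apply atom_not_cset.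
Qed.

Lemma Act_def t : partial_inj t -> Def (fun e => Act t (e 0) (e 1)).
Proof. intros Ht; apply Bnf_def, coding_act, Ht. Qed.

Lemma Act_step t x y : partial_inj t -> Act t x y <-> atom_map t x y \/
  exists d e, x = cset d /\ y = cset e /\
    (forall u, mem u d -> exists v, mem v e /\ Act t u v) /\
    (forall v, mem v e -> exists u, mem u d /\ Act t u v).
Proof.
  intros Ht; unfold Act; rewrite (Bnf_step (coding_act Ht)).
  split; (intros [H|(d & e & H)]; [auto|right; exists d, e; unfold decode in *; tauto]).
Qed.

Lemma Act_fun t x y y' : partial_inj t -> Act t x y -> Act t x y' -> y = y'.
Proof. intros Ht; apply (Bnf_fun (coding_act Ht)). Qed.

Lemma Act_inj t x x' y : partial_inj t -> Act t x y -> Act t x' y -> x = x'.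
Proof. intros Ht; apply (Bnf_inj (coding_act Ht)). Qed.

Lemma Act_atom t i b a y : partial_inj t ->
  Act t (atom i b a) y <-> exists i' b', y = atom i' b' a /\ t i b i' b'.
Proof.
  intros Ht; rewrite Act_step by auto. split.
  - intros [(j & c & i' & b' & a' & E & -> & H)|(d & e & E & _)].
    + apply atom_inj in E as (-> & -> & ->); eauto.
    + destruct (atom_not_cset E).
  - intros (i' & b' & -> & H). left. exists i, b, i', b', a; auto.
Qed.

Lemma Act_cset t d e : partial_inj t -> Act t (cset d) (cset e) <->
  (forall u, mem u d -> exists v, mem v e /\ Act t u v) /\
  (forall v, mem v e -> exists u, mem u d /\ Act t u v).
Proof.
  intros Ht; rewrite Act_step by auto. split.
  - intros [(j & c & i' & b' & a' & E & _)|(d' & e' & E & E' & H)].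
    + destruct (atom_not_cset (eq_sym E)).
    + apply cset_inj in E as <-. apply cset_inj in E' as <-; auto.
  - intros H; right; exists d, e; auto.
Qed.

Lemma Act_cset_l t d y : partial_inj t -> Act t (cset d) y -> exists e, y = cset e.
Proof.
  intros Ht H; apply (Act_step _ _ Ht) in H as [(j & c & i' & b' & a' & E & _)|(d' & e' & _ & -> & _)].
  - destruct (atom_not_cset (eq_sym E)).
  - eauto.
Qed.

Lemma Act_ind t (Q : M -> Prop) : partial_inj t -> Def (fun e => Q (e 0)) ->
  (forall i b a, Q (atom i b a)) -> (forall d, (forall u, mem u d -> Q u) -> Q (cset d)) ->
  forall x y, Act t x y -> Q x.
Proof.
  intros Ht HQ H1 H2. apply (Bnf_ind (coding_act Ht) HQ).
  intros x [y Hy] IH. apply (Act_step _ _ Ht) in Hy as [(j & c & i' & b' & a' & -> & _)|(d & e & -> & _)];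
    auto. apply H2. intros u. apply (IH d u eq_refl).
Qed.

(** Since [r] need only extend the composite, restricting and then permuting can be read as the
    action of a map that is already understood. *)
Lemma Act_comp t s r x y z : partial_inj t -> partial_inj s -> partial_inj r ->
  (forall i b i' b' j c, t i b i' b' -> s i' b' j c -> r i b j c) ->
  Act t x y -> Act s y z -> Act r x z.
Proof.
  intros Ht Hs Hr H Hxy. revert z. revert y Hxy.
  enough (E : forall x y', Act t x y' -> forall y z, Act t x y -> Act s y z -> Act r x z) by eauto.
  clear x. pose proof (Act_def Ht); pose proof (Act_def Hs); pose proof (Act_def Hr).
  apply (Act_ind (Q := fun x => forall y z, Act t x y -> Act s y z -> Act r x z) Ht); [def| |].
  - intros i b a y z Hy Hz. apply Act_atom in Hy as (i' & b' & -> & Hy); auto.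
    apply Act_atom in Hz as (i'' & b'' & -> & Hz); auto. apply Act_atom; eauto.
  - intros d IH y z Hy Hz. destruct (Act_cset_l Ht Hy) as [e ->].
    destruct (Act_cset_l Hs Hz) as [f ->].
    apply Act_cset in Hy as [F B]; auto. apply Act_cset in Hz as [F' B']; auto.
    apply Act_cset; auto. split.
    + intros u Hu. destruct (F u Hu) as (v & Hv & Huv). destruct (F' v Hv) as (w & Hw & Hvw).
      exists w; eauto.
    + intros w Hw. destruct (B' w Hw) as (v & Hv & Hvw). destruct (B v Hv) as (u & Hu & Huv).
      exists u; eauto.
Qed.

Lemma Act_mono t s x y : partial_inj t -> partial_inj s ->
  (forall i b i' b', t i b i' b' -> s i b i' b') -> Act t x y -> Act s x y.
Proof.
  intros Ht Hs H (f & Hf & Hxy). exists f; split; auto.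
  intros u v Huv. destruct (Hf u v Huv) as [(i & b & i' & b' & a & E & E' & Hi)|Hs']; auto.
  left; exists i, b, i', b', a; auto.
Qed.

Lemma Act_conv t s x y : partial_inj t -> partial_inj s ->
  (forall i b i' b', t i b i' b' -> s i' b' i b) -> Act t x y -> Act s y x.
Proof.
  intros Ht Hs H. revert y.
  enough (E : forall x y', Act t x y' -> forall y, Act t x y -> Act s y x) by eauto.
  clear x. pose proof (Act_def Ht); pose proof (Act_def Hs).
  apply (Act_ind (Q := fun x => forall y, Act t x y -> Act s y x) Ht); [def| |].
  - intros i b a y Hy. apply Act_atom in Hy as (i' & b' & -> & Hy); auto.
    apply Act_atom; eauto.
  - intros d IH y Hy. destruct (Act_cset_l Ht Hy) as [e ->].
    apply Act_cset in Hy as [F B]; auto. apply Act_cset; auto. split.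
    + intros u Hu. destruct (B u Hu) as (v & Hv & Huv). exists v; auto.
    + intros v Hv. destruct (F v Hv) as (u & Hu & Huv). exists u; auto.
Qed.

Lemma Act_id t x y : partial_inj t ->
  (forall i b i' b', t i b i' b' -> i = i' /\ b = b') -> Act t x y -> x = y.
Proof.
  intros Ht H. apply (Bnf_eq (coding_act Ht)).
  intros u v (i & b & i' & b' & a & -> & -> & Hi). apply H in Hi as [-> ->]; auto.
Qed.

Lemma Act_pure t x : partial_inj t -> Pure x -> Act t x x.
Proof.
  intros Ht. pose proof (Act_def Ht). revert x. apply Pure_ind; [def|].
  intros d _ IH. apply Act_cset; auto. split; intros u Hu; exists u; auto.
Qed.

Lemma Act_elt t x y x' y' : partial_inj t -> Act t x x' -> Act t y y' ->
  elt x y <-> elt x' y'.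
Proof.
  intros Ht Hx Hy. split; intros (d & -> & Hd).
  - destruct (Act_cset_l Ht Hy) as [e ->]. apply Act_cset in Hy as [F _]; auto.
    destruct (F x Hd) as (v & Hv & Hxv). rewrite (Act_fun Ht Hx Hxv). apply elt_cset; auto.
  - apply (Act_step _ _ Ht) in Hy as [(j & c & i' & b' & a' & _ & E & _)|(d' & e' & -> & E & _ & B)].
    + destruct (atom_not_cset (eq_sym E)).
    + apply cset_inj in E as ->.
      destruct (B x' Hd) as (u & Hu & Huv). rewrite (Act_inj Ht Hx Huv). apply elt_cset; auto.
Qed.

End Action.
(** * The hereditarily symmetric universe *)

Section Symmetric.
Context {M : structure Empty_set} {HM : ZFModel M}.
Implicit Types (x y z u v w d g i j k l m a b c : M) (t s : M -> M -> M -> M -> Prop).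

(* The identity on the pieces with index in [m], except that in piece [i] it exchanges [a] and [b]. *)
Definition transp m i a b : M -> M -> M -> M -> Prop := fun j c j' c' =>
  elt j m /\ mem c Nats /\ mem c' Nats /\ j' = j /\
  ((j = i /\ c = a /\ c' = b) \/ (j = i /\ c = b /\ c' = a) \/
   (c' = c /\ (j <> i \/ (c <> a /\ c <> b)))).

(** Exchanging [zero] with itself is trivial, so this is the identity restricted to the pieces below
    [m]: a set is fixed only if it involves no other piece. *)
Definition keep m := transp m zero zero zero.

Definition swap k l : M -> M -> M -> M -> Prop := fun j c j' c' =>
  mem j Nats /\ mem j' Nats /\ mem c Nats /\ c' = c /\
  ((j = k /\ j' = l) \/ (j = l /\ j' = k) \/ (j' = j /\ j <> k /\ j <> l)).

(** A set is fixed by this restricted identity only if piece [k] does not occur in its transitive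
    closure. Unlike invariance under swaps, this passes to members, as the induction in
    [Act_keep_of_swap] needs. *)
Definition drop k : M -> M -> M -> M -> Prop := fun j c j' c' =>
  mem j Nats /\ mem c Nats /\ j <> k /\ j' = j /\ c' = c.

(** As the bound in [transp], it gives the transposition that is defined on all pieces and is
    therefore an automorphism. *)
Definition omega : M := cset Nats.

Lemma elt_omega j : elt j omega <-> mem j Nats.
Proof. apply elt_cset. Qed.

Ltac crush := intros; unfold keep, transp, swap, drop in *; intuition (subst; try congruence; auto).

Lemma transp_inj m i a b : partial_inj (transp m i a b).
Proof. constructor; [unfold transp; def| |]; crush. Qed.

Lemma keep_inj m : partial_inj (keep m).
Proof. apply transp_inj. Qed.

Lemma swap_inj k l : partial_inj (swap k l).
Proof. constructor; [unfold swap; def| |]; crush. Qed.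

Lemma drop_inj k : partial_inj (drop k).
Proof. constructor; [unfold drop; def| |]; crush. Qed.

Lemma keep_id m j c j' c' : keep m j c j' c' -> j = j' /\ c = c'.
Proof. crush. Qed.

Lemma keep_intro m j c : elt j m -> mem c Nats -> keep m j c j c.
Proof.
  intros; unfold keep, transp.
  destruct (classic (j = zero)), (classic (c = zero)); crush.
Qed.

Definition comp t s : M -> M -> M -> M -> Prop := fun j c j' c' =>
  exists j1 c1, t j c j1 c1 /\ s j1 c1 j' c'.

Lemma comp_inj t s : partial_inj t -> partial_inj s -> partial_inj (comp t s).
Proof.
  intros Ht Hs. pose proof (t_def Ht); pose proof (t_def Hs). constructor.
  - unfold comp; def.
  - intros i b i1 b1 i2 b2 (j & c & H1 & H2) (j' & c' & H3 & H4).
    destruct (t_fun Ht H1 H3) as [<- <-]. apply (t_fun Hs H2 H4).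
  - intros i b i1 b1 i2 b2 (j & c & H1 & H2) (j' & c' & H3 & H4).
    destruct (t_inj Hs H2 H4) as [<- <-]. apply (t_inj Ht H1 H3).
Qed.

(** [transp m i a b] is undefined on pieces outside [m], so being acted upon already excludes them.
    One condition thus covers both halves of the notion of support. *)
Definition Supp m x : Prop := forall i a b, mem i Nats -> mem a Nats -> mem b Nats ->
  ~ elt a m -> ~ elt b m -> Act (transp m i a b) x x.

Definition Sym x : Prop := exists m, mem m Nats /\ Supp m x.

(** Labels are pure sets of the new model itself, so members of its cardinals and pairs formed in it
    can serve as labels. *)
Definition is_atom x : Prop := exists i b a, x = atom i b a /\ mem i Nats /\ mem b Nats /\ Pure a.

Definition HS x : Prop := Bnf decode (fun x y => x = y /\ is_atom x) Sym x x.

Lemma Supp_def : Def (fun e => Supp (e 0) (e 1)).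
Proof.
  (* [Act_def] treats a fixed map, whereas the parameters of this transposition are variables. *)
  unfold Supp, Act, Bnf, bnf, atom_map, transp, decode. def.
Qed.

Lemma Sym_def : Def (fun e => Sym (e 0)).
Proof. pose proof Supp_def. unfold Sym; def. Qed.

Lemma is_atom_def : Def (fun e => is_atom (e 0)).
Proof. unfold is_atom; def. Qed.

Lemma coding_HS : coding decode (fun x y => x = y /\ is_atom x) Sym.
Proof.
  pose proof Sym_def; pose proof is_atom_def.
  apply coding_decode; [def|def| | | |].
  - intros x y y' [<- _] [<- _]; auto.
  - intros x x' y [-> _] [-> _]; auto.
  - intros x y d [_ (i & b & a & -> & _)]; apply atom_not_cset.
  - intros x y d [<- (i & b & a & -> & _)]; apply atom_not_cset.
Qed.

Lemma HS_def : Def (fun e => HS (e 0)).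
Proof. exact (def_sub2 (Bnf_def coding_HS) (def_var 0) (def_var 0)). Qed.

Lemma HS_step x : HS x <-> is_atom x \/
  exists d, x = cset d /\ Sym x /\ forall u, mem u d -> HS u.
Proof.
  unfold HS. rewrite (Bnf_diag coding_HS) by tauto.
  split; (intros [H|(d & -> & H & H')]; [left; tauto|eauto]).
Qed.

Lemma HS_ind (Q : M -> Prop) : Def (fun e => Q (e 0)) ->
  (forall x, is_atom x -> Q x) ->
  (forall d, Sym (cset d) -> (forall u, mem u d -> HS u) ->
    (forall u, mem u d -> Q u) -> Q (cset d)) ->
  forall x, HS x -> Q x.
Proof.
  intros HQ H1 H2. apply (Bnf_diag_ind coding_HS); auto; [tauto|].
  intros x [_ Hx]; auto.
Qed.

Lemma HS_atom i b a : mem i Nats -> mem b Nats -> Pure a -> HS (atom i b a).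
Proof. intros; apply HS_step; left; exists i, b, a; auto. Qed.

Lemma HS_elt x u : HS x -> elt u x -> HS u.
Proof.
  intros H (d & -> & Hu). apply HS_step in H as [(i & b & a & E & _)|(d' & E & _ & H)].
  - destruct (atom_not_cset (eq_sym E)).
  - apply cset_inj in E as ->; auto.
Qed.

Lemma HS_code x : HS x -> ~ is_atom x -> exists d, x = cset d.
Proof. intros H H'; apply HS_step in H as [H|(d & -> & _)]; [tauto|eauto]. Qed.

Lemma cset_not_atom d : ~ is_atom (cset d).
Proof. intros (i & b & a & E & _). destruct (atom_not_cset (eq_sym E)). Qed.

Lemma Supp_mono m n x : nat_le m n -> Supp m x -> Supp n x.
Proof.
  intros Hmn H i a b Hi Ha Hb Ham Hbm.
  apply Act_mono with (transp m i a b); auto using transp_inj. crush.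
Qed.

Lemma Supp_atom m i b a : elt i m -> mem b Nats -> elt b m -> Supp m (atom i b a).
Proof.
  intros Hi Hb Hbm i' a' b' Hi' Ha' Hb' Hm1 Hm2. apply Act_atom; [apply transp_inj|].
  exists i, b; split; auto. unfold transp. repeat split; auto.
  right; right; split; auto. right; split; intros ->; auto.
Qed.

Lemma HS_Sym x : HS x -> Sym x.
Proof.
  intros H; apply HS_step in H as [(i & b & a & -> & Hi & Hb & _)|(d & _ & H & _)]; auto.
  destruct (nat_bound Hi Hb) as (m & Hm & H1 & H2 & _). exists m; split; auto.
  apply Supp_atom; auto.
Qed.

Lemma Supp_pure m x : Pure x -> Supp m x.
Proof. intros H i a b _ _ _ _ _. apply Act_pure; auto using transp_inj. Qed.

Lemma HS_pure x : Pure x -> HS x.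
Proof.
  pose proof HS_def. revert x; apply Pure_ind; [def|]. intros d HP IH. apply HS_step; right.
  exists d; repeat split; auto. exists zero; split; [apply nat_zero|].
  apply Supp_pure, Pure_cset; auto.
Qed.

Lemma Pure_nat (n : M) : mem n Nats -> Pure n.
Proof.
  revert n. apply (@nat_ind M HM Pure); [exact Pure_def| |].
  - apply Pure_cset; intros u Hu; destruct (in_emp Hu).
  - intros n Hn H. destruct (nat_code Hn) as [d ->]. unfold succ; rewrite union_cset.
    apply Pure_cset. intros u Hu; apply in_binunion in Hu as [Hu|Hu].
    + exact (proj1 (Pure_cset d) H u Hu).
    + apply in_upair in Hu as [->| ->]; auto.
Qed.

Lemma Pure_omega : Pure omega.
Proof. apply Pure_cset, Pure_nat. Qed.

Lemma Act_keep_eq m x y : Act (keep m) x y -> x = y.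
Proof. apply Act_id; [apply transp_inj|apply keep_id]. Qed.

Lemma Act_keep_elt m x u : Act (keep m) x x -> elt u x -> Act (keep m) u u.
Proof.
  intros H (d & -> & Hu). apply Act_cset in H as [F _]; [|apply transp_inj].
  destruct (F u Hu) as (v & _ & Huv). rewrite (Act_keep_eq Huv) at 2. exact Huv.
Qed.

Lemma Supp_keep m x : mem m Nats -> Supp m x -> Act (keep m) x x.
Proof.
  intros Hm H. apply Act_mono with (transp m zero m m); try apply transp_inj.
  - intros j c j' c' Ht. assert (j = j' /\ c = c') as [<- <-] by crush.
    apply keep_intro; apply Ht.
  - apply H; auto using nat_zero, nat_irrefl.
Qed.

Lemma Supp_swap m x k l : mem m Nats -> Supp m x -> mem k Nats -> mem l Nats ->
  ~ elt k m -> ~ elt l m -> Act (swap k l) x x.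
Proof.
  intros Hm H Hk Hl Hkm Hlm. apply Act_mono with (keep m);
    auto using keep_inj, transp_inj, swap_inj, Supp_keep.
  intros j c j' c' Ht. pose proof (keep_id Ht) as [<- <-]. destruct Ht as (Hj & Hc & _).
  assert (mem j Nats) by (apply (nat_down Hm Hj)).
  unfold swap. repeat split; auto. right; right. split; [auto|split; congruence].
Qed.

(** Invariance of truth holds for total maps only. On a set with support [m] the partial
    transposition may be replaced by the total one. *)
Lemma Supp_transp m x i a b : mem m Nats -> Supp m x -> mem i Nats -> mem a Nats -> mem b Nats ->
  ~ elt a m -> ~ elt b m -> Act (transp omega i a b) x x.
Proof.
  intros Hm H Hi Ha Hb Ham Hbm. apply Act_mono with (transp m i a b); try apply transp_inj.
  - intros j c j' c' (Hj & H'). split; [|exact H']. apply elt_omega. exact (nat_down Hm Hj).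
  - apply H; auto.
Qed.

(** A transposition is its own inverse, so mapping [d] into itself is enough for mapping it onto
    itself. *)
Lemma HS_intro m d : mem m Nats -> (forall u, mem u d -> HS u) ->
  (forall i a b, mem i Nats -> mem a Nats -> mem b Nats -> ~ elt a m -> ~ elt b m ->
    forall u, mem u d -> exists v, mem v d /\ Act (transp m i a b) u v) ->
  HS (cset d) /\ Supp m (cset d).
Proof.
  intros Hm HN H.
  enough (HS' : Supp m (cset d)).
  { split; auto. apply HS_step; right. exists d; repeat split; auto. exists m; auto. }
  intros i a b Hi Ha Hb Ham Hbm. apply Act_cset; [apply transp_inj|]. split; eauto.
  intros u Hu. destruct (H i a b Hi Ha Hb Ham Hbm u Hu) as (v & Hv & Huv).
  exists v; split; auto. revert Huv. apply Act_conv; auto using transp_inj. crush.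
Qed.

(** ** Automorphisms *)

(** All maps needed are involutions, hence [au_sym]. [au_norm] corresponds to normality of the
    filter in a permutation model: conjugation by [t] respects the admissible transpositions from
    some [m0] on, which keeps [Sym] and [HS] invariant. *)
Record automorphism t : Prop := {
  au_inj : partial_inj t;
  au_sym : forall j c j' c', t j c j' c' -> t j' c' j c;
  au_total : forall j c, mem j Nats -> mem c Nats ->
    exists j' c', mem j' Nats /\ mem c' Nats /\ t j c j' c';
  au_norm : exists m0, mem m0 Nats /\ forall m, mem m Nats -> nat_le m0 m ->
    forall i a b, mem i Nats -> mem a Nats -> mem b Nats -> ~ elt a m -> ~ elt b m ->
    exists i', mem i' Nats /\ forall j c j' c',
      comp t (comp (transp m i' a b) t) j c j' c' -> transp m i a b j c j' c' }.

Lemma transp_auto i a b : mem i Nats -> mem a Nats -> mem b Nats ->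
  automorphism (transp omega i a b).
Proof.
  intros Hi Ha Hb. constructor.
  - apply transp_inj.
  - intros j c j' c' H. crush.
  - intros j c Hj Hc. pose proof (proj2 (elt_omega j) Hj). unfold transp.
    destruct (classic (j = i)) as [->|]; [|exists j, c; tauto].
    destruct (classic (c = a)) as [->|]; [exists i, b; tauto|].
    destruct (classic (c = b)) as [->|]; [exists i, a; tauto|exists i, c; tauto].
  (* Once [a] and [b] are below [m], the two transpositions move disjoint values. They commute, and
     the piece stays the same. *)
  - destruct (nat_bound Ha Hb) as (m0 & Hm0 & Ha0 & Hb0 & _). exists m0; split; auto.
    intros m Hm Hle i' a' b' Hi' Ha' Hb' Ham Hbm. exists i'; split; auto.
    apply Hle in Ha0, Hb0.
    assert (N1 : a <> a') by congruence. assert (N2 : a <> b') by congruence.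
    assert (N3 : b <> a') by congruence. assert (N4 : b <> b') by congruence.
    clear Ham Hbm Ha0 Hb0 Hle.
    intros j c j' c' (j1 & c1 & (H1 & H2 & H3 & -> & H4) & j2 & c2 &
      (H5 & _ & H6 & -> & H7) & (_ & _ & H8 & -> & H9)).
    unfold transp. repeat split; auto.
    destruct H4 as [(-> & -> & ->)|[(-> & -> & ->)|(-> & H4)]];
    destruct H7 as [(? & ? & ?)|[(? & ? & ?)|(? & H7)]]; subst; try congruence;
    destruct H9 as [(? & ? & ?)|[(? & ? & ?)|(? & H9)]]; subst; try congruence; tauto.
Qed.

Lemma swap_auto k l : mem k Nats -> mem l Nats -> automorphism (swap k l).
Proof.
  intros Hk Hl. constructor.
  - apply swap_inj.
  - intros j c j' c' H. crush.
  - intros j c Hj Hc. unfold swap.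
    destruct (classic (j = k)); [exists l, c; tauto|].
    destruct (classic (j = l)); [exists k, c; tauto|]. exists j, c; tauto.
  - destruct (nat_bound Hk Hl) as (m0 & Hm0 & Hk0 & Hl0 & _). exists m0; split; auto.
    intros m Hm Hle i a b Hi Ha Hb Ham Hbm. apply Hle in Hk0, Hl0.
    (* Conjugation carries an exchange within a piece to one within the image of that piece under
       the swap. *)
    assert (Hi' : exists i', mem i' Nats /\
      ((i = k /\ i' = l) \/ (i = l /\ i' = k) \/ (i' = i /\ i <> k /\ i <> l))).
    { destruct (classic (i = k)); [exists l; tauto|].
      destruct (classic (i = l)); [exists k; tauto|]. exists i; tauto. }
    destruct Hi' as (i' & Hi' & Hsw). exists i'; split; auto. clear Ham Hbm.
    intros j c j' c' (j1 & c1 & (H1 & H2 & H3 & -> & H4) & j2 & c2 &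
      (H5 & _ & H6 & -> & H7) & (_ & H8 & _ & -> & H9)).
    assert (elt j m) by (destruct H4 as [(-> & ->)|[(-> & ->)|(-> & _ & _)]]; auto).
    assert (j' = j) as -> by
      (destruct H4 as [(-> & ->)|[(-> & ->)|(-> & ? & ?)]];
       destruct H9 as [(? & ?)|[(? & ?)|(? & ? & ?)]]; congruence).
    assert (E : j = i <-> j1 = i').
    { clear H7 H9.
      destruct H4 as [(-> & ->)|[(-> & ->)|(-> & ? & ?)]];
      destruct Hsw as [(-> & ->)|[(-> & ->)|(-> & ? & ?)]]; split; congruence. }
    unfold transp. repeat split; auto. tauto.
Qed.

Section Automorphism.
Context t (A : automorphism t).

Lemma Act_total x : HS x -> exists y, Act t x y.
Proof.
  pose proof (au_inj A) as Ht. pose proof (Act_def Ht). revert x. apply HS_ind; [def| |].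
  - intros x (i & b & a & -> & Hi & Hb & _).
    destruct (au_total A Hi Hb) as (i' & b' & _ & _ & H').
    exists (atom i' b' a). apply Act_atom; eauto.
  - intros d _ _ IH. destruct (@image_in M HM d (Act t)) as [e He]; auto.
    { intros u v v' _; apply Act_fun; auto. }
    exists (cset e). apply Act_cset; auto. split.
    + intros u Hu; destruct (IH u Hu) as [v Hv]. exists v; split; auto. apply He; eauto.
    + intros v Hv; apply He in Hv; auto.
Qed.

Lemma Act_sym x y : Act t x y -> Act t y x.
Proof. pose proof (au_inj A). apply Act_conv; auto. apply au_sym, A. Qed.

(** A transposition fixes [y] because its conjugate by [t] fixes [x]. *)
Lemma Act_Sym x y : Sym x -> Act t x y -> Sym y.
Proof.
  pose proof (au_inj A) as Ht. intros (m & Hm & HS') Hxy.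
  destruct (au_norm A) as (m0 & Hm0 & Hn).
  destruct (nat_bound Hm Hm0) as (n & Hnn & _ & _ & Hmn & Hm0n).
  exists n; split; auto. intros i a b Hi Ha Hb Ham Hbm.
  destruct (Hn n Hnn Hm0n i a b Hi Ha Hb Ham Hbm) as (i' & Hi' & Hc).
  apply Act_mono with (comp t (comp (transp n i' a b) t));
    auto using comp_inj, transp_inj.
  apply Act_comp with t (comp (transp n i' a b) t) x; auto using comp_inj, transp_inj, Act_sym.
  { intros; eexists _, _; eauto. }
  apply Act_comp with (transp n i' a b) t x; auto using comp_inj, transp_inj.
  { intros; eexists _, _; eauto. }
  apply (Supp_mono Hmn HS'); auto.
Qed.

Lemma Act_is_atom x y : is_atom x -> Act t x y -> is_atom y.
Proof.
  pose proof (au_inj A) as Ht.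
  intros (i & b & a & -> & Hi & Hb & Ha) H. apply Act_atom in H as (i' & b' & -> & H); auto.
  destruct (au_total A Hi Hb) as (i2 & b2 & Hi2 & Hb2 & H2).
  destruct (t_fun Ht H H2) as [-> ->]. exists i2, b2, a; auto.
Qed.

Lemma Act_HS x y : HS x -> Act t x y -> HS y.
Proof.
  pose proof (au_inj A) as Ht. pose proof (Act_def Ht). pose proof HS_def.
  intros Hx; revert x Hx y. apply (HS_ind (Q := fun x => forall y, Act t x y -> HS y)); [def| |].
  - intros x Hx y Hy. apply HS_step; left. eapply Act_is_atom; eauto.
  - intros d HS' _ IH y Hy. destruct (Act_cset_l Ht Hy) as [e ->].
    apply HS_step; right; exists e; repeat split; [eapply Act_Sym; eauto|].
    intros v Hv. apply Act_cset in Hy as [_ B]; auto. destruct (B v Hv) as (u & Hu & Huv); eauto.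
Qed.

End Automorphism.

(** ** Satisfaction in the symmetric universe *)

(** Assignments go into [M] instead of the subtype, so that satisfaction of each formula is
    definable in [M] and falls under its schemes. *)
Fixpoint satHS (e : nat -> M) (f : form ur_symbol) : Prop :=
  match f with
  | Bot => False
  | Mem x y => elt (e x) (e y)
  | Eq x y => e x = e y
  | Pred p x => is_atom (e x)
  | And f g => satHS e f /\ satHS e g
  | Or f g => satHS e f \/ satHS e g
  | Imp f g => satHS e f -> satHS e g
  | All f => forall a : M, HS a -> satHS (a .: e) f
  | Ex f => exists a : M, HS a /\ satHS (a .: e) f
  end.

Lemma HS_inhabited : inhabited {x : M | HS x}.
Proof. constructor; exists zero; apply HS_pure, Pure_nat, nat_zero. Qed.

Definition sym_model : structure ur_symbol :=
  {| dom := {x : M | HS x}; dom_inhabited := HS_inhabited;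
     mem := fun p q => elt (proj1_sig p) (proj1_sig q);
     pred := fun _ p => is_atom (proj1_sig p) |}.

Lemma satHS_ext f (e e' : nat -> M) : (forall n, e n = e' n) -> satHS e f <-> satHS e' f.
Proof.
  intros H. assert (e = e') as -> by (extensionality n; auto). tauto.
Qed.

Lemma sat_satHS f : forall e : nat -> sym_model,
  sat e f <-> satHS (fun n => proj1_sig (e n)) f.
Proof.
  assert (E : forall (x : sym_model) (e : nat -> sym_model),
    (fun n => proj1_sig ((x .: e) n)) = proj1_sig x .: fun n => proj1_sig (e n)).
  { intros; extensionality n; destruct n; auto. }
  induction f; intros e; simpl; rewrite ?IHf1, ?IHf2; try tauto.
  - split; [intros ->; auto|]. apply eq_sig_hprop. intros; apply proof_irrelevance.
  - split; intros H a; [intros Ha|]; specialize (IHf (exist _ a Ha .: e)) || specialize (IHf (a .: e));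
      rewrite E in IHf; simpl in IHf; apply IHf; auto. apply H, (proj2_sig a).
  - split.
    + intros [a H]. apply IHf in H. rewrite E in H. exists (proj1_sig a); split; auto.
      apply (proj2_sig a).
    + intros (a & Ha & H). exists (exist _ a Ha). apply IHf. rewrite E. exact H.
Qed.

Lemma holds_satHS f : holds_in sym_model f <-> forall e, (forall n, HS (e n)) -> satHS e f.
Proof.
  split.
  - intros H e He. exact (proj1 (sat_satHS f (fun n => exist _ (e n) (He n))) (H _)).
  - intros H e. apply sat_satHS, H. intros n; apply (proj2_sig (e n)).
Qed.

Lemma holds_closure_satHS f :
  holds_in sym_model (closure f) <-> forall e, (forall n, HS (e n)) -> satHS e f.
Proof. rewrite holds_closure. apply (holds_satHS f). Qed.

Lemma satHS_rename f : forall (e : nat -> M) r,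
  satHS e (rename r f) <-> satHS (fun n => e (r n)) f.
Proof.
  assert (E : forall a (e : nat -> M) r,
    (fun n => (a .: e) ((0 .: fun n => S (r n)) n)) = a .: fun n => e (r n)).
  { intros; extensionality n; destruct n; auto. }
  induction f; intros e r; simpl; rewrite ?IHf1, ?IHf2; try tauto.
  - split; intros H a Ha; specialize (H a Ha); rewrite IHf, E in *; auto.
  - split; intros (a & Ha & H); exists a; rewrite IHf, E in *; auto.
Qed.

Lemma satHS_def f : Def (fun e => satHS e f).
Proof.
  pose proof HS_def; pose proof is_atom_def.
  assert (E : forall (e : nat -> M), (e 0 .: fun n => e (S n)) = e).
  { intros; extensionality n; destruct n; auto. }
  induction f; simpl; try (def; fail).
  - apply def_and; auto.
  - apply def_or; auto.
  - apply def_imp; auto.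
  - apply def_all. apply def_imp; [def|].
    revert IHf; apply def_ext; intros e; rewrite E; tauto.
  - apply def_ex. apply def_and; [def|].
    revert IHf; apply def_ext; intros e; rewrite E; tauto.
Qed.

Lemma satHS_params f (e : nat -> M) : Def (fun e' => satHS (e' 0 .: e) f).
Proof.
  generalize (def_subst (fun n => match n with 0 => inl 0 | S k => inr (e k) end) (satHS_def f)).
  apply def_ext. intros e'. apply satHS_ext. intros [|n]; auto.
Qed.

Lemma satHS_auto t f : automorphism t -> forall e e',
  (forall n, n < fv_bound f -> HS (e n) /\ Act t (e n) (e' n)) -> satHS e f <-> satHS e' f.
Proof.
  intros A. pose proof (au_inj A) as Ht.
  induction f; intros e e' H; simpl in *.
  - tauto.
  - apply Act_elt with t; auto; apply H; lia.
  - destruct (H x) as [_ Hx]; [lia|]. destruct (H y) as [_ Hy]; [lia|]. split; intros E.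
    + rewrite E in Hx. eapply Act_fun; eauto.
    + rewrite E in Hx. eapply Act_inj; eauto.
  - destruct (H x) as [_ Hx]; [lia|]. split; intros Ha; eapply Act_is_atom; eauto.
    apply Act_sym; auto.
  - rewrite (IHf1 e e'), (IHf2 e e'); [tauto| |]; intros; apply H; lia.
  - rewrite (IHf1 e e'), (IHf2 e e'); [tauto| |]; intros; apply H; lia.
  - rewrite (IHf1 e e'), (IHf2 e e'); [tauto| |]; intros; apply H; lia.
  - assert (E : forall a a', HS a -> Act t a a' -> satHS (a .: e) f <-> satHS (a' .: e') f).
    { intros a a' Ha Haa. apply IHf. intros [|n] Hn; simpl; auto. apply H; lia. }
    split; intros H' a Ha; destruct (Act_total A Ha) as [a' Haa].
    + apply (E a' a); [eapply Act_HS; eauto|apply Act_sym; auto|]. apply H'.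
      eapply Act_HS; eauto.
    + apply (E a a'); auto. apply H'. eapply Act_HS; eauto.
  - assert (E : forall a a', HS a -> Act t a a' -> satHS (a .: e) f <-> satHS (a' .: e') f).
    { intros a a' Ha Haa. apply IHf. intros [|n] Hn; simpl; auto. apply H; lia. }
    split; intros (a & Ha & H'); destruct (Act_total A Ha) as [a' Haa];
      exists a'; (split; [eapply Act_HS; eauto|]).
    + apply (E a a'); auto.
    + apply (E a' a); auto; [eapply Act_HS; eauto|apply Act_sym; auto].
Qed.

(** A formula has finitely many variables in the sense of the metatheory, so an ordinary induction
    yields a common support. *)
Lemma Supp_env (e : nat -> M) n : (forall q, HS (e q)) ->
  exists m, mem m Nats /\ forall q, q < n -> Supp m (e q).
Proof.
  intros He. induction n as [|n (m & Hm & H)].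
  - exists zero; split; [apply nat_zero|lia].
  - destruct (HS_Sym (He n)) as (m' & Hm' & H').
    destruct (nat_bound Hm Hm') as (k & Hk & _ & _ & H1 & H2). exists k; split; auto.
    intros i Hi. destruct (Nat.eq_dec i n) as [->|Hne]; [eapply Supp_mono; eauto|].
    apply (Supp_mono H1), H; lia.
Qed.

(** Transpositions beyond [m] fix the parameters and hence permute the class. Survival under
    [keep m] turns the total transposition into the partial one that [Supp] asks for. For each axiom
    it remains to find the bound [w] and to check [keep m]. *)
Lemma comprehension f (e : nat -> M) m w : mem m Nats -> (forall n, HS (e n)) ->
  (forall n, S n < fv_bound f -> Supp m (e n)) ->
  (forall y, HS y -> satHS (y .: e) f -> mem y w /\ Act (keep m) y y) ->
  exists d, HS (cset d) /\ forall y, mem y d <-> HS y /\ satHS (y .: e) f.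
Proof.
  intros Hm He HeS Hw. pose proof HS_def; pose proof (satHS_params f e).
  destruct (@separation_in M HM w (fun y => HS y /\ satHS (y .: e) f)) as [d Hd].
  { apply def_and; [def|auto]. }
  exists d. split.
  - apply HS_intro with m; auto; [intros u Hu; apply Hd in Hu; tauto|].
    intros i a b Hi Ha Hb Ham Hbm u Hu. apply Hd in Hu as (Huw & HuN & HuS).
    assert (A := transp_auto Hi Ha Hb).
    destruct (Act_total A HuN) as [v Huv]. assert (HvN := Act_HS A HuN Huv).
    assert (HvS : satHS (v .: e) f).
    { refine (proj1 (satHS_auto (f := f) A (e := u .: e) (e' := v .: e) _) HuS).
      intros [|n] Hn; simpl; auto. split; auto. apply Supp_transp with m; auto. }
    exists v; split.
    + apply Hd. split; auto. apply Hw; auto.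
    + apply Act_comp with (keep m) (transp omega i a b) u; try apply transp_inj; auto.
      * intros j c j' c' j2 c2 H1 H2. destruct (keep_id H1) as [<- <-].
        split; [apply H1|apply H2].
      * apply Hw; auto.
  - intros y; rewrite Hd. split; [tauto|]. intros [H1 H2]; repeat split; auto. apply Hw; auto.
Qed.

(* If [y] did involve a piece [k] outside [m], exchanging [k] with a piece that [y] does not
   involve would move [y]. *)
Lemma Act_keep_of_swap y m : HS y -> mem m Nats ->
  (forall k l, mem k Nats -> mem l Nats -> ~ elt k m -> ~ elt l m -> Act (swap k l) y y) ->
  Act (keep m) y y.
Proof.
  intros Hy Hm Hsw.
  assert (Hd : forall k, mem k Nats -> ~ elt k m -> Act (drop k) y y).
  { intros k Hk Hkm. destruct (HS_Sym Hy) as (m' & Hm' & HS').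
    destruct (nat_bound Hm Hm') as (l & Hl & _ & _ & H1 & H2).
    assert (Hlm : ~ elt l m) by (intros H; apply (nat_irrefl Hl); auto).
    assert (Hlm' : ~ elt l m') by (intros H; apply (nat_irrefl Hl); auto).
    assert (Hk' := Supp_keep Hm' HS').
    apply Act_comp with (keep m') (comp (swap k l) (keep m')) y;
      auto using comp_inj, keep_inj, transp_inj, swap_inj, drop_inj.
    - intros j c j' c' j2 c2 H3 (j3 & c3 & H4 & H5).
      destruct (keep_id H3) as [<- <-]. destruct (keep_id H5) as [<- <-].
      destruct H4 as (Hj & Hj3 & Hc & -> & H4). destruct H3 as [H3 _]. destruct H5 as [H5 _].
      destruct H4 as [(-> & ->)|[(-> & ->)|(-> & H6 & H7)]]; try tauto.
      unfold drop; auto.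
    - apply Act_comp with (swap k l) (keep m') y; auto using comp_inj, keep_inj, swap_inj.
      intros; eexists _, _; eauto. }
  clear Hsw. revert y Hy Hd.
  apply (HS_ind (Q := fun y => (forall k, mem k Nats -> ~ elt k m -> Act (drop k) y y) ->
    Act (keep m) y y)).
  - unfold keep, Act, Bnf, bnf, atom_map, decode, drop, transp. def.
  - intros x (i & b & a & -> & Hi & Hb & _) H. apply Act_atom; [apply transp_inj|].
    exists i, b; split; auto. apply keep_intro; auto. apply NNPP; intros Him.
    specialize (H i Hi Him). apply Act_atom in H as (i' & b' & _ & H); [|apply drop_inj].
    apply H; auto.
  - intros d _ _ IH H. apply Act_cset; [apply transp_inj|].
    assert (Hu : forall u, mem u d -> Act (keep m) u u); [|split; eauto].
    intros u Hu. apply IH; auto. intros k Hk Hkm. specialize (H k Hk Hkm).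
    apply Act_cset in H as [F _]; [|apply drop_inj]. destruct (F u Hu) as (v & _ & Huv).
    assert (u = v) as <-; auto. revert Huv. apply Act_id; [apply drop_inj|].
    intros ? ? ? ? (_ & _ & _ & -> & ->); auto.
Qed.

End Symmetric.
(** * The axioms in the symmetric universe *)

Section SymAxioms.
Context {M : structure Empty_set} {HM : ZFModel M}.
Implicit Types (x y z u v w d m : M) (f : form ur_symbol).

Lemma elt_union u x : elt u x -> mem u (union_of x).
Proof. intros (d & -> & H); rewrite union_cset; auto. Qed.

Lemma mem_code d : mem d (cset d).
Proof. apply in_upair; auto. Qed.

Lemma elt_eq x y : ~ is_atom x -> ~ is_atom y -> HS x -> HS y ->
  (forall z, HS z -> elt z x <-> elt z y) -> x = y.
Proof.
  intros Hx Hy HxN HyN H.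
  destruct (HS_code HxN Hx) as [d ->], (HS_code HyN Hy) as [e ->].
  f_equal. apply set_ext; intros z. rewrite <- !elt_cset. split; intros Hz.
  - apply H; auto. apply (HS_elt HxN Hz).
  - apply H; auto. apply (HS_elt HyN Hz).
Qed.

Lemma sym_urelements_empty : holds_in sym_model urelements_empty.
Proof.
  apply holds_satHS. intros e _ x _ Hx (y & _ & d & E & _). simpl in *. subst x.
  apply (cset_not_atom Hx).
Qed.

Lemma sym_extensionality : holds_in sym_model extensionality.
Proof.
  apply holds_satHS. intros e _ x Hx y Hy (H1 & H2 & H). apply elt_eq; auto.
Qed.

Lemma sym_foundation : holds_in sym_model foundation.
Proof.
  apply holds_satHS. intros e _ x Hx (y & Hy & Hyx). simpl in *.
  destruct Hyx as (d & -> & Hyd).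
  destruct (@decode_wf M HM d) as (z & Hz & Hmin); [eauto|].
  assert (Hzd : elt z (cset d)) by (apply elt_cset; auto).
  exists z. split; [apply (HS_elt Hx Hzd)|]. split; [auto|].
  intros u _ (d' & -> & Hu) Hud. apply elt_cset in Hud. apply (Hmin d' u); auto.
  reflexivity.
Qed.

(** The exchanges move no member, so a common support of the members supports the set. *)
Lemma HS_of_Supp m d : mem m Nats -> (forall u, mem u d -> HS u /\ Supp m u) ->
  HS (cset d) /\ Supp m (cset d).
Proof.
  intros Hm H. apply HS_intro; auto; [intros u Hu; apply H; auto|].
  intros i a b Hi Ha Hb Ham Hbm u Hu. exists u; split; auto. apply (H u Hu); auto.
Qed.

Definition upr x y : M := cset (upair x y).
Definition opr x y : M := upr (upr x x) (upr x y).

Lemma HS_upr x y : HS x -> HS y -> HS (upr x y).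
Proof.
  intros Hx Hy. destruct (HS_Sym Hx) as (m & Hm & Hmx), (HS_Sym Hy) as (n & Hn & Hny).
  destruct (nat_bound Hm Hn) as (k & Hk & _ & _ & H1 & H2).
  apply (@HS_of_Supp k); auto.
  intros u Hu; apply in_upair in Hu as [->| ->]; eauto using Supp_mono.
Qed.

Lemma HS_opr x y : HS x -> HS y -> HS (opr x y).
Proof. intros; apply HS_upr; apply HS_upr; auto. Qed.

Lemma Act_upr t x y x' y' : partial_inj t -> Act t x x' -> Act t y y' ->
  Act t (upr x y) (upr x' y').
Proof.
  intros Ht Hx Hy. apply Act_cset; auto. split; intros u Hu; apply in_upair in Hu as [->| ->].
  - exists x'; rewrite in_upair; auto.
  - exists y'; rewrite in_upair; auto.
  - exists x; rewrite in_upair; auto.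
  - exists y; rewrite in_upair; auto.
Qed.

Lemma Act_opr t x y x' y' : partial_inj t -> Act t x x' -> Act t y y' ->
  Act t (opr x y) (opr x' y').
Proof. intros; apply Act_upr; auto; apply Act_upr; auto. Qed.

Lemma Supp_opr m x y : Supp m x -> Supp m y -> Supp m (opr x y).
Proof.
  intros Hx Hy i a b Hi Ha Hb Ham Hbm. apply Act_opr; auto using transp_inj.
Qed.

Lemma Pure_opr x y : Pure x -> Pure y -> Pure (opr x y).
Proof.
  intros; apply Pure_cset; intros u Hu.
  apply in_upair in Hu as [->| ->]; apply Pure_cset; intros v Hv;
    apply in_upair in Hv as [->| ->]; auto.
Qed.

Lemma upr_eq x y x' y' : upr x y = upr x' y' -> upair x y = upair x' y'.
Proof. apply cset_inj. Qed.

Lemma opr_inj x y x' y' : opr x y = opr x' y' -> x = x' /\ y = y'.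
Proof.
  unfold opr; intros H. apply upr_eq in H.
  assert (E : x = x').
  { assert (Hx : mem (upr x x) (upair (upr x' x') (upr x' y')))
      by (rewrite <- H, in_upair; auto).
    apply in_upair in Hx as [Hx|Hx]; apply upr_eq, sing_inj in Hx; tauto. }
  subst x'; split; auto. apply upair_cancel, upr_eq, upair_cancel in H. exact H.
Qed.

Lemma elt_upr z x y : elt z (upr x y) <-> z = x \/ z = y.
Proof. unfold upr; rewrite elt_cset, in_upair; tauto. Qed.

Lemma sym_pairing : holds_in sym_model pairing.
Proof.
  apply holds_satHS. intros e _ x Hx y Hy. exists (upr x y).
  split; [apply HS_upr; auto|]. intros z Hz. simpl. apply elt_upr.
Qed.

Lemma sym_union : holds_in sym_model union.
Proof.
  apply holds_satHS. intros e He x Hx. destruct (HS_Sym Hx) as (m & Hm & HmS).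
  (* Each coded membership is two memberships of [M], so [y] lies four steps below [x], within three
     unions. *)
  destruct (@comprehension M HM (Ex (0 ∈ 2 /\ 1 ∈ 0))%fo (x .: e) m
    (union_of (union_of (union_of x)))) as (d & Hd & Hdy); auto.
  - intros [|n]; simpl; auto.
  - simpl. intros [|n] Hn; simpl; auto; lia.
  - simpl. intros y Hy (z & Hz & Hzx & Hyz). split.
    + apply elt_union in Hzx. destruct Hyz as (d & -> & Hyd).
      apply in_union; exists d; split; auto. apply in_union; exists (cset d); split; auto.
      apply mem_code.
    + apply Supp_keep in HmS; auto. eauto using Act_keep_elt.
  - exists (cset d); split; auto. intros y Hy. simpl. rewrite elt_cset, Hdy. simpl. tauto.
Qed.

Lemma sym_powerset : holds_in sym_model powerset.
Proof.
  apply holds_satHS. intros e He x Hx. destruct (HS_Sym Hx) as (m & Hm & HmS).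
  (* A coded subset is a singleton of a subset of [union_of x], hence the two power sets. *)
  destruct (@comprehension M HM (IsSet 0 /\ subset 0 1)%fo (x .: e) m
    (power (power (union_of x)))) as (d & Hd & Hdy); auto.
  - intros [|n]; simpl; auto.
  - simpl. intros [|n] Hn; simpl; auto; lia.
  - simpl. intros y Hy (Hys & Hsub). destruct (HS_code Hy Hys) as [d ->].
    assert (Hsub' : forall u, mem u d -> elt u x).
    { intros u Hu. assert (Hu' : elt u (cset d)) by (apply elt_cset; auto).
      apply Hsub; auto. apply (HS_elt Hy Hu'). }
    split.
    + apply in_power. intros d' Hd'. assert (d' = d) as -> by (apply in_upair in Hd'; tauto).
      apply in_power. intros u Hu. apply elt_union; auto.
    + apply Supp_keep in HmS; auto. apply Act_cset; [apply transp_inj|].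
      split; intros u Hu; exists u; eauto using Act_keep_elt.
  - exists (cset d); split; auto. intros y Hy. simpl. rewrite elt_cset, Hdy. simpl. tauto.
Qed.

Lemma sym_infinity : holds_in sym_model infinity.
Proof.
  apply holds_satHS. intros e He. exists omega; split; [apply HS_pure, Pure_omega|].
  simpl. split.
  - exists zero. split; [apply HS_pure, Pure_nat, nat_zero|].
    split; [apply elt_omega, nat_zero|]. split; [apply cset_not_atom|].
    intros (y & _ & Hy). apply (elt_zero Hy).
  - intros x _ Hx. apply elt_omega in Hx. exists (succ x).
    split; [apply HS_pure, Pure_nat, nat_succ; auto|].
    split; [apply elt_omega, nat_succ; auto|]. intros z _. apply elt_succ; auto.
Qed.

Lemma sym_separation f : holds_in sym_model (separation f).
Proof.
  apply holds_closure_satHS. intros e He x Hx.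
  assert (He' : forall n, HS ((x .: e) n)) by (intros [|n]; simpl; auto).
  set (g := (0 ∈ 1 /\ rename (0 .: Nat.add 2) f)%fo).
  destruct (Supp_env (fv_bound g) He') as (m & Hm & HmS).
  destruct (@comprehension M HM g (x .: e) m (union_of x)) as (d & Hd & Hdy); auto.
  - intros n Hn; apply HmS; lia.
  - unfold g at 1. cbn [satHS]. intros y Hy [Hyx _]. split.
    + apply elt_union, Hyx.
    + specialize (HmS 0 ltac:(unfold g; cbn [fv_bound]; lia)). apply Supp_keep in HmS; auto.
      eapply Act_keep_elt; [exact HmS|exact Hyx].
  - exists (cset d); split; auto. intros y Hy. cbn [satHS]. simpl scons.
    rewrite elt_cset, Hdy. unfold g. cbn [satHS]. rewrite !satHS_rename. simpl scons.
    rewrite (satHS_ext f (e := fun n => (y .: cset d .: x .: e) ((0 .: Nat.add 3) n))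
      (e' := fun n => (y .: x .: e) ((0 .: Nat.add 2) n))); [tauto|].
    intros [|n]; reflexivity.
Qed.

Lemma sym_replacement f : holds_in sym_model (replacement f).
Proof.
  apply holds_closure_satHS. intros e He x Hx. cbn [satHS AllIn ExIn]. intros HF.
  assert (He' : forall n, HS ((x .: e) n)) by (intros [|n]; simpl; auto).
  set (F := fun u y => satHS (y .: u .: e) f).
  assert (HF' : forall u, elt u x -> exists y, HS y /\ F u y /\ forall y', HS y' -> F u y' -> y' = y).
  { intros u Hu. assert (HuN := HS_elt Hx Hu). destruct (HF u HuN Hu) as (y & Hy & Huy & Hun).
    rewrite satHS_rename in Huy. exists y; split; [auto|split].
    - revert Huy; apply satHS_ext; intros [|[|n]]; reflexivity.
    - intros y' Hy' Huy'. apply (Hun y' Hy'). rewrite satHS_rename.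
      revert Huy'; apply satHS_ext; intros [|[|n]]; reflexivity. }
  clear HF. rename HF' into HF.
  set (g := Ex (0 ∈ 2 /\ rename (1 .: 0 .: Nat.add 3) f)%fo).
  assert (Hg : forall y, HS y -> satHS (y .: x .: e) g <-> exists u, elt u x /\ F u y).
  { intros y Hy. unfold g; cbn [satHS]. split.
    - intros (u & Hu & Hux & Huy). exists u; split; [exact Hux|].
      rewrite satHS_rename in Huy. revert Huy; apply satHS_ext; intros [|[|n]]; reflexivity.
    - intros (u & Hux & Huy). exists u; split; [apply (HS_elt Hx Hux)|]. split; [exact Hux|].
      rewrite satHS_rename. revert Huy; apply satHS_ext; intros [|[|n]]; reflexivity. }
  destruct (Supp_env (S (fv_bound f + fv_bound g)) He') as (m & Hm & HmS).
  assert (Hmx : Supp m x) by (apply (HmS 0); lia).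
  pose proof HS_def.
  destruct (@image_in M HM (union_of x) (fun u y => elt u x /\ HS y /\ F u y)) as [w Hw].
  { apply def_and; [def|apply def_and; [def|]]. unfold F.
    generalize (def_subst (fun n => match n with 0 => inl 1 | 1 => inl 0 | S (S k) => inr (e k) end)
      (satHS_def f)).
    apply def_ext. intros e'. apply satHS_ext. intros [|[|n]]; reflexivity. }
  { intros u y y' _ (Hu & Hy & Huy) (_ & Hy' & Huy').
    destruct (HF u Hu) as (y0 & _ & _ & Hun). rewrite (Hun y), (Hun y'); auto. }
  destruct (@comprehension M HM g (x .: e) m w) as (d & Hd & Hdy); auto.
  - intros n Hn; apply HmS; lia.
  - intros y Hy Hyg. apply Hg in Hyg as (u & Hu & Huy); auto. split.
    + apply Hw. exists u; split; [apply elt_union; auto|auto].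
    (* The swap fixes [u] and the parameters, so the image [y'] of [y] is again a value at [u], and
       uniqueness gives [y' = y]. Collection offers no such uniqueness. *)
    + apply Act_keep_of_swap; auto. intros k l Hk Hl Hkm Hlm.
      assert (A := swap_auto Hk Hl).
      destruct (Act_total A Hy) as [y' Hyy]. assert (Hy' := Act_HS A Hy Hyy).
      assert (Hku : Act (keep m) u u) by eauto using Act_keep_elt, Supp_keep.
      assert (Hsu : Act (swap k l) u u).
      { apply Act_mono with (keep m); auto using keep_inj, swap_inj.
        intros j c j' c' Ht. pose proof (keep_id Ht) as [<- <-]. destruct Ht as (Hj & Hc & _).
        assert (mem j Nats) by (apply (nat_down Hm Hj)).
        unfold swap. repeat split; auto. right; right. split; [auto|split; congruence]. }
      destruct (HF u Hu) as (y0 & _ & _ & Hun).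
      rewrite (Hun y Hy Huy) in Hyy |- *.
      enough (E : y' = y0) by (rewrite E in Hyy; exact Hyy).
      apply Hun; auto. rewrite <- (Hun y Hy Huy) in Hyy. unfold F in *.
      refine (proj1 (satHS_auto (f := f) A (e := y .: u .: e) (e' := y' .: u .: e) _) Huy).
      intros [|[|n]] Hn; simpl; auto.
      * split; auto. apply (HS_elt Hx Hu).
      * split; auto. apply Supp_swap with m; auto. apply (HmS (S n)); lia.
  - exists (cset d); split; auto. intros u HuN Hu. simpl scons in Hu.
    destruct (HF u Hu) as (y & Hy & Huy & _). exists y; split; auto.
    split; [simpl scons; apply elt_cset, Hdy; split; auto; apply Hg; eauto|].
    rewrite satHS_rename. revert Huy; apply satHS_ext; intros [|[|n]]; reflexivity.
Qed.

Lemma sym_ZFUR : models sym_model ZFUR.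
Proof.
  intros f [f' [| | | | | | |f'']|f'].
  - apply sym_urelements_empty.
  - apply sym_extensionality.
  - apply sym_foundation.
  - apply sym_pairing.
  - apply sym_union.
  - apply sym_powerset.
  - apply sym_infinity.
  - apply sym_separation.
  - apply sym_replacement.
Qed.

End SymAxioms.
(** * Plenitude and Duplication *)

Section Equinumerosity.
Context {M : structure Empty_set} {HM : ZFModel M}.
Implicit Types (x y z u v w d m : M) (e : nat -> M).

Lemma def_upr (a b : (nat -> M) -> M) :
  DefTerm a -> DefTerm b -> DefTerm (fun e => upr (a e) (b e)).
Proof. intros; apply def_cset, def_upair; auto. Qed.

Lemma def_opr (a b : (nat -> M) -> M) :
  DefTerm a -> DefTerm b -> DefTerm (fun e => opr (a e) (b e)).
Proof. intros; apply def_upr; apply def_upr; auto. Qed.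

Lemma elt_not_atom x u : elt u x -> ~ is_atom x.
Proof. intros (d & -> & _); apply cset_not_atom. Qed.

(** The formula does not say that [z] is a set, but having a member rules out a urelement. *)
Lemma upr_spec z x y : HS z -> HS x -> HS y ->
  (forall u, HS u -> elt u z <-> u = x \/ u = y) <-> z = upr x y.
Proof.
  intros Hz Hx Hy. split.
  - intros H. apply elt_eq; auto using HS_upr.
    + apply elt_not_atom with x. apply H; auto.
    + apply cset_not_atom.
    + intros u Hu. rewrite H by auto. rewrite elt_upr; tauto.
  - intros -> u Hu. apply elt_upr.
Qed.

Lemma sat_is_upair e (p x y : nat) : (forall n, HS (e n)) ->
  satHS e (is_upair p x y) <-> e p = upr (e x) (e y).
Proof. intros He. rewrite <- upr_spec by auto. simpl; tauto. Qed.

Lemma HS_scons x e : HS x -> (forall n, HS (e n)) -> forall n, HS ((x .: e) n).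
Proof. intros Hx He [|n]; simpl; auto. Qed.

Lemma sat_is_opair e (p x y : nat) : (forall n, HS (e n)) ->
  satHS e (is_opair p x y) <-> e p = opr (e x) (e y).
Proof.
  intros He. unfold opr. rewrite <- upr_spec by auto using HS_upr.
  unfold is_opair; cbn [satHS].
  split; intros H u Hu; specialize (H u Hu);
    rewrite !sat_is_upair in * by auto using HS_scons; exact H.
Qed.

Lemma sat_opair_in e (x y g : nat) : (forall n, HS (e n)) ->
  satHS e (opair_in x y g) <-> elt (opr (e x) (e y)) (e g).
Proof.
  intros He. unfold opair_in, ExIn; cbn [satHS]. split.
  - intros (p & Hp & Hpg & H). rewrite sat_is_opair in H by auto using HS_scons.
    simpl in H, Hpg. subst p; auto.
  - intros H. exists (opr (e x) (e y)).
    assert (HS (opr (e x) (e y))) by auto using HS_opr.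
    split; [auto|split; [exact H|]]. apply sat_is_opair; auto using HS_scons.
Qed.

End Equinumerosity.

Ltac def_user ::= lazymatch goal with
  | |- DefTerm (fun e => pair _ _) => apply def_pair
  | |- DefTerm (fun e => succ _) => apply def_succ
  | |- DefTerm (fun e => opr _ _) => apply def_opr
  | |- DefTerm (fun e => cset _) => apply def_cset
  | |- DefTerm (fun e => atom _ _ _) => apply def_atom
  | |- DefTerm (fun e => binunion _ _) => apply def_binunion
  | |- DefTerm (fun e => upair _ _) => apply def_upair
  | |- DefTerm (fun e => union_of _) => apply def_union
  | |- Def (fun e => elt _ _) => apply def_elt
  | |- Def (fun e => Pure _) => apply (def_sub1 Pure_def)
  end.

Section PlenitudeDuplication.
Context {M : structure Empty_set} {HM : ZFModel M}.
Implicit Types (x y z u v w d m : M).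

(* The graph of a relation that every small enough transposition preserves is symmetric. *)
Lemma sat_equinumerous (R : M -> M -> Prop) (e : nat -> M) a b A B m :
  (forall n, HS (e n)) -> e a = cset A -> e b = cset B -> mem m Nats ->
  Def (fun e => R (e 0) (e 1)) ->
  (forall x y y', R x y -> R x y' -> y = y') ->
  (forall x x' y, R x y -> R x' y -> x = x') ->
  (forall x, mem x A -> exists y, mem y B /\ R x y) ->
  (forall y, mem y B -> exists x, mem x A /\ R x y) ->
  (forall i c c' x y, mem i Nats -> mem c Nats -> mem c' Nats -> ~ elt c m -> ~ elt c' m ->
    mem x A -> mem y B -> R x y -> exists x' y', mem x' A /\ mem y' B /\ R x' y' /\
      Act (transp m i c c') x x' /\ Act (transp m i c c') y y') ->
  satHS e (equinumerous a b).
Proof.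
  intros He HA HB Hm HR Rf Ri Rt Rs Hsym.
  destruct (@image_in M HM A (fun x z => exists y, R x y /\ mem y B /\ z = opr x y)) as [g Hg];
    [def| |].
  { intros x z z' _ (y & H1 & _ & ->) (y' & H2 & _ & ->). rewrite (Rf x y y'); auto. }
  assert (Hopr : forall x y, mem (opr x y) g <-> mem x A /\ mem y B /\ R x y).
  { intros x y. rewrite Hg. split.
    - intros (x' & Hx & y' & H & Hy & E). apply opr_inj in E as [-> ->]; auto.
    - intros (Hx & Hy & H); eauto 6. }
  assert (HAN : forall x, mem x A -> HS x).
  { intros x Hx. apply HS_elt with (e a); auto. rewrite HA; apply elt_cset; auto. }
  assert (HBN : forall y, mem y B -> HS y).
  { intros y Hy. apply HS_elt with (e b); auto. rewrite HB; apply elt_cset; auto. }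
  assert (HN : HS (cset g)).
  { apply HS_intro with m; auto.
    - intros z Hz; apply Hg in Hz as (x & Hx & y & _ & Hy & ->). apply HS_opr; auto.
    - intros i c c' Hi Hc Hc' Hcm Hcm' z Hz.
      apply Hg in Hz as (x & Hx & y & H & Hy & ->).
      destruct (Hsym i c c' x y) as (x' & y' & Hx' & Hy' & H' & H1 & H2); auto.
      exists (opr x' y'); split; [apply Hopr; auto|].
      apply Act_opr; auto using transp_inj. }
  unfold equinumerous. cbn [satHS]. exists (cset g). split; [exact HN|].
  unfold is_bijection, AllIn, ExIn, IsSet, Ur; cbn [satHS scons]; rewrite HA, HB.
  repeat split.
  - apply cset_not_atom.
  - intros z Hz H. apply elt_cset in H. apply Hg in H as (x & Hx & y & HRxy & Hy & ->).
    exists x; split; [auto|split; [apply elt_cset; auto|]].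
    exists y; split; [auto|split; [apply elt_cset; auto|]].
    apply sat_is_opair; auto 10 using HS_scons.
  - intros x Hx H. apply elt_cset in H. destruct (Rt x H) as (y & Hy & HRxy).
    exists y; split; [auto|split].
    + apply sat_opair_in; auto 10 using HS_scons. apply elt_cset, Hopr; auto.
    + intros y' Hy' H'. apply sat_opair_in in H'; auto 10 using HS_scons.
      apply elt_cset, Hopr in H' as (_ & _ & H'). simpl in H'. eauto.
  - intros y Hy H. apply elt_cset in H. destruct (Rs y H) as (x & Hx & HRxy).
    exists x; split; [auto|split].
    + apply sat_opair_in; auto 10 using HS_scons. apply elt_cset, Hopr; auto.
    + intros x' Hx' H'. apply sat_opair_in in H'; auto 10 using HS_scons.
      apply elt_cset, Hopr in H' as (_ & _ & H'). simpl in H'. eauto.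
Qed.

Lemma Pure_of_transitive x : HS x ->
  (forall u, HS u -> elt u x -> forall v, HS v -> elt v u -> elt v x) ->
  (forall u, HS u -> elt u x -> ~ is_atom u) -> forall u, elt u x -> Pure u.
Proof.
  intros Hx HT HP.
  enough (H : forall u, HS u -> elt u x -> Pure u) by eauto using HS_elt.
  apply (HS_ind (Q := fun u => elt u x -> Pure u)).
  - def.
  - intros u Hu Hux. destruct (HP u); auto. apply (HS_elt Hx Hux).
  - intros c _ HcN IH Hc. apply Pure_cset. intros u Hu. apply IH; auto.
    apply HT with (cset c); auto; [apply (HS_elt Hx Hc)|apply elt_cset; auto].
Qed.

(** Only labels vary: the urelements [(0, 0, u)], for [u] in the cardinal, share the support
    [succ zero], and the pure [u] are moved by nothing. *)
Lemma sym_Plenitude : holds_in sym_model Plenitude.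
Proof.
  apply holds_satHS. intros e He x Hx [(HxS & HxT & HxP & _) _].
  destruct (HS_code Hx HxS) as [d ->]. simpl in HxT, HxP.
  assert (HdN : forall u, mem u d -> HS u).
  { intros u Hu; apply (HS_elt Hx), elt_cset; auto. }
  assert (HdP : forall u, mem u d -> Pure u).
  { intros u Hu. apply (Pure_of_transitive Hx HxT HxP). apply elt_cset; auto. }
  destruct (@image_in M HM d (fun u y => y = atom zero zero u)) as [A HA]; [def| |].
  { intros; congruence. }
  set (m := succ (zero : M)).
  assert (Hm : mem m Nats) by apply nat_succ, nat_zero.
  assert (H0 : elt zero m) by (apply elt_succ; auto using nat_zero).
  assert (HAS : forall u, mem u A -> HS u /\ Supp m u).
  { intros u Hu; apply HA in Hu as (a & Ha & ->). split.
    - apply HS_atom; auto using nat_zero.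
    - apply Supp_atom; auto using nat_zero. }
  destruct (HS_of_Supp Hm HAS) as [HAN _].
  exists (cset A). split; [exact HAN|split].
  - split; [apply cset_not_atom|]. intros u Hu HuA. simpl in HuA |- *.
    apply elt_cset, HA in HuA as (a & Ha & ->). exists zero, zero, a; auto using nat_zero.
  - apply sat_equinumerous with (R := fun y u => y = atom zero zero u) (A := A) (B := d) (m := m);
      auto using HS_scons.
    + def.
    + intros y u u' -> E; apply atom_inj in E; tauto.
    + intros y y' u -> ->; auto.
    + intros y Hy; apply HA in Hy as (u & Hu & ->); eauto.
    + intros u Hu. exists (atom zero zero u); split; auto. apply HA; eauto.
    + intros i c c' y u Hi Hc Hc' Hcm Hcm' Hy Hu ->.
      exists (atom zero zero u), u. repeat split; auto.
      * apply HAS; auto.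
      * apply Act_pure; auto using transp_inj.
Qed.

Lemma cset_not_mem d : ~ mem (cset d) d.
Proof.
  intros H. destruct (@foundation_in M HM (upair d (cset d))) as (x & Hx & Hmin).
  { exists d; apply in_upair; auto. }
  apply in_upair in Hx as [->| ->].
  - apply (Hmin (cset d)); auto. apply in_upair; auto.
  - apply (Hmin d); [apply mem_code|]. apply in_upair; auto.
Qed.

(** Exchanges act on indices only, so they commute with replacing each label [a] by the pair of a
    tag [t] and [a]. A tag that no label in [d] carries makes the copy disjoint. *)
Lemma sym_Duplication : holds_in sym_model Duplication.
Proof.
  apply holds_satHS. intros e He x Hx [HxS HxU]. simpl in HxU.
  destruct (HS_code Hx HxS) as [d ->].
  assert (HdU : forall u, mem u d -> is_atom u).
  { intros u Hu. assert (elt u (cset d)) by (apply elt_cset; auto).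
    apply HxU; auto. eapply HS_elt; eauto. }
  destruct (HS_Sym Hx) as (m & Hm & HmS).
  destruct (@image_in M HM d (fun u t => Pure t /\ exists i b a, u = atom i b (opr t a)))
    as [T HT]; [def| |].
  { intros u t t' _ (_ & i & b & a & ->) (_ & j & c & a' & E).
    apply atom_inj in E as (_ & _ & E). apply opr_inj in E; tauto. }
  (* The code of the set of tags in use is not itself in use, by foundation. *)
  set (t := cset T).
  assert (Htp : Pure t) by (apply Pure_cset; intros u Hu; apply HT in Hu as (_ & _ & Hu & _); auto).
  assert (Ht : forall i b a, ~ mem (atom i b (opr t a)) d).
  { intros i b a H. apply (@cset_not_mem T). apply HT. eauto 8. }
  set (R := fun y u => exists i b a, y = atom i b (opr t a) /\ u = atom i b a).
  destruct (@image_in M HM d (fun u y => R y u)) as [A HA]; [unfold R; def| |].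
  { intros u y y' _ (i & b & a & -> & ->) (j & c & a' & -> & E).
    apply atom_inj in E as (-> & -> & ->); auto. }
  assert (HRact : forall n i c c' y u, mem u d -> R y u -> mem n Nats -> Supp n (cset d) ->
    mem i Nats -> mem c Nats -> mem c' Nats -> ~ elt c n -> ~ elt c' n ->
    exists y' u', mem u' d /\ R y' u' /\
      Act (transp n i c c') y y' /\ Act (transp n i c c') u u').
  { intros n i c c' y u Hu (j & b & a & -> & ->) Hn HS' Hi Hc Hc' Hcn Hcn'.
    specialize (HS' i c c' Hi Hc Hc' Hcn Hcn').
    apply Act_cset in HS' as [F _]; [|apply transp_inj].
    destruct (F _ Hu) as (u' & Hu' & Huu). pose proof Huu as Huu'.
    apply Act_atom in Huu' as (j' & b' & -> & Hj); [|apply transp_inj].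
    exists (atom j' b' (opr t a)), (atom j' b' a). split; [auto|split; [exists j', b', a; auto|]].
    split; auto. apply Act_atom; [apply transp_inj|]. eauto. }
  assert (HAN : HS (cset A)).
  { apply HS_intro with m; auto.
    - intros y Hy. apply HA in Hy as (u & Hu & i & b & a & -> & ->).
      destruct (HdU _ Hu) as (i' & b' & a' & E & Hi & Hb & Ha).
      apply atom_inj in E as (-> & -> & ->). apply HS_atom; auto using Pure_opr.
    - intros i c c' Hi Hc Hc' Hcm Hcm' y Hy. apply HA in Hy as (u & Hu & HR).
      destruct (HRact m i c c' y u) as (y' & u' & Hu' & HR' & H1 & H2); auto.
      exists y'; split; auto. apply HA; eauto. }
  exists (cset A). split; [exact HAN|split; [|split]].
  - split; [apply cset_not_atom|]. intros y Hy HyA. simpl in HyA |- *.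
    apply elt_cset, HA in HyA as (u & Hu & i & b & a & -> & ->).
    destruct (HdU _ Hu) as (i' & b' & a' & E & Hi & Hb & Ha).
    apply atom_inj in E as (-> & -> & ->). exists i', b', (opr t a'); auto using Pure_opr.
  - intros y Hy HyA Hyd. simpl in HyA, Hyd. apply elt_cset in Hyd.
    apply elt_cset, HA in HyA as (u & Hu & i & b & a & -> & ->). apply (Ht _ _ _ Hyd).
  - apply sat_equinumerous with (R := R) (A := A) (B := d) (m := m); auto using HS_scons.
    + unfold R; def.
    + intros y u u' (i & b & a & -> & ->) (i' & b' & a' & E & ->).
      apply atom_inj in E as (-> & -> & E). apply opr_inj in E as [_ ->]; auto.
    + intros y y' u (i & b & a & -> & ->) (i' & b' & a' & -> & E).
      apply atom_inj in E as (-> & -> & ->); auto.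
    + intros y Hy; apply HA in Hy as (u & Hu & HR); eauto.
    + intros u Hu. destruct (HdU _ Hu) as (i & b & a & -> & _).
      exists (atom i b (opr t a)). unfold R; split; [apply HA; exists (atom i b a)|];
        unfold R; eauto 8.
    + intros i c c' y u Hi Hc Hc' Hcm Hcm' Hy Hu HR.
      destruct (HRact m i c c' y u) as (y' & u' & Hu' & HR' & H1 & H2); auto.
      exists y', u'. repeat split; auto. apply HA; eauto.
Qed.

End PlenitudeDuplication.
(** * Failure of Collection *)

Section FormulaPhi.
Local Open Scope fo_scope.

(* The relation [g] need not be functional. *)
Definition inj_into (g b c : nat) : form ur_symbol :=
  AllIn b (ExIn (S c) (opair_in 1 0 (S (S g)))) /\
  AllIn b (AllIn (S b) (All (opair_in 2 0 (S (S (S g))) -->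
    opair_in 1 0 (S (S (S g))) --> 2 == 1))).

(** Thinness disregards how many labels occur: members of such a transitive set are pure, and no
    exchange moves them, so only the exchanged coordinate can prevent an injection. *)
Definition thin (b : nat) : form ur_symbol :=
  Ex (Ex (transitive 1 /\ AllIn 1 (IsSet 0) /\ inj_into 0 (S (S b)) 1)).

Definition unrelated (b c : nat) : form ur_symbol :=
  All (All (subset 1 (S (S b)) --> inj_into 0 1 (S (S c)) --> thin 1)).

(* The free variables are the family, 0, and its index set, 1. *)
Definition thick_family : form ur_symbol :=
  AllIn 1 (Ex (opair_in 1 0 2 /\ AllIn 0 (Ur 0) /\ ~ thin 0)) /\
  AllIn 1 (AllIn 2 (~ 1 == 0 -->
    All (All (opair_in 3 1 4 --> opair_in 2 0 4 --> unrelated 1 0)))).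

End FormulaPhi.

Section Collection.
Context {M : structure Empty_set} {HM : ZFModel M}.
Implicit Types (x y z u v w d i j k m s a : M) (e : nat -> M).

Definition Inj g b c : Prop :=
  (forall x : M, HS x -> elt x b -> exists z, HS z /\ elt z c /\ elt (opr x z) g) /\
  (forall x, HS x -> elt x b -> forall y, HS y -> elt y b -> forall z, HS z ->
    elt (opr x z) g -> elt (opr y z) g -> x = y).

Definition Thin b : Prop := exists t : M, HS t /\ exists g, HS g /\
  (forall u, HS u -> elt u t -> forall v, HS v -> elt v u -> elt v t) /\
  (forall u, HS u -> elt u t -> ~ is_atom u) /\ Inj g b t.

Definition Unrelated b c : Prop := forall d, HS d -> forall g, HS g ->
  (forall u, HS u -> elt u d -> elt u b) -> Inj g d c -> Thin d.

Definition ThickFamily n y : Prop :=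
  (forall i, HS i -> elt i n -> exists b, HS b /\ elt (opr i b) y /\
    (forall u, HS u -> elt u b -> is_atom u) /\ ~ Thin b) /\
  (forall i, HS i -> elt i n -> forall j, HS j -> elt j n -> i <> j ->
    forall b, HS b -> forall c, HS c -> elt (opr i b) y -> elt (opr j c) y -> Unrelated b c).

Lemma all_iff (A B : M -> Prop) : (forall x, HS x -> A x <-> B x) ->
  (forall x, HS x -> A x) <-> (forall x, HS x -> B x).
Proof. intros H; split; intros H' x Hx; apply H; auto. Qed.

Lemma ex_iff (A B : M -> Prop) : (forall x, HS x -> A x <-> B x) ->
  (exists x, HS x /\ A x) <-> (exists x, HS x /\ B x).
Proof. intros H; split; intros (x & Hx & H'); exists x; split; auto; apply H; auto. Qed.

Lemma imp_iff (A B A' B' : Prop) : (A <-> A') -> (B <-> B') -> (A -> B) <-> (A' -> B').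
Proof. tauto. Qed.

Lemma and_iff (A B A' B' : Prop) : (A <-> A') -> (B <-> B') -> (A /\ B) <-> (A' /\ B').
Proof. tauto. Qed.

Ltac sat_steps := cbn [satHS AllIn ExIn subset transitive IsSet Ur]; repeat
  lazymatch goal with
  | |- _ /\ _ <-> _ /\ _ => apply and_iff
  | |- (exists _, _) <-> _ => apply ex_iff; intros
  | |- (forall _ : dom _, _) <-> _ => apply all_iff; intros
  | |- satHS _ (opair_in _ _ _) <-> _ =>
      rewrite sat_opair_in by auto 12 using HS_scons; reflexivity
  | |- satHS _ _ <-> _ => fail
  | |- (_ -> _) <-> (_ -> _) => apply imp_iff
  | |- _ => reflexivity
  end.

Lemma sat_inj_into e (g b c : nat) : (forall n, HS (e n)) ->
  satHS e (inj_into g b c) <-> Inj (e g) (e b) (e c).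
Proof. intros He. unfold inj_into, Inj. sat_steps. Qed.

Lemma sat_thin e (b : nat) : (forall n, HS (e n)) -> satHS e (thin b) <-> Thin (e b).
Proof.
  intros He. unfold thin, Thin. sat_steps. rewrite sat_inj_into by auto 12 using HS_scons; reflexivity.
Qed.

Lemma sat_unrelated e (b c : nat) : (forall n, HS (e n)) ->
  satHS e (unrelated b c) <-> Unrelated (e b) (e c).
Proof.
  intros He. unfold unrelated, Unrelated. sat_steps.
  - rewrite sat_inj_into by auto 12 using HS_scons; reflexivity.
  - rewrite sat_thin by auto 12 using HS_scons; reflexivity.
Qed.

Lemma sat_thick_family e : (forall n, HS (e n)) ->
  satHS e thick_family <-> ThickFamily (e 1) (e 0).
Proof.
  intros He. unfold thick_family, ThickFamily. sat_steps.
  - rewrite sat_thin by auto 12 using HS_scons; reflexivity.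
  - rewrite sat_unrelated by auto 12 using HS_scons; reflexivity.
Qed.

Lemma nat_fresh m n : mem m Nats -> mem n Nats -> exists k, mem k Nats /\
  ~ elt k m /\ k <> n.
Proof.
  intros Hm Hn. destruct (nat_bound Hm Hn) as (k & Hk & _ & Hnk & H1 & _).
  exists k; split; [auto|split].
  - intros H. apply (nat_irrefl Hk); apply H1; auto.
  - intros ->. apply (nat_irrefl Hn Hnk).
Qed.

Lemma Act_transp_atom m i c c' a : elt i m -> mem c Nats -> mem c' Nats ->
  Act (transp m i c c') (atom i c a) (atom i c' a).
Proof.
  intros. apply Act_atom; [apply transp_inj|]. exists i, c'; split; auto.
  unfold transp; tauto.
Qed.

Lemma Act_transp_other m i j b c c' a : elt j m -> mem b Nats -> j <> i ->
  Act (transp m i c c') (atom j b a) (atom j b a).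
Proof.
  intros. apply Act_atom; [apply transp_inj|]. exists j, b; split; auto.
  unfold transp; tauto.
Qed.

(** Values in the transitive set are pure. A transposition beyond the support of [g] fixes the value
    at [(k, c, a)] and moves the argument, so two arguments share a value. *)
Lemma not_Thin b k s a : mem k Nats -> mem s Nats -> Pure a ->
  (forall c, mem c Nats -> ~ elt c s -> elt (atom k c a) b) -> ~ Thin b.
Proof.
  intros Hk Hs Ha Hb (t & Ht & g & Hg & HtT & HtS & Hg1 & Hg2).
  destruct (HS_Sym Hg) as (m & Hm & HmS).
  destruct (nat_bound Hm Hs) as (n & Hn & _ & _ & Hmn & Hsn).
  destruct (nat_fresh Hn nat_zero) as (c & Hc & Hcn & _).
  destruct (nat_fresh Hn Hc) as (c' & Hc' & Hcn' & Hne).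
  assert (Hx : elt (atom k c a) b) by (apply Hb; auto).
  assert (Hx' : elt (atom k c' a) b) by (apply Hb; auto).
  destruct (Hg1 (atom k c a)) as (z & Hz & Hzt & Hxz); [apply HS_atom; auto|auto|].
  assert (Hxz' : elt (opr (atom k c' a) z) g).
  { revert Hxz. refine (proj1 (Act_elt (t := transp omega k c c') _ _ _)); try apply transp_inj.
    - apply Act_opr; [apply transp_inj| |].
      + apply Act_transp_atom; auto. apply elt_omega; auto.
      + apply Act_pure; [apply transp_inj|]. apply (Pure_of_transitive Ht HtT HtS Hzt).
    - apply Supp_transp with m; auto. }
  apply Hne. assert (E : atom k c' a = atom k c a).
  { apply (Hg2 _ (HS_atom Hk Hc' Ha) Hx' _ (HS_atom Hk Hc Ha) Hx z Hz); auto. }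
  apply atom_inj in E; tauto.
Qed.

(** The urelements in [b] all have support [s], so the graph sending [(i, c, a)] to the
    corresponding pure triple is symmetric. A transitive set around the image is the target. *)
Lemma bounded_Thin b s : mem s Nats -> HS b ->
  (forall u, elt u b -> exists i c a, u = atom i c a /\ elt i s /\ elt c s /\ Pure a) -> Thin b.
Proof.
  intros Hs Hb Hbs.
  set (R := fun u v => elt u b /\ exists i c a, u = atom i c a /\ v = opr (opr i c) a).
  assert (Rfun : forall u v v', R u v -> R u v' -> v = v').
  { intros u v v' (_ & i & c & a & -> & ->) (_ & j & c' & a' & E & ->).
    apply atom_inj in E as (-> & -> & ->); auto. }
  assert (Rinj : forall u u' v, R u v -> R u' v -> u = u').
  { intros u u' v (_ & i & c & a & -> & ->) (_ & j & c' & a' & -> & E).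
    apply opr_inj in E as (E & ->). apply opr_inj in E as (-> & ->); auto. }
  assert (Rpure : forall u v, R u v -> Pure v /\ Supp s u).
  { intros u v (Hu & i & c & a & -> & ->).
    destruct (Hbs _ Hu) as (i' & c' & a' & E & Hi & Hc & Ha).
    apply atom_inj in E as (-> & -> & ->). pose proof (nat_down Hs Hi).
    pose proof (nat_down Hs Hc). split; [auto using Pure_opr, Pure_nat|apply Supp_atom; auto]. }
  assert (RD : Def (fun e => R (e 0) (e 1))) by (unfold R; def).
  destruct (@image_in M HM (union_of b) R RD) as [d Hd]; [intros u v v' _; apply Rfun|].
  assert (HdP : Pure (cset d)).
  { apply Pure_cset; intros v Hv; apply Hd in Hv as (u & _ & HR); apply (Rpure _ _ HR). }
  destruct (Pure_closure HdP) as (w & Hw & Hwt).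
  assert (HwP : HS (cset w)) by (apply HS_pure, Pure_cset; intros u Hu; apply Hwt; auto).
  destruct (@image_in M HM (union_of b) (fun u z => exists v, R u v /\ z = opr u v)) as [g Hg];
    [def| |].
  { intros u z z' _ (v & Hv & ->) (v' & Hv' & ->). rewrite (Rfun u v v'); auto. }
  assert (Hgo : forall u v, elt (opr u v) (cset g) <-> R u v).
  { intros u v. rewrite elt_cset, Hg. split.
    - intros (u' & _ & v' & HR & E). apply opr_inj in E as [-> ->]; auto.
    - intros HR; exists u; split; [apply elt_union, HR|eauto]. }
  assert (HgN : HS (cset g)).
  { apply (@HS_of_Supp M HM s); auto. intros z Hz; apply Hg in Hz as (u & _ & v & HR & ->).
    destruct (Rpure _ _ HR) as [Hv Hu]. split; [|auto using Supp_opr, Supp_pure].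
    apply HS_opr; [apply (HS_elt Hb), HR|apply HS_pure; auto]. }
  exists (cset w); split; [auto|]. exists (cset g). split; [auto|].
  assert (Hsub : forall u, elt u (cset w) -> forall v, elt v u -> elt v (cset w)).
  { intros u Hu v Hv. apply elt_cset in Hu. destruct (Hwt u Hu) as (_ & d' & -> & Hd').
    apply elt_cset in Hv. apply elt_cset; auto. }
  split; [eauto|split; [|split]].
  - intros u _ Hu. apply elt_cset in Hu. destruct (Hwt u Hu) as (_ & d' & -> & _).
    apply cset_not_atom.
  - intros u _ Hu. destruct (Hbs u Hu) as (i & c & a & -> & _).
    assert (HR : R (atom i c a) (opr (opr i c) a)) by (split; eauto 6).
    assert (Hin : elt (opr (opr i c) a) (cset w)).
    { apply Hsub with (cset d); [apply elt_cset; auto|]. apply elt_cset, Hd.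
      exists (atom i c a); split; auto. apply elt_union; auto. }
    exists (opr (opr i c) a). split; [apply (HS_elt HwP Hin)|].
    split; [auto|apply Hgo; auto].
  - intros u _ _ u' _ _ v _ H1 H2. apply Hgo in H1, H2. eauto.
Qed.

Definition is_piece i d : Prop := forall u, mem u d <-> exists c, mem c Nats /\ u = atom i c zero.

Lemma piece_exists i : exists d, is_piece i d.
Proof.
  destruct (@image_in M HM Nats (fun c u => u = atom i c zero)) as [d Hd]; [def|congruence|].
  exists d; exact Hd.
Qed.

Lemma transp_total m i c c' j b : mem c Nats -> mem c' Nats -> elt j m -> mem b Nats ->
  exists b', mem b' Nats /\ transp m i c c' j b j b'.
Proof.
  intros. unfold transp.
  destruct (classic (j = i)) as [->|]; [|exists b; tauto].
  destruct (classic (b = c)) as [->|]; [exists c'; tauto|].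
  destruct (classic (b = c')) as [->|]; [exists c; tauto|exists b; tauto].
Qed.

Lemma HS_piece m i d : mem m Nats -> elt i m -> is_piece i d -> HS (cset d) /\ Supp m (cset d).
Proof.
  intros Hm Hi Hd. pose proof (nat_down Hm Hi) as HiN. apply HS_intro; auto.
  - intros u Hu; apply Hd in Hu as (c & Hc & ->). apply HS_atom; auto using Pure_nat, nat_zero.
  - intros i' c c' Hi' Hc Hc' _ _ u Hu. apply Hd in Hu as (b & Hb & ->).
    destruct (transp_total i' Hc Hc' Hi Hb) as (b' & Hb' & Ht).
    exists (atom i b' zero). split; [apply Hd; eauto|].
    apply Act_atom; eauto using transp_inj.
Qed.

(** Exchanges within piece [i] leave piece [j] pointwise fixed, so an argument [(i, c, 0)] with [c]
    beyond all supports would share its value with another one. Hence the subset is bounded. *)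
Lemma pieces_unrelated i j d d' : mem i Nats -> mem j Nats -> i <> j ->
  is_piece i d -> is_piece j d' -> Unrelated (cset d) (cset d').
Proof.
  intros Hi Hj Hij Hd Hd' x Hx g Hg Hsub [Hg1 Hg2].
  destruct (HS_Sym Hx) as (m & Hm & HmS). destruct (HS_Sym Hg) as (m' & Hm' & HmS').
  destruct (nat_bound Hm Hm') as (n & Hn & _ & _ & H1 & H2).
  destruct (nat_bound Hn Hi) as (s & Hs & _ & His & H3 & _).
  apply bounded_Thin with s; auto. intros u Hu. assert (HuN := HS_elt Hx Hu).
  pose proof (Hsub u HuN Hu) as Hud. apply elt_cset, Hd in Hud as (c & Hc & ->).
  exists i, c, zero. split; [auto|split; [auto|split; [|apply Pure_nat, nat_zero]]].
  apply NNPP; intros Hcs.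
  destruct (nat_fresh Hs Hc) as (c' & Hc' & Hcs' & Hne).
  destruct (Hg1 _ HuN Hu) as (z & Hz & Hzd & Hcz).
  apply elt_cset, Hd' in Hzd as (b & Hb & ->).
  assert (HS1 : Act (transp omega i c c') x x).
  { apply Supp_transp with s; auto. apply (Supp_mono H3), (Supp_mono H1), HmS. }
  assert (HS2 : Act (transp omega i c c') g g).
  { apply Supp_transp with s; auto. apply (Supp_mono H3), (Supp_mono H2), HmS'. }
  assert (Hat : Act (transp omega i c c') (atom i c zero) (atom i c' zero)).
  { apply Act_transp_atom; auto. apply elt_omega; auto. }
  assert (Hu' : elt (atom i c' zero) x) by
    (apply (Act_elt (transp_inj _ _ _ _) Hat HS1), Hu).
  assert (Hcz' : elt (opr (atom i c' zero) (atom j b zero)) g).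
  { revert Hcz. refine (proj1 (Act_elt (t := transp omega i c c') _ _ _)); try apply transp_inj; auto.
    apply Act_opr; [apply transp_inj|auto|].
    apply Act_transp_other; auto. apply elt_omega; auto. }
  apply Hne. assert (E : atom i c' zero = atom i c zero).
  { apply (Hg2 _ (HS_elt Hx Hu') Hu' _ HuN Hu _ Hz); auto. }
  apply atom_inj in E; tauto.
Qed.

(** The family consists of the copy [zero] of each piece below [n]. It has support [n]; that a bound
    of this kind cannot be avoided is the content of [no_long_thick_family]. *)
Lemma thick_family_exists n : mem n Nats -> exists y, HS y /\ ThickFamily n y.
Proof.
  intros Hn. destruct (@image_in M HM Nats (fun i z => elt i n /\
    exists d, is_piece i d /\ z = opr i (cset d))) as [w Hw]; [unfold is_piece; def| |].
  { intros i z z' _ (_ & d & Hd & ->) (_ & d' & Hd' & ->). do 2 f_equal.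
    apply set_ext; intros u. rewrite (Hd u), (Hd' u); tauto. }
  assert (Hwo : forall i b, elt (opr i b) (cset w) <->
    elt i n /\ exists d, is_piece i d /\ b = cset d).
  { intros i b. rewrite elt_cset, Hw. split.
    - intros (i' & _ & Hi & d & Hd & E). apply opr_inj in E as [-> ->]; eauto.
    - intros (Hi & d & Hd & ->). exists i; split; [apply (nat_down Hn Hi)|eauto]. }
  exists (cset w). split.
  - apply (@HS_of_Supp M HM n); auto. intros z Hz. apply Hw in Hz as (i & Hi & Hin & d & Hd & ->).
    destruct (HS_piece Hn Hin Hd). split.
    + apply HS_opr; auto using HS_pure, Pure_nat.
    + apply Supp_opr; auto using Supp_pure, Pure_nat.
  - split.
    + intros i _ Hi. pose proof (nat_down Hn Hi) as HiN. destruct (piece_exists i) as [d Hd].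
      exists (cset d). split; [apply (HS_piece Hn Hi Hd)|].
      split; [apply Hwo; eauto|split].
      * intros u _ Hu. apply elt_cset, Hd in Hu as (c & Hc & ->).
        exists i, c, zero; auto 8 using Pure_nat, nat_zero.
      * apply not_Thin with i zero zero; auto using nat_zero, Pure_nat.
        intros c Hc _. apply elt_cset, Hd; eauto.
    + intros i _ Hi j _ Hj Hij b _ c _ Hb Hc.
      apply Hwo in Hb as (_ & d & Hd & ->). apply Hwo in Hc as (_ & d' & Hd' & ->).
      apply pieces_unrelated with i j; auto; eapply nat_down; eauto.
Qed.

(* [b] contains the copy at [a] of piece [k] up to finitely many urelements. *)
Definition almost_contains b k s a : Prop := mem s Nats /\ Pure a /\
  forall c, mem c Nats -> ~ elt c s -> elt (atom k c a) b.

(** [k] is found below [m], while [s] depends on the support of [b], over which [m] gives no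
    control. One urelement with value beyond [s] brings along all others of its piece and label;
    without any, [b] is bounded and so thin. *)
Lemma almost_contains_piece b m : HS b -> mem m Nats -> Act (keep m) b b ->
  (forall u, HS u -> elt u b -> is_atom u) -> ~ Thin b ->
  exists k, elt k m /\ exists s a, almost_contains b k s a.
Proof.
  intros Hb Hm Hbm HbU Hthin. apply NNPP; intros Hno. apply Hthin.
  destruct (HS_Sym Hb) as (m' & Hm' & HmS).
  destruct (nat_bound Hm Hm') as (s & Hs & _ & _ & H1 & H2).
  apply bounded_Thin with s; auto. intros u Hu.
  destruct (HbU u (HS_elt Hb Hu) Hu) as (i & c & a & -> & Hi & Hc & Ha).
  assert (Him : elt i m).
  { pose proof (Act_keep_elt Hbm Hu) as H.
    apply Act_atom in H as (i' & c' & _ & H); [|apply transp_inj]. apply H. }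
  exists i, c, a. split; [auto|split; [auto|split; [|auto]]].
  apply NNPP; intros Hcs. apply Hno. exists i; split; auto. exists s, a.
  split; [auto|split; [auto|]]. intros c' Hc' Hcs'.
  revert Hu. refine (proj1 (Act_elt (t := transp omega i c c') _ _ _)); try apply transp_inj.
  - apply Act_transp_atom; auto. apply elt_omega; auto.
  - apply Supp_transp with s; auto. apply (Supp_mono H2 HmS).
Qed.

(** Changing the label [a] to [a'] is an injection commuting with every exchange. Beyond a common
    bound it relates a part of [b], not thin by [not_Thin], to [c]. *)
Lemma almost_contains_related b c k s s' a a' : mem k Nats ->
  almost_contains b k s a -> almost_contains c k s' a' -> ~ Unrelated b c.
Proof.
  intros Hk (Hs & Ha & Hb) (Hs' & Ha' & Hc) Hun.
  destruct (nat_bound Hs Hs') as (s1 & Hs1 & _ & _ & H1 & H2).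
  destruct (nat_bound Hs1 Hk) as (n & Hn & _ & Hkn & H3 & _).
  destruct (@image_in M HM Nats (fun q u => ~ elt q n /\ u = atom k q a)) as [d Hd]; [def| |].
  { intros q u u' _ [_ ->] [_ ->]; auto. }
  destruct (@image_in M HM Nats (fun q z => ~ elt q n /\ z = opr (atom k q a) (atom k q a')))
    as [g Hg]; [def| |].
  { intros q z z' _ [_ ->] [_ ->]; auto. }
  (* The new value [q'] is independent of the label, so both components of a pair in [g] move
     together. *)
  assert (Hmove : forall i b c q, mem b Nats -> mem c Nats -> ~ elt b n -> ~ elt c n ->
    mem q Nats -> ~ elt q n -> exists q', mem q' Nats /\ ~ elt q' n /\
      forall a, Act (transp n i b c) (atom k q a) (atom k q' a)).
  { intros i b' c' q Hb' Hc' Hbn Hcn Hq Hqn.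
    destruct (transp_total i Hb' Hc' Hkn Hq) as (q' & Hq' & Ht).
    exists q'; split; [auto|split].
    - destruct Ht as (_ & _ & _ & _ & [(_ & _ & ->)|[(_ & _ & ->)|(-> & _)]]); auto.
    - intros a0. apply Act_atom; eauto using transp_inj. }
  assert (HdN : HS (cset d)).
  { apply HS_intro with n; auto.
    - intros u Hu; apply Hd in Hu as (q & Hq & _ & ->). apply HS_atom; auto.
    - intros i b' c' _ Hb' Hc' Hbn Hcn u Hu. apply Hd in Hu as (q & Hq & Hqn & ->).
      destruct (Hmove i b' c' q) as (q' & Hq' & Hqn' & H); auto.
      exists (atom k q' a); split; [apply Hd; eauto|auto]. }
  assert (HgN : HS (cset g)).
  { apply HS_intro with n; auto.
    - intros u Hu; apply Hg in Hu as (q & Hq & _ & ->). apply HS_opr; apply HS_atom; auto.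
    - intros i b' c' _ Hb' Hc' Hbn Hcn u Hu. apply Hg in Hu as (q & Hq & Hqn & ->).
      destruct (Hmove i b' c' q) as (q' & Hq' & Hqn' & H); auto.
      exists (opr (atom k q' a) (atom k q' a')); split; [apply Hg; eauto|].
      apply Act_opr; auto using transp_inj. }
  apply (@not_Thin (cset d) k n a); auto.
  { intros q Hq Hqn. apply elt_cset, Hd; eauto. }
  apply (Hun _ HdN _ HgN).
  - intros u _ Hu. apply elt_cset, Hd in Hu as (q & Hq & Hqn & ->).
    apply Hb; auto.
  - split.
    + intros u _ Hu. apply elt_cset, Hd in Hu as (q & Hq & Hqn & ->).
      exists (atom k q a'). split; [apply HS_atom; auto|split].
      * apply Hc; auto.
      * apply elt_cset, Hg; eauto.
    + intros u _ _ u' _ _ z _ Hz Hz'.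
      apply elt_cset, Hg in Hz as (q & _ & _ & E). apply elt_cset, Hg in Hz' as (q' & _ & _ & E').
      apply opr_inj in E as [-> ->]. apply opr_inj in E' as [-> E'].
      apply atom_inj in E' as (_ & -> & _); auto.
Qed.

Lemma no_long_thick_family m y : mem m Nats -> HS y -> Act (keep m) y y ->
  ~ ThickFamily (succ m) y.
Proof.
  intros Hm Hy Hym [HF1 HF2].
  assert (HsN : forall i, elt i (succ m) -> HS i).
  { intros i Hi. apply HS_pure, Pure_nat. apply (nat_down (nat_succ Hm) Hi). }
  pose proof HS_def.
  destruct (@relation_set M HM (fun i k => exists b, HS b /\ elt (opr i b) y /\
    exists s a, almost_contains b k s a)) as [r Hr]; [unfold almost_contains; def|].
  destruct (@pigeonhole M HM m Hm r) as (i & j & k & Hi & Hj & Hij & H1 & H2).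
  - intros i Hi. destruct (HF1 i (HsN i Hi) Hi) as (b & Hb & Hib & HbU & Hthin).
    destruct (@almost_contains_piece b m) as (k & Hk & Hka); auto.
    + pose proof (Act_keep_elt Hym Hib) as H1.
      assert (H2 : elt (upr i b) (opr i b)) by (apply elt_upr; auto).
      pose proof (Act_keep_elt H1 H2) as H3.
      apply (Act_keep_elt H3). apply elt_upr; auto.
    + exists k; split; auto. apply Hr.
      split; [apply (nat_down (nat_succ Hm) Hi)|split; [apply (nat_down Hm Hk)|exists b; auto]].
  - apply Hr in H1 as (_ & Hk & b & Hb & Hib & s & a & Hba).
    apply Hr in H2 as (_ & _ & c & Hc & Hjc & s' & a' & Hca).
    apply (almost_contains_related Hk Hba Hca). apply (HF2 i) with j; auto.
Qed.

Lemma sym_not_Collection : ~ models sym_model Collection.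
Proof.
  intros H. specialize (H (collection thick_family) (ex_intro _ thick_family eq_refl)).
  assert (H0 : forall n : nat, HS ((fun _ => zero : M) n)).
  { intros _; apply HS_pure, Pure_nat, nat_zero. }
  assert (Hom : HS (omega : M)) by apply HS_pure, Pure_omega.
  apply (proj1 (holds_closure_satHS _)) with (e := fun _ => zero) in H; auto.
  specialize (H omega Hom). cbn [satHS AllIn ExIn] in H. destruct H as (v & Hv & H).
  - intros n Hn Hnom. apply elt_omega in Hnom.
    destruct (thick_family_exists Hnom) as (y & Hy & HF). exists y; split; auto.
    apply satHS_rename, sat_thick_family; auto.
    intros k. auto 10 using HS_scons.
  (* Members of [v] need not have support [m], but they involve only pieces below [m], too few for
     the family indexed by [succ m]. *)
  - destruct (HS_Sym Hv) as (m & Hm & HmS).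
    assert (Hsm := nat_succ Hm).
    destruct (H (succ m)) as (y & Hy & Hyv & HF).
    + apply HS_pure, Pure_nat; auto.
    + apply elt_omega; auto.
    + apply (proj1 (satHS_rename _ _ _)) in HF.
      apply sat_thick_family in HF; [|intros k; auto 10 using HS_scons, HS_pure, Pure_nat].
      apply (@no_long_thick_family m y); auto.
      apply (Act_keep_elt (Supp_keep Hm HmS) Hyv).
Qed.

End Collection.

Theorem theorem2p33 :
  consistent ZF ->
  exists M : structure ur_symbol,
    models M ZFUR /\ holds_in M Plenitude /\ holds_in M Duplication /\
    ~ models M Collection.
Proof.
  intros H. destruct (ZF_model H) as [M HM].
  assert (ZFModel M) by exact HM. exists sym_model.
  split; [exact sym_ZFUR|split; [exact sym_Plenitude|]].
  split; [exact sym_Duplication|exact sym_not_Collection].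
Qed.
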